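(* Let $X$ and $Y$ be independent random variables with $X$ non-degenerate, $E|X|<\infty$, $0<P\{Y>0\}\le P\{Y\ge0\}=1$, and let $(X_i,Y_i)$, $i\ge1$, be i.i.d. copies of $(X,Y)$. Assume $Y\in\mathcal{F}_c$ (the centered Feller class). Then for a suitable sequence of norming constants $a_n>0$, $a_n\to\infty$, any subsequence of $\{n\}$ contains a further subsequence $\{n'\}$ such that, with $W_{1,n}=\sum_{i=1}^nX_iY_i$ and $W_{2,n}=\sum_{i=1}^nY_i$, $$\left(\frac{W_{1,n'}}{a_{n'}},\frac{W_{2,n'}}{a_{n'}}\right)$$ converges in distribution to a non-degenerate random vector $(W_1,W_2)$ having a $C^\infty$ Lebesgue density $f$ on $\mathbb{R}^2$; consequently, along $\{n'\}$, $$T_{n'}=\frac{W_{1,n'}}{W_{2,n'}}\overset{\mathrm{D}}{\longrightarrow}\frac{W_1}{W_2}=:T,$$ and $T$ has a Lebesgue density $f_T$ on $\mathbb{R}$.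
   Context: Convention $0/0:=0$ in the definition of $T_n$. Feller class: a random variable $Y$ is in the Feller class $\mathcal{F}$ if there exist norming constants $a_n>0$ with $a_n\to\infty$ and centering constants $b_n\in\mathbb{R}$ such that, for $Y_1,Y_2,\dots$ i.i.d. copies of $Y$, every subsequence of $\{n\}$ contains a further subsequence $\{n'\}$ along which $a_{n'}^{-1}\{\sum_{i=1}^{n'}Y_i-b_{n'}\}$ converges in distribution to some non-degenerate random variable (which may depend on the subsequence). $Y$ is in the centered Feller class, $Y\in\mathcal{F}_c$, if this holds with $b_n=0$ for all $n\ge1$. *)

(* Defs.v *)
From HB Require Import structures.
From mathcomp Require Import all_boot all_order all_algebra.
From mathcomp Require Import finmap.
From mathcomp Require Import all_classical all_reals all_analysis.

Set Implicit Arguments.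
Unset Strict Implicit.
Unset Printing Implicit Defensive.

Import Order.TTheory GRing.Theory Num.Theory.
Import numFieldNormedType.Exports.

Local Open Scope classical_set_scope.
Local Open Scope ring_scope.

Definition independent_rvs (R : realType) (d d1 d2 : measure_display)
    (Omega : measurableType d) (P : probability Omega R)
    (T1 : measurableType d1) (T2 : measurableType d2)
    (X : Omega -> T1) (Y : Omega -> T2) : Prop :=
  forall (A : set T1) (B : set T2), measurable A -> measurable B ->
    P (X @^-1` A `&` Y @^-1` B) = (P (X @^-1` A) * P (Y @^-1` B))%E.

Definition mutually_independent (R : realType) (d d' : measure_display)
    (Omega : measurableType d) (P : probability Omega R)
    (T : measurableType d') (Z : nat -> Omega -> T) : Prop :=
  forall (J : {fset nat}) (A : nat -> set T), (forall i, measurable (A i)) ->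
    P (\bigcap_(i in [set` J]) Z i @^-1` A i) =
    (\prod_(i <- J) P (Z i @^-1` A i))%E.

Definition same_distribution (R : realType) (d d' d'' : measure_display)
    (Omega : measurableType d) (P : probability Omega R)
    (Omega' : measurableType d') (P' : probability Omega' R)
    (T : measurableType d'') (Z : Omega -> T) (Z' : Omega' -> T) : Prop :=
  forall A : set T, measurable A -> P (Z @^-1` A) = P' (Z' @^-1` A).

(* The copies of Z (defined under P) may live on another probability space. *)
Definition iid_copies (R : realType) (d d' d'' : measure_display)
    (Omega : measurableType d) (P : probability Omega R)
    (Omega' : measurableType d') (P' : probability Omega' R)
    (T : measurableType d'') (Z : Omega -> T) (Z_ : nat -> Omega' -> T) : Prop :=
  mutually_independent P' Z_ /\ forall i, same_distribution P P' Z (Z_ i).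

Definition nondegenerate_rv (R : realType) (d : measure_display)
    (Omega : measurableType d) (P : probability Omega R)
    (Z : Omega -> R) : Prop :=
  forall c : R, (P [set w | Z w = c] < 1)%E.

(* Non-degenerate in the sense of random vectors: the law of (Z1, Z2) is not
   carried by a line; this is stronger than (Z1, Z2) not being a.s. constant. *)
Definition nondegenerate_rvector (R : realType) (d : measure_display)
    (Omega : measurableType d) (P : probability Omega R)
    (Z1 Z2 : Omega -> R) : Prop :=
  forall u v c : R, (u, v) <> (0, 0) ->
    (P [set w | (u * Z1 w + v * Z2 w)%R = c] < 1)%E.

Definition cvg_in_distribution (R : realType) (d d' : measure_display)
    (Omega : measurableType d) (P : probability Omega R)
    (Omega' : measurableType d') (Q : probability Omega' R)
    (V : topologicalType) (Z : nat -> Omega -> V) (W : Omega' -> V) : Prop :=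
  forall g : V -> R, continuous g -> (exists M : R, forall x, `|g x| <= M) ->
    ('E_P[fun w => g (Z n w)] @[n --> \oo] --> 'E_Q[fun w => g (W w)])%E.

Definition strictly_increasing (phi : nat -> nat) : Prop :=
  {homo phi : m n / (m < n)%N}.

(* Being in the Feller class only depends on the law of Y; i.i.d. copies of Y
   are taken on arbitrary probability spaces.  Sums run over the first n
   copies Y_ 0, ..., Y_ n.-1. *)
Definition feller_constants (R : realType) (d : measure_display)
    (Omega : measurableType d) (P : probability Omega R) (Y : {RV P >-> R})
    (a b : nat -> R) : Prop :=
  [/\ forall n, 0 < a n, a n @[n --> \oo] --> +oo &
  forall (d' : measure_display) (Omega' : measurableType d')
    (P' : probability Omega' R) (Y_ : nat -> {RV P' >-> R}),
  iid_copies P P' Y Y_ ->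
  forall phi, strictly_increasing phi ->
  exists psi, strictly_increasing psi /\
  exists (d'' : measure_display) (Omega'' : measurableType d'')
    (Q : probability Omega'' R) (W : {RV Q >-> R}),
    nondegenerate_rv Q W /\
    cvg_in_distribution P' Q
      (fun k w => let n := phi (psi k) in
         (a n)^-1 * (\sum_(i < n) Y_ i w - b n)) W].

Definition feller_class (R : realType) (d : measure_display)
    (Omega : measurableType d) (P : probability Omega R)
    (Y : {RV P >-> R}) : Prop :=
  exists a b : nat -> R, feller_constants Y a b.

Definition centered_feller_class (R : realType) (d : measure_display)
    (Omega : measurableType d) (P : probability Omega R)
    (Y : {RV P >-> R}) : Prop :=
  exists a : nat -> R, feller_constants Y a (fun=> 0).

Definition has_density (R : realType) (d d' : measure_display)
    (Omega : measurableType d) (P : probability Omega R)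
    (T : measurableType d') (mu : {measure set T -> \bar R})
    (Z : Omega -> T) (f : T -> R) : Prop :=
  [/\ measurable_fun setT f, forall x, 0 <= f x &
  forall A : set T, measurable A ->
    P (Z @^-1` A) = (\int[mu]_(x in A) (f x)%:E)%E].

Definition lebesgue_measure2 (R : realType) :
    {measure set (measurableTypeR R * measurableTypeR R) -> \bar R} :=
  product_measure1 (@lebesgue_measure R) (@lebesgue_measure R).

(* C^n on the plane: all partial derivatives up to order n exist and are
   continuous. *)
Fixpoint continuously_differentiable (R : realType) (n : nat)
    (f : R * R -> R) : Prop :=
  continuous f /\
  if n is m.+1 then
    forall v : R * R, v = (1, 0) \/ v = (0, 1) ->
      (forall x, derivable f x v) /\ continuously_differentiable m ('D_v f)
  else True.

Definition smooth2 (R : realType) (f : R * R -> R) : Prop :=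
  forall n, continuously_differentiable n f.

(* Main.v *)
Require Import Defs.
From HB Require Import structures.
From mathcomp Require Import all_boot all_order all_algebra.
From mathcomp Require Import finmap.
From mathcomp Require Import all_classical all_reals all_analysis.
From mathcomp Require Import measurable_realfun.
From mathcomp Require Import ring lra.
Set Implicit Arguments.
Unset Strict Implicit.
Unset Printing Implicit Defensive.
Import Order.TTheory GRing.Theory Num.Theory.
Import numFieldNormedType.Exports.
Local Open Scope classical_set_scope.
Local Open Scope ring_scope.

(* Write H(x) = E min(1, |Y|/x), Q(x) = E min(1, (Y/x)^2), and let a_n be centered
   norming constants for Y.  Tightness of the normed sums gives n H(L a_n) -> 0 as
   L -> oo uniformly in n, and non-degeneracy of the subsequential limits gives
   n Q(a_n) >= c > 0.  Comparing both at the index n with a_n of the order of x shows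
   that H(L x) <= H(x)/2 and that the truncated second moment at x dominates H(x), for
   large x.  Iterating, n Q(a_n/lambda) grows like a positive power of lambda.  As X is
   not degenerate, |s X + t| is comparable to |s| + |t| with probability bounded below,
   so the characteristic functions of U_n = (W_{1,n}, W_{2,n})/a_n decay, eventually in
   n, faster than any power of |s| + |t|.  U_n is tight as E|X| < oo, hence along a
   subsequence the characteristic functions converge to a rapidly decreasing limit whose
   inverse Fourier transform f is smooth.  Smoothing with a Fejer kernel identifies f as
   the density of the weak limit.  The ratio is handled by the continuous mapping
   theorem, the axis {W_2 = 0} being null; its law is absolutely continuous because
   the preimage of a null set under (x, y) |-> x/y is null. *)

(** * Integration tools *)

(** The decay bounds hold only from an index on that depends on (s, t), so the characteristic
    functions of the U_n have no common integrable majorant and inversion cannot be passed to the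
    limit directly. It is applied to laws smoothed by a kernel whose Fourier transform is a product
    of tents: compact support lets n tend to infinity at a fixed width with the trivial bound 1, and
    only the limit, which is rapidly decreasing, has to survive the width tending to zero. The pair
    (E cos, E sin) stands for the complex number E e^{iZ}. Decay is proved for its squared modulus,
    because 1 - |E e^{iZ}|^2 is an integral of nonnegative terms 1 - cos, so that parts of the space
    may be discarded and no centering has to be estimated. Clipped moments and Laplace transforms
    stay finite even if Y has infinite mean. The factor 2 gained in H at each division of the scale
    by L makes a frequency of size L^j meet the exponent 2^j, and exp(-c 2^j) beats every power
    L^(-m j). *)

Section integration_tools.
Context {d} {T : measurableType d} {R : realType}.

Lemma integrable_le (mu : {measure set T -> \bar R}) (f g : T -> R) :
  measurable_fun setT f -> (forall x, `|f x| <= g x) ->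
  mu.-integrable setT (EFin \o g) -> mu.-integrable setT (EFin \o f).
Proof.
move=> mf fg ig; apply: (le_integrable measurableT _ _ ig).
  exact/measurable_EFinP.
by move=> x _; rewrite /= lee_fin (le_trans (fg x))// ler_norm.
Qed.

Lemma bounded_integrable (P : probability T R) (f : T -> R) (M : R) :
  measurable_fun setT f -> (forall x, `|f x| <= M) ->
  P.-integrable setT (EFin \o f).
Proof.
move=> mf fM; apply: (@integrable_le _ f (cst M)) => //.
by apply: finite_measure_integrable_cst.
Qed.

Lemma Rintegral_dominated_cvg (mu : {measure set T -> \bar R})
    (f_ : nat -> T -> R) (f g : T -> R) :
  (forall n, measurable_fun setT (f_ n)) ->
  (forall x, f_ n x @[n --> \oo] --> f x) ->
  mu.-integrable setT (EFin \o g) ->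
  (forall n x, `|f_ n x| <= g x) ->
  \int[mu]_x f_ n x @[n --> \oo] --> \int[mu]_x f x.
Proof.
move=> mf_ f_f ig fg.
have mf : measurable_fun setT f.
  by apply: (measurable_fun_cvg mf_) => x _; exact: f_f.
have [||||_ _ h] := @dominated_convergence _ _ _ mu setT measurableT
   (fun n => EFin \o f_ n) (EFin \o f) (EFin \o g) _ _ _ ig.
- by move=> n; exact/measurable_EFinP.
- exact/measurable_EFinP.
- by apply: aeW => x _; apply: cvg_EFin; [exact: nearW|exact: f_f].
- by apply: aeW => x n _; rewrite /= lee_fin.
apply: fine_cvg; rewrite fineK //.
apply: integrable_fin_num => //.
apply: (integrable_le mf _ ig) => x.
have : `|f_ n x| @[n --> \oo] --> `|f x| by apply: cvg_norm; exact: f_f.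
move=> h'; rewrite -(cvg_lim _ h')//; apply: limr_le; first exact: cvgP h'.
exact: nearW.
Qed.

Lemma Rintegral_indic (P : probability T R) (A : set T) : measurable A ->
  \int[P]_x (\1_A x) = fine (P A).
Proof. by move=> mA; rewrite /Rintegral integral_indic// setIT. Qed.

Lemma prob_integral_cst (P : probability T R) (c : \bar R) :
  (\int[P]_x c)%E = c.
Proof.
have h := @integral_cst _ _ _ P setT measurableT c.
have e : P setT = 1%E := probability_setT P.
rewrite [LHS]h -[RHS]mule1; exact: (congr1 (fun z => c * z)%E e).
Qed.

Lemma prob_Rintegral_cst (P : probability T R) (r : R) : \int[P]_x r = r.
Proof. by rewrite /Rintegral prob_integral_cst. Qed.

Lemma expectation_Rintegral (P : probability T R) (f : T -> R) :
  P.-integrable setT (EFin \o f) -> 'E_P[f]%E = (\int[P]_x f x)%:E.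
Proof.
move=> h; rewrite unlock /Rintegral fineK//; exact: integrable_fin_num.
Qed.

End integration_tools.

(** The majorant depends on y alone and [P] has mass one, so Tonelli deduces joint integrability
    from that of [B]. *)
Lemma Rintegral_Fubini d1 d2 (T1 : measurableType d1) (T2 : measurableType d2)
    (R : realType) (P : probability T1 R)
    (mu : {sigma_finite_measure set T2 -> \bar R})
    (F : T1 * T2 -> R) (B : T2 -> R) :
  measurable_fun setT F -> (forall x y, `|F (x, y)| <= B y) ->
  mu.-integrable setT (EFin \o B) ->
  \int[P]_x (\int[mu]_y F (x, y)) = \int[mu]_y (\int[P]_x F (x, y)).
Proof.
move=> mF FB iB.
have mF1 x : measurable_fun setT (fun y => F (x, y)).
  exact: measurableT_comp (pair1_measurable x).
have mF2 y : measurable_fun setT (fun x => F (x, y)).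
  exact: measurableT_comp (pair2_measurable y).
have iF1 x : mu.-integrable setT (EFin \o (fun y => F (x, y))).
  exact: (integrable_le (mF1 x) _ iB).
have iF2 y : P.-integrable setT (EFin \o (fun x => F (x, y))).
  exact: (bounded_integrable _ (M := B y)).
have iF : (P \x mu)%E.-integrable setT (EFin \o F).
  apply/integrable12ltyP; first exact/measurable_EFinP.
  apply: (@le_lt_trans _ _ (\int[P]_x \int[mu]_y (B y)%:E)%E).
    apply: ge0_le_integral => //=.
    - by move=> x _; apply: integral_ge0.
    - apply: (@measurable_fun_fubini_tonelli_F _ _ _ _ _ _ (fun z => `|F z|%:E)) => //.
      by apply/measurable_EFinP; exact: measurableT_comp.
    - move=> x _; apply: ge0_le_integral => //=.
      + by apply/measurable_EFinP; apply: measurableT_comp.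
      + by have /integrableP[] := iB.
      + by move=> y _; rewrite lee_fin.
  rewrite prob_integral_cst.
  exact: (integrable_lty measurableT iB).
have e1 x : (\int[mu]_y F (x, y))%:E = (\int[mu]_y (F (x, y))%:E)%E.
  by rewrite /Rintegral fineK//; exact: (integrable_fin_num measurableT (iF1 x)).
have e2 y : (\int[P]_x F (x, y))%:E = (\int[P]_x (F (x, y))%:E)%E.
  by rewrite /Rintegral fineK//; exact: (integrable_fin_num measurableT (iF2 y)).
transitivity (fine (\int[P]_x \int[mu]_y (F (x, y))%:E)%E).
  by rewrite {1}/Rintegral; under eq_integral do rewrite e1.
by rewrite (Fubini iF) [in RHS]/Rintegral; under [in RHS]eq_integral do rewrite e2.
Qed.

Section law.
Context {d d1} {Omega : measurableType d} {T1 : measurableType d1} {R : realType}.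
Variable P : probability Omega R.

Definition law (U : Omega -> T1) (mU : measurable_fun setT U) : probability T1 R :=
  distribution P (HB.pack_for {mfun Omega >-> T1} U (isMeasurableFun.Build _ _ _ _ _ mU)).

Lemma integral_law (U : Omega -> T1) (mU : measurable_fun setT U) (h : T1 -> R) (K : R) :
  measurable_fun setT h -> (forall x, `|h x| <= K) ->
  (\int[law mU]_x (h x)%:E = \int[P]_w (h (U w))%:E)%E.
Proof.
move=> mh hK; rewrite /law integral_distribution//; first exact/measurable_EFinP.
apply: (@bounded_integrable _ _ _ _ (h \o U) K); first exact: measurableT_comp.
by move=> x; exact: hK.
Qed.

Lemma Rintegral_law (U : Omega -> T1) (mU : measurable_fun setT U) (h : T1 -> R) (K : R) :
  measurable_fun setT h -> (forall x, `|h x| <= K) ->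
  \int[law mU]_x h x = \int[P]_w h (U w).
Proof. by move=> mh hK; rewrite /Rintegral (integral_law mU mh hK). Qed.

End law.

Section independence.
Context {d} {Omega : measurableType d} {R : realType} (P : probability Omega R).

Lemma Rintegral_same_distribution d' d1 (Omega' : measurableType d')
    (P' : probability Omega' R) (T1 : measurableType d1)
    (U : Omega -> T1) (V : Omega' -> T1) (h : T1 -> R) (K : R) :
  measurable_fun setT U -> measurable_fun setT V ->
  same_distribution P P' U V ->
  measurable_fun setT h -> (forall x, `|h x| <= K) ->
  \int[P]_w h (U w) = \int[P']_w h (V w).
Proof.
move=> mU mV UV mh hK; rewrite -(Rintegral_law _ mU mh hK) -(Rintegral_law _ mV mh hK).
by rewrite /Rintegral; congr fine; apply: eq_measure_integral => A mA _; exact: UV.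
Qed.

(** On rectangles the law of (U, V) is the product of the marginal laws, hence everywhere by
    uniqueness of the product measure; Fubini then splits the integral. *)
Lemma independent_Rintegral d1 d2 (T1 : measurableType d1) (T2 : measurableType d2)
    (U : Omega -> T1) (V : Omega -> T2) (f : T1 -> R) (g : T2 -> R) (M N : R) :
  measurable_fun setT U -> measurable_fun setT V ->
  independent_rvs P U V ->
  measurable_fun setT f -> measurable_fun setT g ->
  (forall x, `|f x| <= M) -> (forall x, `|g x| <= N) ->
  \int[P]_w (f (U w) * g (V w)) = \int[P]_w f (U w) * \int[P]_w g (V w).
Proof.
move=> mU mV indep mf mg fM gN.
have mUV : measurable_fun setT (fun w => (U w, V w)) by exact: measurable_fun_pair.
pose PU := law P mU; pose PV := law P mV; pose PUV := law P mUV.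
have mfg : measurable_fun setT (fun z : T1 * T2 => f z.1 * g z.2).
  by apply: measurable_funM; apply: measurableT_comp.
have fgMN z : `|f z.1 * g z.2| <= M * N by rewrite normrM ler_pM.
rewrite -(Rintegral_law P mUV mfg fgMN) -(Rintegral_law _ mU mf fM).
rewrite -(Rintegral_law _ mV mg gN) -/PU -/PV -/PUV.
have -> : \int[PUV]_z (f z.1 * g z.2) = fine (\int[PU \x PV]_z (f z.1 * g z.2)%:E)%E.
  rewrite /Rintegral; congr fine; apply: eq_measure_integral => A mA _.
  by apply/esym; apply: product_measure_unique.
rewrite -integral12_prod_meas1/=; last first.
  apply/integrable12ltyP; first exact/measurable_EFinP.
  apply: (@le_lt_trans _ _ (\int[PU]_x \int[PV]_y (M * N)%:E)%E).
    apply: ge0_le_integral => //=.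
    - by move=> x _; apply: integral_ge0.
    - apply: (@measurable_fun_fubini_tonelli_F _ _ _ _ _ _ (fun z => `|f z.1 * g z.2|%:E)) => //.
      by apply/measurable_EFinP; exact: measurableT_comp.
    - move=> x _; apply: ge0_le_integral => //=.
      + apply/measurable_EFinP; apply: measurableT_comp => //.
        exact: (measurable_funM (measurable_cst _) mg).
      + by move=> y _; rewrite lee_fin (fgMN (x, y)).
  by under eq_integral do rewrite prob_integral_cst; rewrite prob_integral_cst ltry.
rewrite [LHS](_ : _ = \int[PU]_x (f x * \int[PV]_y g y)).
  by rewrite RintegralZr//; exact: (bounded_integrable _ mf fM).
rewrite /Rintegral; congr fine; apply: eq_integral => x _.
have ig : PV.-integrable setT (EFin \o g) by exact: (bounded_integrable _ mg gN).
rewrite /fubini_F/=; under eq_integral => y _ do rewrite EFinM.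
by rewrite integralZl// EFinM fineK//; exact: integrable_fin_num.
Qed.

End independence.

(** * Sums of independent copies *)

Section iid_sums.
Context {d} {Omega : measurableType d} {R : realType} (P : probability Omega R).

Lemma iid_copies_comp d1 d2 d3 (Omega' : measurableType d1) (P' : probability Omega' R)
    (T : measurableType d2) (T' : measurableType d3)
    (Z : Omega -> T) (Z_ : nat -> Omega' -> T) (q : T -> T') :
  measurable_fun setT q -> iid_copies P P' Z Z_ ->
  iid_copies P P' (q \o Z) (fun i => q \o Z_ i).
Proof.
move=> mq [indep same]; have mqA A : measurable A -> measurable (q @^-1` A).
  by move=> mA; rewrite -[X in measurable X]setTI; exact: mq.
split=> [J A mA|i A mA].
  have := indep J (fun i => q @^-1` A i) (fun i => mqA _ (mA i)).
  by move=> ->.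
exact: same (mqA _ mA).
Qed.

(** Cylinder events over the indices below n form a pi-system [G]. The measures P(. and W_n in B)
    and P(W_n in B) P agree on it, hence on the sigma-algebra it generates, for which the sum is
    measurable. *)
Lemma independent_sum (W : nat -> Omega -> R) (n : nat) :
  (forall i, measurable_fun setT (W i)) -> mutually_independent P W ->
  independent_rvs P (fun w => \sum_(i < n) W i w) (W n).
Proof.
move=> mW indep A B mA mB.
pose J := [fset i | i in iota 0 n]%fset.
have JE i : (i \in J) = (i < n)%N.
  apply/imfsetP/idP => [[j /= + ->]|iLn]; first by rewrite mem_iota.
  by exists i => //=; rewrite mem_iota.
have nJ : n \notin J by rewrite JE ltnn.
pose G := [set E | exists2 A : nat -> set R, (forall i, measurable (A i)) &
  E = \bigcap_(i in [set` J]) W i @^-1` A i].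
have mWA i C : measurable C -> measurable (W i @^-1` C).
  by move=> mC; rewrite -[X in measurable X]setTI; exact: mW.
have GT : G setT.
  by exists (fun=> setT) => //; apply/esym; rewrite -subTset => w _ i _.
have mG : G `<=` measurable.
  by move=> E [C mC ->]; apply: fin_bigcap_measurable => // i _; exact: mWA.
have GI : setI_closed G.
  move=> E F [C mC ->] [D mD ->]; exists (fun i => C i `&` D i).
    by move=> i; exact: measurableI.
  by rewrite -bigcapI; apply: eq_bigcapr => i _; rewrite preimage_setI.
pose r : {nonneg R} := NngNum (fine_ge0 (measure_ge0 P (W n @^-1` B))).
pose m1 : {measure set Omega -> \bar R} := mrestr P (mWA n B mB).
pose m2 : {measure set Omega -> \bar R} := mscale r P.
have m12 E : G E -> m1 E = m2 E.
  move=> [C mC ->]; rewrite /m1 /m2/= /mrestr /mscale/=.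
  rewrite (fineK (fin_num_measure P _ (mWA n B mB))).
  (* Independence of the first n + 1 variables is used with [B] in slot n, which [J] leaves free. *)
  pose C' i := if i == n then B else C i.
  have mC' i : measurable (C' i) by rewrite /C'; case: ifP.
  have CC' i : i \in J -> C' i = C i.
    by rewrite /C'; case: eqP => // ->; rewrite (negbTE nJ).
  have := indep (n |` J)%fset C' mC'; rewrite big_fsetU1//= (_ : C' n = B); last by rewrite /C' eqxx.
  rewrite (_ : \prod_(i <- J) _ = P (\bigcap_(i in [set` J]) W i @^-1` C i))%E.
    move=> <-; congr (P _); apply/seteqP; split => w /=.
      move=> [h wB] i; rewrite /= in_fset1U => /orP[/eqP->|iJ].
        by rewrite /C' eqxx.
      by rewrite CC'//; exact: h.
    move=> h; split=> [i /= iJ|]; last first.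
      by have /= := h n; rewrite in_fset1U eqxx /C' eqxx; apply.
    by have /= := h i; rewrite in_fset1U iJ orbT CC'//; apply.
  by rewrite indep//; apply: eq_big_seq => i iJ; rewrite CC'.
have sG : forall F, <<s G>> F -> m1 F = m2 F.
  apply: (@g_sigma_algebra_measure_unique _ _ _ G mG (fun=> setT)) => //.
    exact: bigcup_const.
  move=> _; rewrite /m1/= /mrestr setTI.
  by rewrite -ge0_fin_numE ?measure_ge0// (fin_num_measure P _ (mWA n B mB)).
(* For i < n the event {W_i in C} is a cylinder with one constrained slot, so each summand is
   measurable for the sigma-algebra generated by [G]. *)
have mS : <<s G>> ((fun w => \sum_(i < n) W i w) @^-1` A).
  have /(_ measurableT A mA) : measurable_fun
      (setT : set (g_sigma_algebraType G)) (fun w => \sum_(i < n) W i w).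
    apply: measurable_sum => i _ C mC; rewrite setTI.
    apply: sub_sigma_algebra; exists (fun j : nat => if j == i then C else setT).
      by move=> j; case: ifP.
    apply/seteqP; split => w /=.
      by move=> wC j _ /=; case: eqP => //= ->.
    by move=> /(_ i) /=; rewrite JE ltn_ord eqxx; exact.
  by rewrite setTI.
have := sG _ mS; rewrite /m1 /m2/= /mrestr /mscale/= => ->.
by rewrite (fineK (fin_num_measure P _ (mWA n B mB))) muleC.
Qed.

Section characteristic_function.
Variables (W : nat -> Omega -> R) (mW : forall i, measurable_fun setT (W i)).
Variables (d' : measure_display) (Omega' : measurableType d') (P' : probability Omega' R).
Variables (W0 : Omega' -> R) (mW0 : measurable_fun setT W0).
Hypothesis iidW : iid_copies P' P W0 W.

Let S n w := \sum_(i < n) W i w.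

Let mS n : measurable_fun setT (S n).
Proof. by apply: measurable_sum. Qed.

Let mcos : measurable_fun setT (@cos R).
Proof. by apply: continuous_measurable_fun; exact: continuous_cos. Qed.

Let msin : measurable_fun setT (@sin R).
Proof. by apply: continuous_measurable_fun; exact: continuous_sin. Qed.

Let same (h : R -> R) (K : R) n : measurable_fun setT h -> (forall x, `|h x| <= K) ->
  \int[P]_w h (W n w) = \int[P']_w h (W0 w).
Proof.
move=> mh hK; apply/esym.
exact: (Rintegral_same_distribution mW0 (mW n) (iidW.2 n) mh hK).
Qed.

(** This is |E e^{iS_n}|^2 = |E e^{iW}|^(2n). Independence and the addition formulas multiply the
    pairs (E cos, E sin) like complex numbers, and the squared modulus is multiplicative. *)
Lemma cos_sin_iid_sum n :
  (\int[P]_w cos (S n w)) ^+ 2 + (\int[P]_w sin (S n w)) ^+ 2 =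
  ((\int[P']_w cos (W0 w)) ^+ 2 + (\int[P']_w sin (W0 w)) ^+ 2) ^+ n.
Proof.
elim: n => [|n IH].
  under eq_Rintegral do rewrite /S big_ord0 cos0.
  under [X in _ + X ^+ _]eq_Rintegral do rewrite /S big_ord0 sin0.
  by rewrite !prob_Rintegral_cst expr0; ring.
have ind (f g : R -> R) : measurable_fun setT f -> measurable_fun setT g ->
    (forall x, `|f x| <= 1) -> (forall x, `|g x| <= 1) ->
    \int[P]_w (f (S n w) * g (W n w)) = \int[P]_w f (S n w) * \int[P]_w g (W n w).
  move=> mf mg f1 g1.
  exact: (independent_Rintegral (mS n) (mW n) (independent_sum n mW iidW.1) mf mg f1 g1).
have ifg (f g : R -> R) : measurable_fun setT f -> measurable_fun setT g ->
    (forall x, `|f x| <= 1) -> (forall x, `|g x| <= 1) ->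
    P.-integrable setT (EFin \o (fun w => f (S n w) * g (W n w))).
  move=> mf mg f1 g1.
  apply: (@bounded_integrable _ _ _ _ _ 1).
    by apply: measurable_funM; exact: measurableT_comp.
  by move=> w; rewrite normrM mulr_ile1.
have c1 := @cos_max R; have s1 := @sin_max R.
have -> : \int[P]_w cos (S n.+1 w) =
    \int[P]_w (cos (S n w) * cos (W n w)) - \int[P]_w (sin (S n w) * sin (W n w)).
  rewrite -RintegralB//; [|exact: ifg..].
  by apply: eq_Rintegral => w _; rewrite /S big_ord_recr/= cosD.
have -> : \int[P]_w sin (S n.+1 w) =
    \int[P]_w (sin (S n w) * cos (W n w)) + \int[P]_w (cos (S n w) * sin (W n w)).
  rewrite -RintegralD//; [|exact: ifg..].
  by apply: eq_Rintegral => w _; rewrite /S big_ord_recr/= sinD.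
rewrite !ind// !(same _ mcos c1) !(same _ msin s1) [RHS]exprS -IH; ring.
Qed.

(** The absolute value keeps the exponential bounded on the whole line, as [independent_Rintegral]
    requires; on nonnegative sums it is additive. *)
Lemma laplace_iid_sum n : (forall i w, 0 <= W i w) ->
  \int[P]_w expR (- `|S n w|) = (\int[P']_w expR (- `|W0 w|)) ^+ n.
Proof.
move=> W_ge0.
have me : measurable_fun setT (fun x : R => expR (- `|x|)).
  by apply: (measurableT_comp (@measurable_expR R)); apply: measurableT_comp => //;
     exact: normr_measurable.
have e1 (x : R) : `|expR (- `|x|)| <= 1.
  by rewrite ger0_norm ?expR_ge0// -expR0 ler_expR oppr_le0.
elim: n => [|n IH].
  by under eq_Rintegral do rewrite /S big_ord0 normr0 oppr0 expR0; rewrite prob_Rintegral_cst.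
rewrite exprS -IH mulrC -(same n me e1).
rewrite -(independent_Rintegral (mS n) (mW n) (independent_sum n mW iidW.1) me me e1 e1).
apply: eq_Rintegral => w _; rewrite -expRD /S big_ord_recr/= -opprD.
by rewrite [in RHS]ger0_norm ?sumr_ge0//; congr (expR (- _)); rewrite !ger0_norm// addr_ge0// sumr_ge0.
Qed.

End characteristic_function.
End iid_sums.

Ltac measurability :=
  repeat first
    [ exact: measurable_cst | exact: measurable_id | exact: measurable_funP
    | assumption
    | exact: measurable_fst | exact: measurable_snd
    | apply: measurable_funB | apply: measurable_funD | apply: measurable_funM
    | apply: measurable_minr | apply: measurable_maxr | apply: measurable_funX
    | apply: (measurableT_comp (@oppr_measurable _ _))
    | apply: (measurableT_comp (@measurable_expR _))
    | apply: (measurableT_comp (continuous_measurable_fun (@continuous_cos _)))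
    | apply: (measurableT_comp (continuous_measurable_fun (@continuous_sin _)))
    | apply: (measurableT_comp (@normr_measurable _ setT)) ].

(** * Elementary inequalities for cosine, sine and the exponential *)

Section real_inequalities.
Context {R : realType}.
Implicit Types x y z : R.

Lemma mvt_lipschitz (f df : R -> R) x y :
  (forall x, is_derive x 1 f (df x)) -> (forall x, `|df x| <= 1) ->
  `|f x - f y| <= `|x - y|.
Proof.
move=> f_df df1; wlog xy : x y / x <= y => [h|].
  by have [/h|/ltW/h] := leP x y; rewrite // distrC [X in _ <= X]distrC.
have cf : {within `[x, y], continuous f}.
  apply: continuous_subspaceT => z.
  by apply/differentiable_continuous/derivable1_diffP; exact: ex_derive.
have [c _ e] := MVT_segment xy (fun z _ => f_df z) cf.
by rewrite distrC [X in _ <= X]distrC e normrM ler_piMl.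
Qed.

Lemma cos_lipschitz x y : `|cos x - cos y| <= `|x - y|.
Proof.
apply: (@mvt_lipschitz cos (fun z => - sin z)) => z.
by rewrite normrN sin_max.
Qed.

Lemma sin_lipschitz x y : `|sin x - sin y| <= `|x - y|.
Proof.
apply: (@mvt_lipschitz sin cos) => z.
exact: cos_max.
Qed.

Lemma one_sub_cosE x : 1 - cos x = 2 * sin (x / 2) ^+ 2.
Proof.
rewrite {1}(_ : x = (x / 2) *+ 2); last by rewrite -mulr_natr; field.
by rewrite cos_mulr2n sin2cos2; ring.
Qed.

Lemma one_sub_cos_le x : 1 - cos x <= x ^+ 2 / 2.
Proof.
rewrite one_sub_cosE.
have : sin (x / 2) ^+ 2 <= (x / 2) ^+ 2.
  rewrite -(real_normK (num_real (sin _))) -(real_normK (num_real (x / 2))).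
  by rewrite ler_pXn2r ?nnegrE//; have := sin_lipschitz (x / 2) 0; rewrite sin0 !subr0.
have -> : (x / 2) ^+ 2 = x ^+ 2 / 4 by field.
by move=> h; lra.
Qed.

Lemma one_sub_cos_le2 x : 1 - cos x <= 2.
Proof. by have := cos_geN1 x; lra. Qed.

Lemma one_sub_cos_ge0 x : 0 <= 1 - cos x.
Proof. by rewrite subr_ge0 cos_le1. Qed.

(** By the mean value theorem sin y >= y cos 1 on [0, 1]. With y = x / 2, the value 1 - cos x = 2
    sin^2 y is at least this constant times x^2 for 0 <= x <= 2. *)
Definition cos_const : R := cos 1 ^+ 2 / 2.

Lemma cos_const_gt0 : 0 < cos_const.
Proof. by rewrite divr_gt0// exprn_gt0// cos1_gt0. Qed.

Lemma one_sub_cos_ge x : `|x| <= 2 -> cos_const * x ^+ 2 <= 1 - cos x.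
Proof.
move=> x2; rewrite one_sub_cosE; wlog x0 : x x2 / 0 <= x => [h|].
  have [/h|/ltW xle0] := leP 0 x; first exact.
  have := h (- x); rewrite normrN oppr_ge0 => /(_ x2 xle0).
  by rewrite mulNr sinN !sqrrN.
rewrite ger0_norm// in x2.
have y0 : 0 <= x / 2 by rewrite divr_ge0.
have cs : {within `[0, x / 2], continuous (@sin R)}.
  by apply: continuous_subspaceT => z; exact: continuous_sin.
have [c] := MVT_segment y0 (fun z _ => is_derive_sin z) cs.
rewrite in_itv/= => /andP[c0 cx]; rewrite sin0 !subr0 => ->.
have c1 : cos 1 <= cos c.
  have pi1 : 1 <= pi :> R by have := @pi_ge2 R; lra.
  have [c1|c1|->//] := ltrgtP c 1; last by lra.
  by apply/ltW; rewrite ltr_cos// in_itv/=; apply/andP; split; lra.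
have := @cos1_gt0 R => p; rewrite /cos_const exprMn.
have -> : cos 1 ^+ 2 / 2 * x ^+ 2 = 2 * (cos 1 ^+ 2 * (x / 2) ^+ 2) by field.
rewrite ler_pM2l// ler_wpM2r ?sqr_ge0// ler_pXn2r ?nnegrE// ltW//.
exact: lt_le_trans c1.
Qed.

(** From exp z >= 1 + z one gets 1 - exp(-z) >= z / (1 + z), which is at least 1/2 for z >= 1 and at
    least z / 2 below. *)
Lemma one_sub_expRN_ge z : 0 <= z -> Num.min 1 z / 2 <= 1 - expR (- z).
Proof.
move=> z0; have ez : expR (- z) <= (1 + z)^-1.
  by rewrite expRN lef_pV2 ?posrE ?expR_gt0 ?expR_ge1Dx//; lra.
apply: (@le_trans _ _ (1 - (1 + z)^-1)); last by lra.
have -> : 1 - (1 + z)^-1 = z / (1 + z) by field; lra.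
rewrite ler_pdivlMr; last lra.
case: (lerP 1 z) => z1; nra.
Qed.

Lemma one_sub_exprn_ge (x : R) n : 0 <= x <= 1 -> 1 - n%:R * x <= (1 - x) ^+ n.
Proof.
move=> /andP[x0 x1]; elim: n => [|n IH]; first by rewrite mul0r subr0 expr0.
rewrite exprS; apply: (@le_trans _ _ ((1 - x) * (1 - n%:R * x))).
  rewrite -natr1; have : 0 <= n%:R :> R by []; nra.
by rewrite ler_wpM2l// subr_ge0.
Qed.

Lemma one_sub_exprn_le (x : R) n : 0 <= x <= 1 -> (1 - x) ^+ n <= expR (- (n%:R * x)).
Proof.
move=> /andP[x0 x1]; rewrite -mulrN mulrC expRM_natr.
have := expR_ge1Dx (- x); move=> h; apply: lerXn2r => //; rewrite ?nnegrE ?expR_ge0//; lra.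
Qed.

End real_inequalities.

(** Dependent choice. It turns the failure of an eventual bound, for every constant and every
    starting index, into a subsequence along which the bound fails ever more badly; it also serves
    for diagonal extraction. *)
Lemma subsequence_exists (Pr : nat -> nat -> Prop) :
  (forall k N, exists2 n, (N <= n)%N & Pr k n) ->
  exists phi, strictly_increasing phi /\ forall k, Pr k (phi k).
Proof.
move=> h; have /choice[F hF] : forall kN : nat * nat,
    exists n, (kN.2 <= n)%N /\ Pr kN.1 n.
  by move=> [k N]; have [n] := h k N; exists n.
pose phi := fix phi k := if k is k'.+1 then F (k, (phi k').+1) else F (0, 0)%N.
exists phi; split; last by case=> [|k]; [exact: (hF (0, 0)%N).2 | exact: (hF (k.+1, _)).2].
have step k : (phi k < phi k.+1)%N by exact: (hF (k.+1, (phi k).+1)).1.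
by apply: homo_ltn => //; exact: ltn_trans.
Qed.

Lemma strictly_increasing_ge phi : strictly_increasing phi ->
  forall n, (n <= phi n)%N.
Proof. by move=> hphi; elim=> [//|n IH]; exact: leq_ltn_trans IH (hphi _ _ _). Qed.

Section linear_combinations.
Context {d} {T : measurableType d} {R : realType} (mu : {measure set T -> \bar R}).
Variables (a b : R) (f g : T -> R).
Hypotheses (if_ : mu.-integrable setT (EFin \o f)) (ig : mu.-integrable setT (EFin \o g)).

Lemma integrable_scale : mu.-integrable setT (EFin \o (fun x => a * f x)).
Proof.
rewrite (_ : _ \o _ = (fun x => a%:E * (EFin \o f) x)%E); first exact: integrableZl.
by apply/funext => x /=; rewrite EFinM.
Qed.

Lemma integrable_add : mu.-integrable setT (EFin \o (fun x => f x + g x)).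
Proof.
rewrite (_ : _ \o _ = (EFin \o f) \+ (EFin \o g))%E; first exact: integrableD.
by apply/funext => x /=; rewrite EFinD.
Qed.

End linear_combinations.

Lemma integrable_lincomb {d} {T : measurableType d} {R : realType}
    (mu : {measure set T -> \bar R}) (a b : R) (f g : T -> R) :
  mu.-integrable setT (EFin \o f) -> mu.-integrable setT (EFin \o g) ->
  mu.-integrable setT (EFin \o (fun x => a * f x + b * g x)).
Proof. by move=> if_ ig; apply: integrable_add; exact: integrable_scale. Qed.

Lemma Rintegral_lincomb {d} {T : measurableType d} {R : realType}
    (mu : {measure set T -> \bar R}) (a b : R) (f g : T -> R) :
  mu.-integrable setT (EFin \o f) -> mu.-integrable setT (EFin \o g) ->
  \int[mu]_x (a * f x + b * g x) = a * \int[mu]_x f x + b * \int[mu]_x g x.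
Proof.
by move=> if_ ig; rewrite RintegralD ?RintegralZl//; exact: integrable_scale.
Qed.

Lemma Rintegral_dist_le {d} {T : measurableType d} {R : realType}
    (mu : {measure set T -> \bar R}) (f g h : T -> R) :
  mu.-integrable setT (EFin \o f) -> mu.-integrable setT (EFin \o g) ->
  mu.-integrable setT (EFin \o h) -> (forall x, `|f x - g x| <= h x) ->
  `|\int[mu]_x f x - \int[mu]_x g x| <= \int[mu]_x h x.
Proof.
move=> if_ ig ih fgh; have iB : mu.-integrable setT (EFin \o (fun x => f x - g x)).
  have := integrable_lincomb 1 (-1) if_ ig; congr (integrable _ _ _).
  by apply/funext => x /=; rewrite mul1r mulN1r.
rewrite -RintegralB// (le_trans (le_normr_Rintegral _ iB))//.
by apply: le_Rintegral => //; exact: integrable_norm iB.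
Qed.

(** * Almost sure statements and symmetrized characteristic functions *)

Section probability_tools.
Context {d} {Omega : measurableType d} {R : realType} (P : probability Omega R).

Lemma prob_integrable_cst (q : R) : P.-integrable setT (EFin \o (fun=> q)).
Proof. by apply: (@bounded_integrable _ _ _ _ _ `|q|). Qed.

Lemma Rintegral_ae_eq (f g : Omega -> R) : measurable_fun setT f -> measurable_fun setT g ->
  {ae P, forall w, f w = g w} -> \int[P]_w f w = \int[P]_w g w.
Proof.
move=> mf mg fg; rewrite /Rintegral; congr fine; apply: ae_eq_integral => //;
  [exact/measurable_EFinP|exact/measurable_EFinP|].
by apply: filterS fg => w fgw _; rewrite fgw.
Qed.

Lemma Rintegral_le0_ae (f : Omega -> R) (M : R) : measurable_fun setT f ->
  (forall w, 0 <= f w <= M) -> \int[P]_w f w <= 0 -> {ae P, forall w, f w = 0}.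
Proof.
move=> mf f0M f0; have fM w : `|f w| <= M.
  by have /andP[? ?] := f0M w; rewrite ger0_norm.
have if_ := bounded_integrable P mf fM.
have e : (\int[P]_w `|(f w)%:E|)%E = 0%E.
  transitivity (\int[P]_w (f w)%:E)%E.
    by apply: eq_integral => w _; rewrite gee0_abs// lee_fin; have /andP[] := f0M w.
  rewrite -(fineK (integrable_fin_num measurableT if_)); congr EFin.
  apply/le_anti/andP; split; first exact: f0.
  by apply: Rintegral_ge0 => w _; have /andP[] := f0M w.
have /(_ _ measurableT (EFin \o f)) [| h _] := ae_eq_integral_abs P.
  exact/measurable_EFinP.
by have := h e; apply: filterS => w /(_ I) [].
Qed.

Lemma ae_ex (A : Omega -> Prop) : {ae P, forall w, A w} -> exists w, A w.
Proof.
move=> h; have PF : ProperFilter (almost_everywhere P).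
  apply: ae_properfilter_algebraOfSetsType.
  by rewrite [X in (_ < X)%E](probability_setT P) lte01.
exact: filter_ex h.
Qed.

Lemma ae_prob1 (A : set Omega) : measurable A -> {ae P, forall w, A w} -> P A = 1%E.
Proof.
move=> mA [N [mN N0 sub]]; have : P (~` A) = 0%E.
  apply/eqP; rewrite -measure_le0 -N0; apply: le_measure; rewrite ?inE//.
  exact: measurableC.
rewrite probability_setC// -(fineK (fin_num_measure P _ mA)) -EFinB => -[/eqP].
by rewrite subr_eq0 => /eqP <-.
Qed.

Lemma prob1_ae (A : set Omega) : measurable A -> P A = 1%E -> {ae P, forall w, A w}.
Proof.
move=> mA PA; exists (~` A); split; first exact: measurableC.
  by rewrite probability_setC// PA subee.
by [].
Qed.

(** For fixed v the inner integral of the symmetrization is an explicit trigonometric function of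
    [f v]; the formula also supplies its measurability in v. *)
Lemma charfun_shift (f : Omega -> R) v : measurable_fun setT f ->
  \int[P]_w (1 - cos (f w - f v)) =
  1 - (cos (f v) * \int[P]_w cos (f w) + sin (f v) * \int[P]_w sin (f w)).
Proof.
move=> mf.
have mc : measurable_fun setT (fun w => cos (f w)) by measurability.
have ms : measurable_fun setT (fun w => sin (f w)) by measurability.
have ic : P.-integrable setT (EFin \o (fun w => cos (f w))).
  by apply: (@bounded_integrable _ _ _ _ _ 1) => // w; exact: cos_max.
have is_ : P.-integrable setT (EFin \o (fun w => sin (f w))).
  by apply: (@bounded_integrable _ _ _ _ _ 1) => // w; exact: sin_max.
have -> : \int[P]_w (1 - cos (f w - f v)) =
    \int[P]_w (1 - (cos (f v) * cos (f w) + sin (f v) * sin (f w))).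
  by apply: eq_Rintegral => w _; rewrite cosB ![_ * cos (f v)]mulrC ![_ * sin (f v)]mulrC.
rewrite RintegralB//; last 2 first.
- exact: prob_integrable_cst.
- exact: integrable_lincomb.
by rewrite Rintegral_lincomb// prob_Rintegral_cst.
Qed.

(* The left-hand side is 1 - |E e^{if}|^2, and f w - f v is a symmetrization of f. *)
Lemma one_sub_charfun_sqr (f : Omega -> R) : measurable_fun setT f ->
  1 - ((\int[P]_w cos (f w)) ^+ 2 + (\int[P]_w sin (f w)) ^+ 2) =
  \int[P]_v (\int[P]_w (1 - cos (f w - f v))).
Proof.
move=> mf; set c := \int[P]_w cos (f w); set s := \int[P]_w sin (f w).
have mc : measurable_fun setT (fun w => cos (f w)) by measurability.
have ms : measurable_fun setT (fun w => sin (f w)) by measurability.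
have ic : P.-integrable setT (EFin \o (fun w => cos (f w))).
  by apply: (@bounded_integrable _ _ _ _ _ 1) => // w; exact: cos_max.
have is_ : P.-integrable setT (EFin \o (fun w => sin (f w))).
  by apply: (@bounded_integrable _ _ _ _ _ 1) => // w; exact: sin_max.
have -> : \int[P]_v (\int[P]_w (1 - cos (f w - f v))) =
    \int[P]_v (1 - (c * cos (f v) + s * sin (f v))).
  by apply: eq_Rintegral => v _; rewrite charfun_shift// -/c -/s !(mulrC c) !(mulrC s).
rewrite RintegralB//; last 2 first.
- exact: prob_integrable_cst.
- exact: integrable_lincomb.
by rewrite Rintegral_lincomb// prob_Rintegral_cst -/c -/s !expr2.
Qed.

End probability_tools.

(** * Consequences of the centered Feller condition *)

Section feller.
Context {d} {Omega : measurableType d} {R : realType} (P : probability Omega R).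
Variables (Y : {RV P >-> R}) (Y_ : nat -> {RV P >-> R}).
Hypothesis iidY : iid_copies P P Y (fun i => Y_ i : Omega -> R).
Hypothesis Y_ge0 : P [set w | 0 <= Y w] = 1%E.
Hypothesis Y_pos : (0 < P [set w | (0 < Y w)%R])%E.
Variable a : nat -> R.
Hypothesis fellerY : feller_constants Y a (fun=> 0).

Let a_gt0 n : 0 < a n. Proof. by case: fellerY. Qed.
Let a_cvg : a n @[n --> \oo] --> +oo. Proof. by case: fellerY. Qed.

(** Clipping by min(1, .) yields a quantity that is finite without any moment of Y, monotone in x,
    and changes by at most a constant factor under dilation of x. *)
Definition trunc_mean (x : R) : R := \int[P]_w Num.min 1 (`|Y w| / x).
Definition trunc_square (x : R) : R := \int[P]_w Num.min 1 ((`|Y w| / x) ^+ 2).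
(* A continuous substitute for z^2 1_{z <= 1}. *)
Definition bump (z : R) : R := z ^+ 2 * Num.max 0 (1 - z).
Definition local_square (x : R) : R := \int[P]_w bump (`|Y w| / x).

(** The absolute values change the sums only on a null set, but make nonnegativity hold at every
    point, as [laplace_iid_sum] requires. *)
Let S n w := \sum_(i < n) `|Y_ i w|.

Let mS n : measurable_fun setT (S n).
Proof. by apply: measurable_sum => i; measurability. Qed.

Let Y_sum_ae : {ae P, forall w, forall n, \sum_(i < n) Y_ i w = S n w}.
Proof.
have m0 : measurable [set y : R | 0 <= y].
  by rewrite (_ : [set y | _] = `[0, +oo[%classic)//; apply/seteqP; split => y /=;
     rewrite in_itv/= andbT.
have : {ae P, forall w, forall i, 0 <= Y_ i w}.
  apply: ae_foralln => i; apply: (@prob1_ae _ _ _ P [set w | 0 <= Y_ i w]).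
    by rewrite -[X in measurable X]setTI; exact: (@measurable_funP _ _ _ _ setT (Y_ i) measurableT _ m0).
  by have := iidY.2 i _ m0; rewrite -Y_ge0 => <-.
apply: filterS => w Yw n; apply: eq_bigr => i _; by rewrite ger0_norm.
Qed.

(** The Feller condition is applied to the given copies on their own space; [Y_sum_ae] then replaces
    the sums of the copies by [S]. *)
Lemma feller_subsequence phi : strictly_increasing phi ->
  exists psi, strictly_increasing psi /\
  exists (d'' : measure_display) (Omega'' : measurableType d'')
    (Q : probability Omega'' R) (W : {RV Q >-> R}),
    nondegenerate_rv Q W /\
    forall g : R -> R, continuous g -> (exists M, forall x, `|g x| <= M) ->
      \int[P]_w g (S (phi (psi k)) w / a (phi (psi k))) @[k --> \oo]
        --> \int[Q]_w g (W w).
Proof.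
move=> hphi; have [_ _ h] := fellerY.
have [psi [hpsi [? [? [Q [W [nW cW]]]]]]] := h _ _ P Y_ iidY phi hphi.
exists psi; split=> //; exists _, _, Q, W; split=> // g cg [M gM].
have mg : measurable_fun setT g by exact: continuous_measurable_fun.
have := cW g cg (ex_intro _ M gM); rewrite expectation_Rintegral; last first.
  by apply: (@bounded_integrable _ _ _ _ _ M) => //; exact: measurableT_comp.
move=> /fine_cvg; apply: cvg_trans; apply: near_eq_cvg; apply: nearW => k /=.
set n := phi (psi k); rewrite expectation_Rintegral; last first.
  apply: (@bounded_integrable _ _ _ _ _ M) => //; apply: measurableT_comp => //.
  apply: measurable_funM; first by measurability.
  apply: measurable_funB; last by measurability.
  by apply: measurable_sum => i; measurability.
rewrite /=; apply: Rintegral_ae_eq.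
- apply: measurableT_comp => //.
  apply: measurable_funM; first by measurability.
  apply: measurable_funB; last by measurability.
  by apply: measurable_sum => i; measurability.
- apply: (measurableT_comp mg); apply: measurable_funM; last by measurability.
  exact: mS.
- by apply: filterS Y_sum_ae => w ->; rewrite subr0 mulrC.
Qed.

Let my (x : R) : measurable_fun setT (fun w => `|Y w| / x).
Proof. by measurability. Qed.

Let y_ge0 x w : 0 < x -> 0 <= `|Y w| / x.
Proof. by move=> x0; rewrite divr_ge0// ltW. Qed.

Let min_bound (z : R) : 0 <= z -> `|Num.min 1 z| <= 1.
Proof. by move=> z0; rewrite ger0_norm ?ge_min ?lexx// le_min ler01. Qed.

Let mmin x : measurable_fun setT (fun w => Num.min 1 (`|Y w| / x)).
Proof. by measurability. Qed.

Let imin x : 0 < x -> P.-integrable setT (EFin \o (fun w => Num.min 1 (`|Y w| / x))).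
Proof.
move=> x0; apply: (@bounded_integrable _ _ _ _ _ 1) => // w.
exact/min_bound/y_ge0.
Qed.

Let imin2 x : 0 < x -> P.-integrable setT (EFin \o (fun w => Num.min 1 ((`|Y w| / x) ^+ 2))).
Proof.
move=> x0; apply: (@bounded_integrable _ _ _ _ _ 1) => [|w]; first by measurability.
exact/min_bound/sqr_ge0.
Qed.

Lemma bump_ge0 z : 0 <= bump z.
Proof. by rewrite mulr_ge0 ?sqr_ge0// le_max lexx. Qed.

Lemma bump_le_sqr z : 0 <= z -> bump z <= z ^+ 2.
Proof. by move=> z0; rewrite ler_piMr ?sqr_ge0// ge_max ler01/= gerBl. Qed.

Lemma bump_gt1 z : 1 <= z -> bump z = 0.
Proof. by move=> z1; rewrite /bump max_l ?mulr0// subr_le0. Qed.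

Lemma bump_le1 z : 0 <= z -> bump z <= 1.
Proof.
move=> z0; have [z1|/ltW z1] := leP 1 z; first by rewrite bump_gt1.
by apply: (le_trans (bump_le_sqr z0)); rewrite expr_le1.
Qed.

Let mbump x : measurable_fun setT (fun w => bump (`|Y w| / x)).
Proof. by rewrite /bump; measurability. Qed.

Let ibump x : 0 < x -> P.-integrable setT (EFin \o (fun w => bump (`|Y w| / x))).
Proof.
move=> x0; apply: (@bounded_integrable _ _ _ _ _ 1) => // w.
by rewrite ger0_norm ?bump_ge0// bump_le1// y_ge0.
Qed.

Lemma trunc_mean_ge0 x : 0 < x -> 0 <= trunc_mean x.
Proof. by move=> x0; apply: Rintegral_ge0 => w _; rewrite le_min ler01 y_ge0. Qed.

Lemma trunc_mean_le x x' : 0 < x -> x <= x' -> trunc_mean x' <= trunc_mean x.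
Proof.
move=> x0 xx'; have x'0 := lt_le_trans x0 xx'.
apply: le_Rintegral => //; [exact: imin|exact: imin|move=> w _].
by rewrite le_min ge_min lexx/= ge_min ler_wpM2l ?orbT// lef_pV2.
Qed.

Lemma trunc_square_le x x' : 0 < x -> x <= x' -> trunc_square x' <= trunc_square x.
Proof.
move=> x0 xx'; have x'0 := lt_le_trans x0 xx'.
apply: le_Rintegral => //; [exact: imin2|exact: imin2|move=> w _].
rewrite le_min ge_min lexx/= ge_min; apply/orP; right.
by apply: lerXn2r; rewrite ?nnegrE ?y_ge0// ler_wpM2l// lef_pV2.
Qed.

Lemma trunc_mean_scale x L : 0 < x -> 1 <= L -> trunc_mean x <= L * trunc_mean (L * x).
Proof.
move=> x0 L1; have L0 : 0 < L by exact: lt_le_trans L1.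
have Lx0 : 0 < L * x by rewrite mulr_gt0.
rewrite /trunc_mean -RintegralZl//; last exact: imin.
apply: le_Rintegral => //; [exact: imin|exact/integrable_scale/imin|move=> w _].
rewrite invfM mulrCA; set z := `|Y w| * x^-1.
have z0 : 0 <= z by exact: y_ge0.
by rewrite (minr_pMr _ _ (ltW L0)) mulr1 mulVKf ?gt_eqF// le_min !ge_min L1 lexx orbT.
Qed.

Lemma trunc_square_scale x L : 0 < x -> 1 <= L ->
  trunc_square x <= L ^+ 2 * trunc_square (L * x).
Proof.
move=> x0 L1; have L0 : 0 < L by exact: lt_le_trans L1.
have Lx0 : 0 < L * x by rewrite mulr_gt0.
rewrite /trunc_square -RintegralZl//; last exact: imin2.
apply: le_Rintegral => //; [exact: imin2|exact/integrable_scale/imin2|move=> w _].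
rewrite invfM mulrCA; set z := `|Y w| * x^-1.
have z0 : 0 <= z by exact: y_ge0.
rewrite (minr_pMr _ _ (sqr_ge0 L)) mulr1 -exprMn mulVKf ?gt_eqF//.
by rewrite le_min !ge_min exprn_ege1// lexx orbT.
Qed.

Lemma trunc_square_le_mean x : 0 < x -> trunc_square x <= trunc_mean x.
Proof.
move=> x0; apply: le_Rintegral => //; [exact: imin2|exact: imin|move=> w _].
have z0 := y_ge0 w x0; set z := _ / _ in z0 *.
have [z1|z1] := leP 1 z; first by rewrite ge_min lexx.
by rewrite ge_min expr2 ler_piMr ?orbT// ltW.
Qed.

Lemma trunc_mean_gt0 x : 0 < x -> 0 < trunc_mean x.
Proof.
move=> x0; rewrite ltNge; apply/negP => h.
have : {ae P, forall w, Num.min 1 (`|Y w| / x) = 0}.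
  apply: (@Rintegral_le0_ae _ _ _ P _ 1) => // w.
  by rewrite le_min ler01 y_ge0//= ge_min lexx.
move=> ae0; have : P [set w | (0 < Y w)%R] = 0%E.
  have [N [mN N0 sub]] := ae0; apply/eqP; rewrite -measure_le0 -N0.
  apply: le_measure; rewrite ?inE//.
    rewrite (_ : [set w | _] = setT `&` Y @^-1` `]0, +oo[%classic).
      by apply: (@measurable_funP _ _ _ _ setT Y) => //; exact: measurable_itv.
    by rewrite setTI; apply/seteqP; split => w /=; rewrite in_itv/= andbT.
  move=> w /= Yw; apply: sub => /= e.
  have : 0 < Num.min 1 (`|Y w| / x) by rewrite lt_min ltr01 divr_gt0// normr_gt0 gt_eqF.
  by rewrite e ltxx.
by move=> e; move: Y_pos; rewrite e ltxx.
Qed.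

(** The Laplace transform of the sum is (1 - h)^n with h = E(1 - exp(-|Y| / x)) >=
    [trunc_mean x / 2], and (1 - h)^n <= exp(-n h). *)
Lemma laplace_bound n x : 0 < x ->
  \int[P]_w expR (- `|S n w / x|) <= expR (- (n%:R * trunc_mean x / 2)).
Proof.
move=> x0; pose W i w := `|Y_ i w| / x.
have mW i : measurable_fun setT (W i) by rewrite /W; measurability.
have iidW : iid_copies P P (fun w => `|Y w| / x) W.
  apply: (@iid_copies_comp _ _ _ _ _ _ _ _ _ _ _ _ _ (fun y : R => `|y| / x) _ iidY).
  by measurability.
have := laplace_iid_sum mW (my x) iidW n (fun i w => divr_ge0 (normr_ge0 _) (ltW x0)).
have -> : \int[P]_w expR (- `|\sum_(i < n) W i w|) = \int[P]_w expR (- `|S n w / x|).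
  by apply: eq_Rintegral => w _; rewrite /S mulr_suml.
move=> ->; pose h := 1 - \int[P]_w expR (- `| `|Y w| / x|).
have ie : P.-integrable setT (EFin \o (fun w => expR (- `| `|Y w| / x|))).
  apply: (@bounded_integrable _ _ _ _ _ 1) => [|w]; first by measurability.
  by rewrite ger0_norm ?expR_ge0// -expR0 ler_expR oppr_le0.
have i1 : P.-integrable setT (EFin \o (fun=> 1 : R)).
  exact: prob_integrable_cst.
have hE : h = \int[P]_w (1 - expR (- `| `|Y w| / x|)).
  by rewrite RintegralB// prob_Rintegral_cst.
have h0 : trunc_mean x / 2 <= h.
  rewrite hE /trunc_mean -RintegralZr//; last exact: imin.
  apply: le_Rintegral => //.
  - have := integrable_scale 2^-1 (imin x0); congr (integrable _ _ _).
    by apply/funext => w /=; rewrite mulrC.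
  - have := integrable_add i1 (integrable_scale (-1) ie); congr (integrable _ _ _).
    by apply/funext => w /=; rewrite mulN1r.
  - by move=> w _; rewrite (ger0_norm (y_ge0 _ x0)); apply/one_sub_expRN_ge/y_ge0.
have h01 : 0 <= h <= 1.
  rewrite (le_trans _ h0) ?divr_ge0 ?trunc_mean_ge0//=.
  by rewrite /h lerBlDr lerDl; apply: Rintegral_ge0 => w _; exact: expR_ge0.
have -> : \int[P]_w expR (- `| `|Y w| / x|) = 1 - h by rewrite /h opprB addrC subrK.
apply: (le_trans (one_sub_exprn_le n h01)).
by rewrite ler_expR lerN2 -mulrA ler_wpM2l.
Qed.

(** If this failed, n H((k + 1) a_n) > e would hold along some n = phi k. By [laplace_bound] a
    subsequential limit W would satisfy E exp(-|W| / K) <= exp(-e / 2) for every positive integer K,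
    whereas the left side tends to 1 as K grows. *)
Lemma trunc_mean_tight (e : R) : 0 < e -> exists (L : R) (N : nat),
  1 <= L /\ forall n, (N <= n)%N -> n%:R * trunc_mean (L * a n) <= e.
Proof.
move=> e0; apply: contrapT => hn.
have [phi [hphi phiP]] : exists phi, strictly_increasing phi /\
    forall k, e < (phi k)%:R * trunc_mean (k.+1%:R * a (phi k)).
  apply: (@subsequence_exists (fun k n => e < n%:R * trunc_mean (k.+1%:R * a n))) => k N; apply: contrapT => hk; apply: hn.
  exists k.+1%:R, N; split; first by rewrite ler1n.
  move=> n Nn; rewrite leNgt; apply/negP => h; apply: hk; by exists n.
have [psi [hpsi [? [? [Q [W [_ cW]]]]]]] := feller_subsequence hphi.
pose g (K : nat) (x : R) := expR (- `|x / K.+1%:R|).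
have cg K : continuous (g K).
  move=> x; rewrite /g; apply: continuous_cvg; first exact: continuous_expR.
  by apply: cvgN; apply: cvg_norm; apply: cvgMl; exact: cvg_id.
have g1 K x : `|g K x| <= 1.
  by rewrite ger0_norm ?expR_ge0// -expR0 ler_expR oppr_le0.
have gW K : \int[Q]_w g K (W w) <= expR (- (e / 2)).
  have h := cW _ (cg K) (ex_intro _ 1 (g1 K)).
  rewrite -(cvg_lim _ h)//; apply: limr_le; first exact: cvgP h.
  (* For k >= K the failure at phi (psi k) is at level psi k + 1 >= K + 1, and H is
     nonincreasing. *)
  exists K => // k /= Kk; set n := phi (psi k).
  have -> : \int[P]_w g K (S n w / a n) = \int[P]_w expR (- `|S n w / (K.+1%:R * a n)|).
    by apply: eq_Rintegral => w _; rewrite /g invfM (mulrC K.+1%:R^-1) mulrA.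
  apply: (le_trans (laplace_bound n _)); first by rewrite mulr_gt0.
  rewrite ler_expR lerN2 ler_pM2r// (le_trans (ltW (phiP (psi k))))// ler_wpM2l//.
  apply: trunc_mean_le; first by rewrite mulr_gt0.
  by rewrite ler_pM2r// ler_nat ltnS (leq_trans Kk)// strictly_increasing_ge.
have : \int[Q]_w g K (W w) @[K --> \oo] --> \int[Q]_w (1 : R).
  apply: (@Rintegral_dominated_cvg _ _ _ _ _ _ (fun=> 1)) => //.
  - move=> K; apply: (measurableT_comp (continuous_measurable_fun (cg K))).
    exact: measurable_funP.
  - move=> w; rewrite -[X in _ --> X]expR0; apply: continuous_cvg; first exact: continuous_expR.
    rewrite -[X in _ --> X]oppr0; apply: cvgN; rewrite -[X in _ --> X](@normr0 _ R).
    apply: cvg_norm; rewrite -[X in _ --> X](mulr0 (W w)); apply: cvgMr.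
    exact: cvg_harmonic.
  - exact: prob_integrable_cst.
rewrite prob_Rintegral_cst => h1.
have : 1 <= expR (- (e / 2)).
  rewrite -[leLHS](cvg_lim _ h1)//; apply: limr_le; first exact: cvgP h1.
  by apply: nearW => K; exact: gW.
by rewrite -expR0 ler_expR oppr_ge0 leNgt divr_gt0.
Qed.

(** Dividing the argument by L costs at most a factor L, so the tightness bound at e = 1 gives C =
    L. *)
Lemma trunc_mean_bounded : exists (C : R) (N : nat),
  0 < C /\ forall n, (N <= n)%N -> n%:R * trunc_mean (a n) <= C.
Proof.
have [L [N [L1 h]]] := trunc_mean_tight ltr01; exists L, N; split.
  exact: lt_le_trans L1.
move=> n /h hn; apply: (@le_trans _ _ (L * (n%:R * trunc_mean (L * a n)))).
  by rewrite mulrCA ler_wpM2l// trunc_mean_scale.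
by rewrite -[leRHS]mulr1 ler_wpM2l// (le_trans _ L1).
Qed.

End feller.

Section feller_consequences.
Context {d} {Omega : measurableType d} {R : realType} (P : probability Omega R).
Variables (Y : {RV P >-> R}) (Y_ : nat -> {RV P >-> R}).
Hypothesis iidY : iid_copies P P Y (fun i => Y_ i : Omega -> R).
Hypothesis Y_ge0 : P [set w | 0 <= Y w] = 1%E.
Hypothesis Y_pos : (0 < P [set w | (0 < Y w)%R])%E.
Variable a : nat -> R.
Hypothesis fellerY : feller_constants Y a (fun=> 0).

Let a_gt0 n : 0 < a n. Proof. by case: fellerY. Qed.
Let a_cvg : a n @[n --> \oo] --> +oo. Proof. by case: fellerY. Qed.

Let S n w := \sum_(i < n) `|Y_ i w|.

Let mS n : measurable_fun setT (S n).
Proof. by apply: measurable_sum => i; measurability. Qed.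

(** Bernoulli reduces the claim to one summand. There 1 - cos u <= min(2, u^2 / 2), where u is t
    times the difference of two copies, and this is at most 2 (1 + t^2) times the sum of the two
    clipped squares. *)
Let charfun_ge (t : R) n :
  1 - n%:R * (4 * (1 + t ^+ 2) * trunc_square Y (a n)) <=
  (\int[P]_w cos (t * (S n w / a n))) ^+ 2 + (\int[P]_w sin (t * (S n w / a n))) ^+ 2.
Proof.
pose f w := t * (`|Y w| / a n); pose W i w := t * (`|Y_ i w| / a n).
have mW i : measurable_fun setT (W i) by rewrite /W; measurability.
have mf : measurable_fun setT f by rewrite /f; measurability.
have iidW : iid_copies P P f W.
  apply: (@iid_copies_comp _ _ _ _ _ _ _ _ _ _ _ _ _ (fun y : R => t * (`|y| / a n)) _ iidY).
  by measurability.
have WS w : \sum_(i < n) W i w = t * (S n w / a n).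
  by rewrite /S mulr_suml mulr_sumr.
have := cos_sin_iid_sum mW mf iidW n.
have -> : \int[P]_w cos (\sum_(i < n) W i w) = \int[P]_w cos (t * (S n w / a n)).
  by apply: eq_Rintegral => w _; rewrite WS.
have -> : \int[P]_w sin (\sum_(i < n) W i w) = \int[P]_w sin (t * (S n w / a n)).
  by apply: eq_Rintegral => w _; rewrite WS.
move=> ->; set cs := (\int[P]_w cos (f w)) ^+ 2 + _; have := one_sub_charfun_sqr P mf; rewrite -/cs => csE.
have D0 : 0 <= 1 - cs.
  rewrite csE; apply: Rintegral_ge0 => v _; apply: Rintegral_ge0 => w _.
  exact: one_sub_cos_ge0.
have D1 : 1 - cs <= 1 by rewrite gerBl addr_ge0 ?sqr_ge0.
rewrite -[X in _ <= X ^+ n](subKr 1); apply: (@le_trans _ _ (1 - n%:R * (1 - cs))); last first.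
  by apply: one_sub_exprn_ge; rewrite D0.
rewrite lerB// ler_wpM2l// csE.
pose q w := Num.min 1 ((`|Y w| / a n) ^+ 2).
have mq : measurable_fun setT q by rewrite /q; measurability.
have q01 w : 0 <= q w <= 1 by rewrite le_min ler01 sqr_ge0 ge_min lexx.
have bi (g : Omega -> R) (M : R) : measurable_fun setT g -> (forall w, 0 <= g w <= M) ->
    P.-integrable setT (EFin \o g).
  move=> mg g0M; apply: (@bounded_integrable _ _ _ _ _ M) => // w.
  by have /andP[g0 gM] := g0M w; rewrite ger0_norm.
set C := 2 * (1 + t ^+ 2); have t0 : 0 <= t ^+ 2 by exact: sqr_ge0.
have C0 : 0 <= C by rewrite /C; lra.
have CE (b : R) : 0 <= b <= 1 -> \int[P]_w (C * (q w + b)) = C * (trunc_square Y (a n) + b).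
  move=> /andP[b0 b1]; rewrite RintegralZl//; last first.
    apply: (bi _ 2) => [|w]; first by measurability.
    by have /andP[? ?] := q01 w; apply/andP; split; lra.
  rewrite RintegralD//; first by rewrite prob_Rintegral_cst.
    exact: (bi _ 1).
  by apply: (bi _ 1) => [|w]; [exact: measurable_cst|rewrite b0].
have pw w v : 1 - cos (f w - f v) <= C * (q w + q v).
  have qv0 := q01 v; have qw0 := q01 w; rewrite /C.
  set zw := `|Y w| / a n in qw0 *; set zv := `|Y v| / a n.
  have e1 : f w = t * zw by []; have e2 : f v = t * zv by [].
  rewrite e1 e2; have h1 := one_sub_cos_le (t * zw - t * zv).
  have h2 := one_sub_cos_le2 (t * zw - t * zv).
  rewrite /q -/zw -/zv in qv0 qw0 *.
  have [z1|z1] := lerP 1 (zw ^+ 2).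
    by have /andP[? _] := qv0; nra.
  have [z2|z2] := lerP 1 (zv ^+ 2); first by have := sqr_ge0 zw; nra.
  apply: (le_trans h1); have := sqr_ge0 (t * zw + t * zv); have := sqr_ge0 zw; have := sqr_ge0 zv.
  by nra.
have inner v : \int[P]_w (1 - cos (f w - f v)) <= C * (trunc_square Y (a n) + q v).
  rewrite -CE//; apply: le_Rintegral => //.
  - apply: (bi _ 2) => [|w]; first by measurability.
    by rewrite one_sub_cos_ge0 one_sub_cos_le2.
  - apply: (bi _ (C * 2)) => [|w]; first by measurability.
    have /andP[? ?] := q01 w; have /andP[? ?] := q01 v.
    by rewrite mulr_ge0 ?addr_ge0//= ler_wpM2l//; lra.
have T01 : 0 <= trunc_square Y (a n) <= 1.
  apply/andP; split; first by apply: Rintegral_ge0 => w _; have /andP[] := q01 w.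
  rewrite -[leRHS](prob_Rintegral_cst P); apply: le_Rintegral => //; first exact: (bi _ 1).
    by apply: (bi _ 1) => [|w]; [exact: measurable_cst|rewrite ler01 lexx].
  by move=> w _; have /andP[] := q01 w.
apply: (@le_trans _ _ (\int[P]_v (C * (q v + trunc_square Y (a n))))).
  apply: le_Rintegral => //.
  - apply: (@bounded_integrable _ _ _ _ _ 2) => [|v].
      rewrite (_ : (fun v => _) = fun v => \int[P]_w (1 - cos (f w - f v)))//.
      have -> : (fun v => \int[P]_w (1 - cos (f w - f v))) =
         (fun v => 1 - (cos (f v) * \int[P]_w cos (f w) + sin (f v) * \int[P]_w sin (f w))).
        apply/funext => v; exact: (charfun_shift P v mf).
      by measurability.
    rewrite ger0_norm; last by apply: Rintegral_ge0 => w _; exact: one_sub_cos_ge0.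
    rewrite -[leRHS](prob_Rintegral_cst P); apply: le_Rintegral => //.
    + apply: (bi _ 2) => [|w]; first by measurability.
      by rewrite one_sub_cos_ge0 one_sub_cos_le2.
    + by apply: (bi _ 2) => [|w]; [exact: measurable_cst|apply/andP; split; lra].
    + by move=> w _; exact: one_sub_cos_le2.
  - apply: (bi _ (C * 2)) => [|w]; first by measurability.
    have /andP[? ?] := q01 w; have /andP[? ?] := T01.
    by rewrite mulr_ge0 ?addr_ge0//= ler_wpM2l//; lra.
  - by move=> v _; rewrite (addrC (q v)); exact: inner.
by rewrite CE// /C; lra.
Qed.

(* Otherwise the characteristic function of a subsequential limit would have modulus one
   everywhere, which forces the limit to be a constant. *)
Lemma trunc_square_lower : exists (c : R) (N : nat),
  0 < c /\ forall n, (N <= n)%N -> c <= n%:R * trunc_square Y (a n).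
Proof.
apply: contrapT => hn.
have [phi [hphi phiP]] : exists phi, strictly_increasing phi /\
    forall k, (phi k)%:R * trunc_square Y (a (phi k)) < k.+1%:R^-1.
  apply: (@subsequence_exists (fun k n => n%:R * trunc_square Y (a n) < k.+1%:R^-1)) => k N.
  apply: contrapT => hk; apply: hn; exists k.+1%:R^-1, N; split; first by rewrite invr_gt0.
  move=> n Nn; rewrite leNgt; apply/negP => h; apply: hk; by exists n.
have [psi [hpsi [? [? [Q [W [ndW cW]]]]]]] := feller_subsequence iidY Y_ge0 fellerY hphi.
pose c t := \int[Q]_w cos (t * W w); pose s t := \int[Q]_w sin (t * W w).
have cs1 t : 1 <= c t ^+ 2 + s t ^+ 2.
  have ct : \int[P]_w cos (t * (S (phi (psi k)) w / a (phi (psi k)))) @[k --> \oo] --> c t.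
    apply: (cW (fun x => cos (t * x))); last by exists 1 => x; exact: cos_max.
    move=> x; apply: (@cvg_comp _ _ _ (fun x => t * x) cos); last exact: continuous_cos.
    by apply: cvgMr; exact: cvg_id.
  have st : \int[P]_w sin (t * (S (phi (psi k)) w / a (phi (psi k)))) @[k --> \oo] --> s t.
    apply: (cW (fun x => sin (t * x))); last by exists 1 => x; exact: sin_max.
    move=> x; apply: (@cvg_comp _ _ _ (fun x => t * x) sin); last exact: continuous_sin.
    by apply: cvgMr; exact: cvg_id.
  have cst : (\int[P]_w cos (t * (S (phi (psi k)) w / a (phi (psi k))))) ^+ 2 +
      (\int[P]_w sin (t * (S (phi (psi k)) w / a (phi (psi k))))) ^+ 2 @[k --> \oo]
      --> c t ^+ 2 + s t ^+ 2.
    by apply: cvgD; rewrite expr2; apply: cvgM.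
  have lo : (1 - 4 * (1 + t ^+ 2) * k.+1%:R^-1) @[k --> \oo] --> (1 : R).
    rewrite -[X in _ --> X]subr0; apply: cvgB; first exact: cvg_cst.
    rewrite -[X in _ --> X](mulr0 (4 * (1 + t ^+ 2))); apply: cvgMr.
    exact: cvg_harmonic.
  apply: (ler_cvg_to lo cst); apply: nearW => k.
  apply: le_trans (charfun_ge t (phi (psi k))); rewrite lerB//.
  rewrite mulrCA ler_wpM2l//; first by have := sqr_ge0 t; lra.
  apply: (le_trans (ltW (phiP (psi k)))).
  by rewrite lef_pV2 ?posrE// ler_nat ltnS strictly_increasing_ge.
have mtW t : measurable_fun setT (fun w => t * W w) by measurability.
have bi (g : _ -> R) : measurable_fun setT g -> (forall w, 0 <= g w <= 2) ->
    Q.-integrable setT (EFin \o g).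
  move=> mg g0M; apply: (@bounded_integrable _ _ _ _ _ 2) => // w.
  by have /andP[g0 gM] := g0M w; rewrite ger0_norm.
have D02 t v : 0 <= \int[Q]_w (1 - cos (t * W w - t * W v)) <= 2.
  apply/andP; split; first by apply: Rintegral_ge0 => w _; exact: one_sub_cos_ge0.
  rewrite -[leRHS](prob_Rintegral_cst Q); apply: le_Rintegral => //.
  - by apply: bi => [|w]; [measurability|rewrite one_sub_cos_ge0 one_sub_cos_le2].
  - by apply: bi => [|w]; [exact: measurable_cst|apply/andP; split; lra].
  - by move=> w _; exact: one_sub_cos_le2.
(* Only the frequencies 1 / (k + 1) are used: they produce countably many null sets, and they are
   small enough to exclude nonzero multiples of 2 pi. *)
have aev : {ae Q, forall v, forall k : nat,
    \int[Q]_w (1 - cos (k.+1%:R^-1 * W w - k.+1%:R^-1 * W v)) = 0}.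
  apply: ae_foralln => k; apply: (@Rintegral_le0_ae _ _ _ Q _ 2) => //.
    have -> : (fun v => \int[Q]_w (1 - cos (k.+1%:R^-1 * W w - k.+1%:R^-1 * W v))) =
       (fun v => 1 - (cos (k.+1%:R^-1 * W v) * \int[Q]_w cos (k.+1%:R^-1 * W w)
            + sin (k.+1%:R^-1 * W v) * \int[Q]_w sin (k.+1%:R^-1 * W w))).
      by apply/funext => v; exact: (charfun_shift Q v (mtW _)).
    by measurability.
  by rewrite -(one_sub_charfun_sqr Q (mtW _)) subr_le0; exact: cs1.
have [v hv] := ae_ex aev.
have aew : {ae Q, forall w, forall k : nat,
    1 - cos (k.+1%:R^-1 * W w - k.+1%:R^-1 * W v) = 0}.
  apply: ae_foralln => k; apply: (@Rintegral_le0_ae _ _ _ Q _ 2).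
  - by measurability.
  - by move=> w; rewrite one_sub_cos_ge0 one_sub_cos_le2.
  - by rewrite hv.
have := ndW (W v); rewrite (@ae_prob1 _ _ _ Q [set w | W w = W v]) ?ltxx//.
  rewrite (_ : [set w | _] = setT `&` W @^-1` [set W v]); last by rewrite setTI.
  by apply: (@measurable_funP _ _ _ _ setT W) => //; exact: measurable_set1.
apply: filterS aew => w hw; pose D := W w - W v.
(* Such a k brings D / (k + 1) into the range of [one_sub_cos_ge], where the cosine equals one only
   at zero. *)
have [k Dk] : exists k : nat, `|D| <= k%:R.
  by exists (Num.truncn `|D|).+1; apply/ltW; rewrite truncnS_gt.
have := hw k; rewrite -mulrBr -/D => e.
have : `|k.+1%:R^-1 * D| <= 2.
  rewrite normrM ger0_norm ?invr_ge0// ler_pdivrMl//.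
  by apply: (le_trans Dk); rewrite -natr1; have : 0 <= k%:R :> R by []; lra.
move=> /one_sub_cos_ge; rewrite e => h.
have : (k.+1%:R^-1 * D) ^+ 2 <= 0 by rewrite -(pmulr_rle0 _ (@cos_const_gt0 R)).
rewrite le_eqVlt ltNge sqr_ge0 orbF sqrf_eq0 mulf_eq0 invr_eq0 pnatr_eq0/= => /eqP.
by move/eqP; rewrite subr_eq0 => /eqP.
Qed.

End feller_consequences.

(** * Growth of the truncated second moment along the norming constants *)

Section tail_growth.
Context {d} {Omega : measurableType d} {R : realType} (P : probability Omega R).
Variables (Y : {RV P >-> R}) (Y_ : nat -> {RV P >-> R}).
Hypothesis iidY : iid_copies P P Y (fun i => Y_ i : Omega -> R).
Hypothesis Y_ge0 : P [set w | 0 <= Y w] = 1%E.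
Hypothesis Y_pos : (0 < P [set w | (0 < Y w)%R])%E.
Variable a : nat -> R.
Hypothesis fellerY : feller_constants Y a (fun=> 0).

Let a_gt0 n : 0 < a n. Proof. by case: fellerY. Qed.
Let a_cvg : a n @[n --> \oo] --> +oo. Proof. by case: fellerY. Qed.

Local Notation H := (trunc_mean Y).
Local Notation K := (local_square Y).

(** Pointwise, with u = |Y| / (L x): for u <= 1/2 the bump is at least u^2 / 2, and for u > 1/2 the
    term 2 min(1, u) is at least 1. *)
Lemma trunc_square_le_local (x L : R) : 0 < x -> 1 <= L ->
  trunc_square Y x <= 2 * L ^+ 2 * K (L * x) + 2 * H (L * x).
Proof.
move=> x0 L1; have L0 : 0 < L by exact: lt_le_trans L1.
have u0 w : 0 <= `|Y w| / (L * x) by rewrite divr_ge0// mulr_ge0// ltW.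
have i1 : P.-integrable setT (EFin \o (fun w => bump (`|Y w| / (L * x)))).
  apply: (@bounded_integrable _ _ _ _ _ 1) => [|w].
    by rewrite /bump; measurability.
  by rewrite ger0_norm ?bump_ge0 ?bump_le1.
have i2 : P.-integrable setT (EFin \o (fun w => Num.min 1 (`|Y w| / (L * x)))).
  apply: (@bounded_integrable _ _ _ _ _ 1) => [|w]; first by measurability.
  by rewrite ger0_norm ?ge_min ?lexx// le_min ler01 u0.
rewrite /trunc_square /local_square /trunc_mean -Rintegral_lincomb//.
apply: le_Rintegral => //; last 2 first.
- exact: integrable_lincomb.
- move=> w _; have -> : `|Y w| / x = L * (`|Y w| / (L * x)) by field; rewrite ?gt_eqF.
  set u := `|Y w| / _; have := u0 w; rewrite -/u => {}u0.
  have [u1|u1] := lerP u (2^-1).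
    have -> : bump u = u ^+ 2 * (1 - u) by rewrite /bump max_r//; lra.
    have : 0 <= Num.min 1 u by rewrite le_min ler01.
    have h : Num.min 1 ((L * u) ^+ 2) <= (L * u) ^+ 2 by rewrite ge_min lexx orbT.
    move=> m0; apply: (le_trans h); have : 0 <= L ^+ 2 * u ^+ 2 by rewrite mulr_ge0 ?sqr_ge0.
    move=> Lu0; have : 0 <= L ^+ 2 * u ^+ 2 * (1 - 2 * u) by rewrite mulr_ge0//; lra.
    by rewrite [(L * u) ^+ 2]exprMn; lra.
  apply: (@le_trans _ _ 1); first by rewrite ge_min lexx.
  have : 0 <= 2 * L ^+ 2 * bump u by rewrite mulr_ge0 ?bump_ge0// mulr_ge0// sqr_ge0.
  have : 2^-1 <= Num.min 1 u by rewrite le_min (ltW u1) andbT; lra.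
  by lra.
- apply: (@bounded_integrable _ _ _ _ _ 1) => [|w]; first by measurability.
  by rewrite ger0_norm ?ge_min ?lexx// le_min ler01 sqr_ge0.
Qed.

(* Given x, the bounds at a_n are used with n about c / (2 H x): then a_n <= x <= L1 * a_n. *)
Lemma trunc_mean_halving : exists L delta x0 : R, [/\ 1 <= L, 0 < delta, 0 < x0 &
  forall x, x0 <= x -> delta * H x <= K x /\ H (L * x) <= H x / 2].
Proof.
have [c [N0 [c0 hc]]] := trunc_square_lower iidY Y_ge0 fellerY.
have [C [NC [C0 hC]]] := trunc_mean_bounded iidY Y_ge0 fellerY.
have c4 : 0 < c / 4 by rewrite divr_gt0.
(* The value c / 4 lies below c / 2 < n H(x), which will force x <= L1 a_n. *)
have [L1 [N1 [L11 hL1]]] := trunc_mean_tight iidY Y_ge0 fellerY c4.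
have L10 : 0 < L1 by exact: lt_le_trans L11.
pose del := (L1 ^+ 2)^-1; have del0 : 0 < del by rewrite invr_gt0 exprn_gt0.
have del1 : del <= 1 by rewrite invf_le1 ?exprn_gt0// exprn_ege1.
(* The factor 1/8 will make 2 H(L2 x) at most half of [del * H x], so that this term can be
   absorbed. *)
have e20 : 0 < c * del / 8 by rewrite divr_gt0 ?mulr_gt0.
have [L2 [N2 [L21 hL2]]] := trunc_mean_tight iidY Y_ge0 fellerY e20.
have L20 : 0 < L2 by exact: lt_le_trans L21.
pose N := (N0 + N1 + N2).+1.
(* H(x) <= h0 makes y = c / H(x) at least 3 and at least 2 N. The integer n just above y / 2 then
   satisfies n >= N and y / 2 < n < y, that is, c / 2 < n H(x) < c. *)
pose h0 := Num.min (c / (2 * N%:R)) (c / 3).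
have h00 : 0 < h0 by rewrite lt_min !divr_gt0// mulr_gt0// ltr0n.
have [m [mNC mC]] : exists m, (NC <= m)%N /\ H (a m) <= h0.
  exists (NC + (Num.truncn (C / h0)).+1)%N; split; first exact: leq_addr.
  set m := (_ + _)%N; have m0 : 0 < m%:R :> R by rewrite ltr0n /m addnS.
  have := hC m (leq_addr _ _); rewrite -ler_pdivlMl// => /le_trans; apply.
  rewrite mulrC ler_pdivrMr// mulrC -ler_pdivrMr//.
  by rewrite (le_trans (ltW (truncnS_gt _)))// ler_nat leq_addl.
have main x : a m <= x -> [/\ (del / (4 * L2 ^+ 2)) * H (L2 * x) <= K (L2 * x)
                            & H (L2 * x) <= H x / 2].
  move=> mx; have x0 : 0 < x by exact: lt_le_trans (a_gt0 m) mx.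
  have L2x0 : 0 < L2 * x by rewrite mulr_gt0.
  have Hx0 := trunc_mean_gt0 Y_pos x0; have Hxh : H x <= h0.
    by apply: le_trans mC; exact: trunc_mean_le.
  pose y := c / H x; have y0 : 0 < y by rewrite divr_gt0.
  have yH : y * H x = c by rewrite /y divfK// gt_eqF.
  have Hxh1 : H x <= c / (2 * N%:R) by apply: (le_trans Hxh); rewrite ge_min lexx.
  have Hxh2 : H x <= c / 3 by apply: (le_trans Hxh); rewrite ge_min lexx orbT.
  pose n := (Num.truncn (y / 2)).+1.
  have n1 : y / 2 < n%:R by exact: truncnS_gt.
  have n2 : n%:R <= y / 2 + 1.
    by rewrite /n -natr1 lerD2r truncn_le// divr_ge0// ltW.
  have y3 : 3 <= y by rewrite ler_pdivlMr//; lra.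
  have nN : (N <= n)%N.
    rewrite -(ler_nat R) ltW//; apply: le_lt_trans n1.
    rewrite ler_pdivlMr// /y ler_pdivlMr// mulrC -ler_pdivlMr; first by rewrite (mulrC _ 2).
    by rewrite mulr_gt0// ltr0n.
  have n0 : 0 < n%:R :> R by rewrite ltr0n.
  have leN k : (k <= N0 + N1 + N2)%N -> (k <= n)%N.
    by move=> h; apply: leq_trans nN; rewrite (leq_trans h)// leqnSn.
  have hcn := hc n (leN _ (leq_trans (leq_addr _ _) (leq_addr _ _))).
  have hL1n := hL1 n (leN _ (leq_trans (leq_addl _ _) (leq_addr _ _))).
  have hL2n := hL2 n (leN _ (leq_addl _ _)).
  have Han : c <= n%:R * H (a n).
    by rewrite (le_trans hcn)// ler_wpM2l// trunc_square_le_mean.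
  have nHx : n%:R * H x < c by rewrite -yH ltr_pM2r//; lra.
  have nHx2 : c / 2 < n%:R * H x by rewrite -yH mulrAC ltr_pM2r.
  (* Otherwise n H(a_n) <= n H(x) < c, against c <= n H(a_n). *)
  have anx : a n <= x.
    rewrite leNgt; apply/negP => /ltW h.
    by have := trunc_mean_le Y x0 h; nra.
  have xL1 : x <= L1 * a n.
    rewrite leNgt; apply/negP => /ltW h.
    have := trunc_mean_le Y (mulr_gt0 L10 (a_gt0 n)) h.
    by rewrite -(ler_pM2l n0); lra.
  have QH : del * H x <= trunc_square Y x.
    have s1 := trunc_square_scale Y (a_gt0 n) L11.
    have s2 := trunc_square_le Y x0 xL1.
    rewrite /del ler_pdivrMl ?exprn_gt0// -(ler_pM2l n0).
    have : c <= n%:R * (L1 ^+ 2 * trunc_square Y x).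
      rewrite (le_trans hcn)// ler_wpM2l// (le_trans s1)// ler_wpM2l// sqr_ge0//.
    by lra.
  have HL2 : H (L2 * x) <= del / 4 * H x.
    have s1 : H (L2 * x) <= H (L2 * a n).
      by apply: trunc_mean_le; [rewrite mulr_gt0|rewrite ler_wpM2l// ltW].
    rewrite -(ler_pM2l n0); apply: (@le_trans _ _ (n%:R * H (L2 * a n))).
      by rewrite ler_wpM2l.
    by apply: (le_trans hL2n); nra.
  have LK := trunc_square_le_local x0 L21.
  split; last by have := trunc_mean_ge0 Y x0; nra.
  have HLx : H (L2 * x) <= H x by apply: trunc_mean_le => //; rewrite ler_peMl// ltW.
  have : del / 2 * H x <= 2 * L2 ^+ 2 * K (L2 * x) by lra.
  rewrite [X in _ -> X <= _](_ : _ = (2 * L2 ^+ 2)^-1 * (del / 2 * H (L2 * x))).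
    rewrite ler_pdivrMl ?mulr_gt0 ?exprn_gt0// => h; apply: le_trans h.
    by rewrite ler_wpM2l// divr_ge0// ltW.
  by field; rewrite gt_eqF.
(* The lower bound on [K] is obtained at L2 times the argument, so it is used at x / L2, which has
   to exceed a_m; hence the threshold L2 a_m. *)
exists L2, (del / (4 * L2 ^+ 2)), (L2 * a m); split => //.
- by rewrite divr_gt0// mulr_gt0// exprn_gt0.
- by rewrite mulr_gt0.
move=> x Lx; have [] := main (x / L2); first by rewrite ler_pdivlMr// mulrC.
rewrite (_ : L2 * (x / L2) = x); last by rewrite mulrC divfK// gt_eqF.
move=> h1 _; split=> //.
have x0 : 0 < x by apply: lt_le_trans Lx; rewrite mulr_gt0.
have [] := main x; last by [].
by apply: le_trans Lx; rewrite ler_peMl// ltW.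
Qed.

(** Descending from a_n to a_n / L^j in j halvings gives H(a_n / lam) >= 2^j H(a_n), while n H(a_n)
    >= n Q(a_n) >= c. The index N depends on lam because a_n / lam has to exceed the threshold of
    [trunc_mean_halving]. *)
Lemma local_square_growth : exists L c : R, [/\ 1 <= L, 0 < c &
  forall (j : nat) (lam : R), L ^+ j <= lam -> exists N : nat,
    forall n, (N <= n)%N -> c * 2 ^+ j <= n%:R * K (a n / lam)].
Proof.
have [L [del [x0 [L1 del0 x00 h]]]] := trunc_mean_halving.
have [c [N0 [c0 hc]]] := trunc_square_lower iidY Y_ge0 fellerY.
have L0 : 0 < L by exact: lt_le_trans L1.
exists L, (del * c); split; [by []|exact: mulr_gt0|move=> j lam jlam].
have lam0 : 0 < lam by apply: lt_le_trans jlam; rewrite exprn_gt0.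
have [N1 _ hN1] : \forall n \near \oo, lam * x0 <= a n.
  by move/cvgryPge : a_cvg => /(_ (lam * x0)).
exists (maxn N0 N1) => n; rewrite geq_max => /andP[nN0 nN1].
have lx : x0 <= a n / lam by rewrite ler_pdivlMr// mulrC; exact: hN1.
have jH : forall i, (i <= j)%N -> 2 ^+ i * H (a n) <= H (a n / L ^+ i).
  elim=> [|i IH] ij; first by rewrite !expr0 mul1r divr1.
  have Li : L ^+ i.+1 <= lam by apply: le_trans jlam; rewrite ler_weXn2l.
  have [_] : del * H (a n / L ^+ i.+1) <= K (a n / L ^+ i.+1) /\
      H (L * (a n / L ^+ i.+1)) <= H (a n / L ^+ i.+1) / 2.
    apply: h; apply: (le_trans lx); rewrite (ler_wpM2l (ltW (a_gt0 n)))//.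
    by rewrite lef_pV2 ?posrE ?exprn_gt0.
  have -> : L * (a n / L ^+ i.+1) = a n / L ^+ i.
    by rewrite exprS; field; rewrite ?expf_neq0 gt_eqF.
  by have := IH (ltnW ij); rewrite [2 ^+ i.+1]exprS; lra.
have [h1 _] := h _ lx.
have h2 : H (a n / L ^+ j) <= H (a n / lam).
  apply: trunc_mean_le; first by rewrite divr_gt0.
  by rewrite (ler_wpM2l (ltW (a_gt0 n)))// lef_pV2 ?posrE ?exprn_gt0.
have h3 : c <= n%:R * H (a n).
  by rewrite (le_trans (hc n nN0))// ler_wpM2l// trunc_square_le_mean.
have h4 := jH j (leqnn j).
apply: (@le_trans _ _ (n%:R * (del * (2 ^+ j * H (a n))))).
  rewrite (_ : n%:R * _ = del * 2 ^+ j * (n%:R * H (a n))); last by ring.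
  by rewrite mulrAC ler_wpM2l// mulr_ge0// ?exprn_ge0 ltW.
rewrite ler_wpM2l// (le_trans _ h1)// (ler_wpM2l (ltW del0))//.
exact: le_trans h4 h2.
Qed.

(** H(1) <= a_n H(a_n) and the bound on n H(a_n) show that n is O(a_n), and a_n tends to infinity.
    The lemma controls n times the square of a term of order 1 / a_n in
    [charfun_exponential_decay]. *)
Lemma norming_superlinear (e : R) : 0 < e ->
  exists N : nat, forall n, (N <= n)%N -> n%:R <= e * a n ^+ 2.
Proof.
move=> e0; have [C [NC [C0 hC]]] := trunc_mean_bounded iidY Y_ge0 fellerY.
have H1 := trunc_mean_gt0 Y_pos (@ltr01 R).
have [N1 _ hN1] : \forall n \near \oo, Num.max 1 (C / H 1 / e) <= a n.
  by move/cvgryPge : a_cvg => /(_ (Num.max 1 (C / H 1 / e))).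
exists (maxn NC N1) => n; rewrite geq_max => /andP[nNC nN1].
have := hN1 n nN1; rewrite /= ge_max => /andP[a1 a2].
have h1 : H 1 <= a n * H (a n).
  by have := @trunc_mean_scale _ _ _ _ Y 1 (a n) ltr01 a1; rewrite mulr1.
have h2 := hC n nNC; have n0 : 0 <= n%:R :> R by [].
have h3 : n%:R * H 1 <= C * a n by have := a_gt0 n; nra.
have h4 : n%:R <= C / H 1 * a n by rewrite mulrAC ler_pdivlMr.
apply: (le_trans h4); rewrite expr2 mulrA (ler_wpM2r (ltW (a_gt0 n)))//.
by rewrite -ler_pdivrMl// [leLHS]mulrC.
Qed.

End tail_growth.

(** * Decay of the characteristic functions and tightness *)

Section nondegenerate_spread.
Context {d} {Omega : measurableType d} {R : realType} (P : probability Omega R).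

Lemma not_ae_prob_gt0 (A : set Omega) : measurable A ->
  ~ {ae P, forall w, ~ A w} -> 0 < fine (P A).
Proof.
move=> mA h; rewrite fine_gt0// lt0e measure_ge0 andbT; apply/andP; split.
  by apply/eqP => PA; apply: h; exists A; split=> // w /= /contrapT.
by rewrite -ge0_fin_numE// fin_num_measure.
Qed.

Lemma bounded_prob_gt0 (Z : Omega -> R) : measurable_fun setT Z ->
  exists M : nat, 0 < fine (P [set w | `|Z w| <= M%:R]).
Proof.
move=> mZ; apply: contrapT => hn.
have : {ae P, forall w, forall k : nat, ~ (`|Z w| <= k%:R)}.
  apply: ae_foralln => k; apply: contrapT => hk; apply: hn; exists k.
  apply: not_ae_prob_gt0 => //.
  rewrite (_ : [set w | _] = setT `&` (fun w => `|Z w|) @^-1` `]-oo, k%:R]%classic).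
    by apply: (_ : measurable_fun setT (fun w => `|Z w|)); [measurability|..].
  by rewrite setTI; apply/seteqP; split => w /=; rewrite in_itv.
move=> /ae_ex[w /(_ (Num.truncn `|Z w|).+1)]; apply.
exact/ltW/truncnS_gt.
Qed.

Variable X : {RV P >-> R}.
Hypothesis X_nondegenerate : nondegenerate_rv P X.

Let mX (A : set R) : measurable A -> measurable (X @^-1` A).
Proof. by move=> mA; rewrite -[X in measurable X]setTI; exact: (@measurable_funP _ _ _ _ setT X). Qed.

(** Let c be the supremum of the almost sure lower bounds of X. Without a split every x > c would be
    an almost sure upper bound, so X would equal c almost surely. *)
Lemma nondegenerate_split : exists al be : R, [/\ al < be,
  ~ {ae P, forall w, al < X w} & ~ {ae P, forall w, X w < be}].
Proof.
apply: contrapT => hn.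
have h al be : al < be -> {ae P, forall w, al < X w} \/ {ae P, forall w, X w < be}.
  move=> ab; apply: contrapT => /not_orP[h1 h2]; apply: hn; by exists al, be.
pose E := [set x : R | {ae P, forall w, x < X w}].
have E0 : E !=set0.
  apply: contrapT => hE.
  have : {ae P, forall w, forall k : nat, X w < - k%:R}.
    apply: ae_foralln => k.
    have [|h1|//] := h (- k%:R - 1) (- k%:R); first by rewrite ltrBlDr ltrDl.
    by exfalso; apply: hE; exists (- k%:R - 1).
  move=> /ae_ex[w hw]; have := hw (Num.truncn `|X w|).+1.
  by rewrite ltrNr => /(lt_trans (truncnS_gt _)); rewrite ltNge -normrN ler_norm.
have Eub : has_ubound E.
  apply: contrapT => hE.
  have : {ae P, forall w, forall k : nat, k%:R < X w}.
    apply: ae_foralln => k.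
    have [e Ee ke] : exists2 e, E e & k%:R < e.
      apply: contrapT => hk; apply: hE; exists k%:R => e Ee.
      by rewrite leNgt; apply/negP => ke; apply: hk; exists e.
    by apply: filterS Ee => w; exact: lt_trans.
  move=> /ae_ex[w hw]; have := hw (Num.truncn `|X w|).+1.
  by move=> /(lt_trans (truncnS_gt _)); rewrite ltNge ler_norm.
pose c := sup E.
have lo (x : R) : x < c -> {ae P, forall w, x < X w}.
  move=> xc; have [e Ee xe] := sup_gt E0 xc.
  by apply: filterS Ee => w; exact: lt_trans.
have hi (x : R) : c < x -> {ae P, forall w, X w < x}.
  move=> cx; have [|h1|//] := h ((c + x) / 2) x; first by lra.
  have h2 : (c + x) / 2 <= c by exact: ub_le_sup.
  by exfalso; lra.
have ae1 : {ae P, forall w, forall k : nat, c - k.+1%:R^-1 < X w}.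
  by apply: ae_foralln => k; apply: lo; rewrite ltrBlDr ltrDl invr_gt0.
have ae2 : {ae P, forall w, forall k : nat, X w < c + k.+1%:R^-1}.
  by apply: ae_foralln => k; apply: hi; rewrite ltrDl invr_gt0.
have := X_nondegenerate c; rewrite (@ae_prob1 _ _ _ P [set w | X w = c]) ?ltxx//.
  exact: (mX (measurable_set1 c)).
apply: filterS2 ae1 ae2 => w h1 h2; apply/eqP; rewrite -subr_eq0 -normr_eq0; apply/eqP/le_anti.
rewrite normr_ge0 andbT; apply/ler_addgt0Pl => e e0; rewrite addr0.
pose k := Num.truncn e^-1; have ke : k.+1%:R^-1 <= e.
  by rewrite -[leRHS]invrK lef_pV2 ?posrE ?invr_gt0// ltW// truncnS_gt.
have := h1 k; have := h2 k; rewrite ler_norml; move: (k.+1%:R^-1) ke => z ze ? ?.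
by apply/andP; split; lra.
Qed.

(* The affine function s x + t cannot be small on both sides of a split of the law of X. *)
Lemma spread_directions : exists M eta p : R, [/\ 1 <= M, 0 < eta, 0 < p &
  forall s t : R, exists2 A : set R, measurable A /\ p <= fine (P (X @^-1` A)) &
    forall x, A x -> eta * (`|s| + `|t|) <= `|s * x + t| <= M * (`|s| + `|t|)].
Proof.
have [al [be [ab hal hbe]]] := nondegenerate_split.
have [M1 hM1] : exists k : nat, ~ {ae P, forall w, ~ (- k%:R <= X w <= al)}.
  apply: contrapT => hn; apply: hal.
  have : {ae P, forall w, forall k : nat, ~ (- k%:R <= X w <= al)}.
    by apply: ae_foralln => k; apply: contrapT => hk; apply: hn; exists k.
  apply: filterS => w /(_ (Num.truncn `|X w|).+1) hw; rewrite ltNge; apply/negP => Xal.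
  apply: hw; rewrite Xal andbT lerNl.
  by apply/ltW/(le_lt_trans _ (truncnS_gt _)); rewrite -normrN ler_norm.
have [M2 hM2] : exists k : nat, ~ {ae P, forall w, ~ (be <= X w <= k%:R)}.
  apply: contrapT => hn; apply: hbe.
  have : {ae P, forall w, forall k : nat, ~ (be <= X w <= k%:R)}.
    by apply: ae_foralln => k; apply: contrapT => hk; apply: hn; exists k.
  apply: filterS => w /(_ (Num.truncn `|X w|).+1) hw; rewrite ltNge; apply/negP => Xbe.
  apply: hw; rewrite Xbe/=.
  by apply/ltW/(le_lt_trans _ (truncnS_gt _)); exact: ler_norm.
pose A1 := `[- M1%:R, al]%classic : set R; pose A2 := `[be, M2%:R]%classic : set R.
have p1 : 0 < fine (P (X @^-1` A1)).
  apply: not_ae_prob_gt0; first by apply: mX; exact: measurable_itv.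
  apply: contra_not hM1; apply: filterS => w; apply: contra_not => /=.
  by rewrite /A1/= in_itv.
have p2 : 0 < fine (P (X @^-1` A2)).
  apply: not_ae_prob_gt0; first by apply: mX; exact: measurable_itv.
  apply: contra_not hM2; apply: filterS => w; apply: contra_not => /=.
  by rewrite /A2/= in_itv.
pose M : R := 1 + M1%:R + M2%:R + `|al| + `|be|.
have M1_0 : 0 <= M1%:R :> R by [].
have M2_0 : 0 <= M2%:R :> R by [].
have nal := normr_ge0 al; have nbe := normr_ge0 be.
have M_1 : 1 <= M by rewrite /M; lra.
have A1M x : A1 x -> `|x| <= M.
  rewrite /A1/= in_itv/= => /andP[h1 h2]; rewrite ler_norml /M.
  by have := ler_norm al; move=> ?; apply/andP; split; lra.
have A2M x : A2 x -> `|x| <= M.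
  rewrite /A2/= in_itv/= => /andP[h1 h2]; rewrite ler_norml /M.
  by have := ler_norm (- be); rewrite normrN => ?; apply/andP; split; lra.
(* Chosen so that eta (2 (be - al) + 4 (M + 1)) = be - al: if both pieces failed, the estimates
   below would give be - al <= (be - al) / 2. *)
pose eta := (be - al) / (2 * (be - al) + 4 * (M + 1)).
have den0 : 0 < 2 * (be - al) + 4 * (M + 1) by lra.
have eta0 : 0 < eta by rewrite divr_gt0// subr_gt0.
have up s t x : `|x| <= M -> `|s * x + t| <= M * (`|s| + `|t|).
  move=> xM; rewrite (le_trans (ler_normD _ _))// normrM.
  by have := normr_ge0 s; have := normr_ge0 t; nra.
exists M, eta, (Num.min (fine (P (X @^-1` A1))) (fine (P (X @^-1` A2)))); split => //.
  by rewrite lt_min p1.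
move=> s t; have [h|/existsNP[x /not_implyP[A1x hx]]] :=
  pselect (forall x, A1 x -> eta * (`|s| + `|t|) <= `|s * x + t|).
  exists A1; first by split; [exact: measurable_itv|rewrite ge_min lexx].
  by move=> x A1x; rewrite h//= up// A1M.
exists A2; first by split; [exact: measurable_itv|rewrite ge_min lexx orbT].
move=> x' A2x; rewrite up ?A2M// andbT leNgt; apply/negP => hx'.
move/negP : hx; rewrite -ltNge => hx.
(* Two small values, at x <= al and at x' >= be, bound the slope s; [e2] then bounds the intercept
   t. *)
have e1 : `|s| * (be - al) <= 2 * (eta * (`|s| + `|t|)).
  apply: (@le_trans _ _ (`|s * x' + t| + `|s * x + t|)); last by lra.
  apply: (le_trans _ (ler_normB _ _)); rewrite (_ : s * x' + t - (s * x + t) = s * (x' - x)); last by ring.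
  rewrite normrM ler_wpM2l//; apply: (le_trans _ (ler_norm _)).
  by move: A1x A2x; rewrite /A1 /A2/= !in_itv/= => /andP[_ ?] /andP[? _]; lra.
have e2 : `|t| <= eta * (`|s| + `|t|) + M * `|s|.
  apply: (@le_trans _ _ (`|s * x + t| + `|s * x|)).
    by rewrite -{1}(addKr (s * x) t) addrC (le_trans (ler_normB _ _)).
  by apply: lerD; [exact: ltW|rewrite normrM mulrC ler_wpM2r// A1M].
have r0 : 0 < `|s| + `|t|.
  rewrite lt_neqAle addr_ge0// andbT eq_sym; apply/eqP => r0.
  by move: hx; rewrite r0 mulr0 ltNge normr_ge0.
set r := `|s| + `|t| in e1 e2 r0 *.
have e3 : r * (be - al) <= eta * r * (be - al) + (M + 1) * (2 * (eta * r)).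
  apply: (@le_trans _ _ ((eta * r + (M + 1) * `|s|) * (be - al))).
    by rewrite ler_wpM2r ?subr_ge0 ?(ltW ab)//; rewrite /r; rewrite /r in e2; lra.
  by rewrite mulrDl lerD2l -mulrA ler_wpM2l//; lra.
have e4 : be - al <= eta * ((be - al) + 2 * (M + 1)).
  by rewrite -(ler_pM2l r0); apply: (le_trans e3); lra.
have e5 : eta * (2 * (be - al) + 4 * (M + 1)) = be - al by rewrite divfK// gt_eqF.
have : be - al <= (be - al) / 2 by rewrite -{2}e5; lra.
by lra.
Qed.

End nondegenerate_spread.

Section charfun_decay.
Context {d} {Omega : measurableType d} {R : realType} (P : probability Omega R).
Variables (X Y : {RV P >-> R}) (X_ Y_ : nat -> {RV P >-> R}).
Hypothesis indepXY : independent_rvs P X Y.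
Hypothesis X_nondegenerate : nondegenerate_rv P X.
Hypothesis Y_ge0 : P [set w | 0 <= Y w] = 1%E.
Hypothesis Y_pos : (0 < P [set w | (0 < Y w)%R])%E.
Hypothesis iidXY : iid_copies P P (fun w => (X w, Y w)) (fun i w => (X_ i w, Y_ i w)).
Variable a : nat -> R.
Hypothesis fellerY : feller_constants Y a (fun=> 0).

Let a_gt0 n : 0 < a n. Proof. by case: fellerY. Qed.
Let a_cvg : a n @[n --> \oo] --> +oo. Proof. by case: fellerY. Qed.

Let iidY : iid_copies P P Y (fun i => Y_ i : Omega -> R).
Proof.
have := @iid_copies_comp _ _ _ P _ _ _ _ P _ _ _ _ (snd : R * R -> R) measurable_snd iidXY.
by [].
Qed.

(** It rests on (u - v)^2 >= u^2 / 2 - v^2. Where [bump z] does not vanish z < 1, so |u - v| <= 2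
    and [one_sub_cos_ge] applies. *)
Lemma one_sub_cos_sub_ge (u v z e b : R) : 0 <= e -> 0 <= z -> e * z <= `|u| ->
  `|u| <= z -> `|v| <= b -> b <= 1 ->
  cos_const * (e ^+ 2 * bump z / 2 - b ^+ 2) <= 1 - cos (u - v).
Proof.
move=> e0 z0 ezu uz vb b1; have k0 := @cos_const_gt0 R.
have v2 : v ^+ 2 <= b ^+ 2.
  rewrite -(real_normK (num_real v)) lerXn2r// ?nnegrE//.
  exact: le_trans vb.
have [z1|z1] := leP 1 z.
  rewrite bump_gt1// mulr0 mul0r sub0r mulrN.
  apply: (@le_trans _ _ 0); last exact: one_sub_cos_ge0.
  by rewrite oppr_le0 mulr_ge0// ?sqr_ge0 ?ltW.
apply: (@le_trans _ _ (cos_const * (u - v) ^+ 2)); last first.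
  apply: one_sub_cos_ge; apply: (le_trans (ler_normB _ _)).
  by have := le_trans uz (ltW z1); have := le_trans vb b1; lra.
rewrite ler_pM2l//.
have u2 : e ^+ 2 * bump z <= u ^+ 2.
  apply: (@le_trans _ _ ((e * z) ^+ 2)); first by rewrite exprMn ler_wpM2l ?sqr_ge0 ?bump_le_sqr.
  by rewrite -(real_normK (num_real u)) lerXn2r// ?nnegrE// mulr_ge0.
by have := sqr_ge0 (u - 2 * v); nra.
Qed.

Let Z s t n w := (s * (X w * Y w) + t * Y w) / a n.

Let mZ s t n : measurable_fun setT (Z s t n).
Proof. by rewrite /Z; measurability. Qed.

(* In 1 - |E e^{iZ}|^2 = E_v E_w (1 - cos (Z w - Z v)), v is restricted to an event on which
   X and Y are bounded, so that Z v = O(1/a_n), and w to {X in A} with A spreading (s, t). *)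
Lemma charfun_exponential_decay : exists L c C : R, [/\ 1 <= L, 0 < c, 0 < C &
  forall (j : nat) (s t : R), L ^+ j <= `|s| + `|t| -> exists N : nat,
  forall n, (N <= n)%N ->
    ((\int[P]_w cos (Z s t n w)) ^+ 2 + (\int[P]_w sin (Z s t n w)) ^+ 2) ^+ n
      <= C * expR (- (c * 2 ^+ j))].
Proof.
have [M [eta [p [M1 eta0 p0 spread]]]] := spread_directions X_nondegenerate.
have M0 : 0 < M by exact: lt_le_trans M1.
have mXY : measurable_fun setT (fun w => `|X w| + `|Y w|) by measurability.
have [b pb0] := bounded_prob_gt0 P mXY.
set B := [set w | _] in pb0.
have mB : measurable B.
  rewrite /B (_ : [set w | _] = setT `&` (fun w => `|X w| + `|Y w|) @^-1` `]-oo, b%:R]%classic).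
    exact: mXY.
  by rewrite setTI; apply/seteqP; split => w /=; rewrite in_itv/= (@ger0_norm _ (`|X w| + _)) ?addr_ge0//.
set pB := fine (P B) in pb0.
have [L [c [L1 c0 grow]]] := local_square_growth iidY Y_ge0 Y_pos fellerY.
have k0 := @cos_const_gt0 R; set kap := cos_const in k0.
(* On {X in A}, with z = M r |Y| / a_n, the two bounds of [spread] read e z <= |Z| <= z. *)
pose e := eta / M; have e0 : 0 < e by rewrite divr_gt0.
have c'0 : 0 < pB * kap * (e ^+ 2 * p / 2) * c.
  by apply: mulr_gt0 => //; apply: mulr_gt0; apply: mulr_gt0 => //; apply: mulr_gt0 => //;
     rewrite exprn_gt0.
(* The constant exp(pB kap) absorbs the contribution of the second copy, since n times the square of
   its bound is made at most 1. *)
exists L, (pB * kap * (e ^+ 2 * p / 2) * c), (expR (pB * kap)).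
split; [by []|exact: c'0|exact: expR_gt0|].
move=> j s t Lj; pose r : R := `|s| + `|t|.
have r0 : 0 < r by apply: lt_le_trans Lj; rewrite exprn_gt0// (lt_le_trans _ L1).
have Mr0 : 0 < M * r by rewrite mulr_gt0.
have LMr : L ^+ j <= M * r by rewrite (le_trans Lj)// ler_peMl// ltW.
have [N1 hN1] := grow j _ LMr.
have [A [mA pA] hA] := spread s t.
have b0 : 0 <= b%:R :> R by [].
(* On [B] one has |s X + t| |Y| <= bb, hence |Z v| <= bb / a_n for v in [B]. *)
pose bb : R := (b%:R + 1) * b%:R * r.
have bb0 : 0 <= bb by rewrite !mulr_ge0 ?addr_ge0// ltW.
(* With this value [norming_superlinear] yields n (bb / a_n)^2 <= 1. *)
have ee0 : 0 < (bb ^+ 2 + 1)^-1 by rewrite invr_gt0 ltr_wpDl ?sqr_ge0.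
have [N2 hN2] := norming_superlinear iidY Y_ge0 Y_pos fellerY ee0.
have [N3 _ hN3] : \forall n \near \oo, bb <= a n.
  by move/cvgryPge : a_cvg => /(_ bb).
exists (maxn N1 (maxn N2 N3)) => n; rewrite !geq_max => /and3P[n1 n2 n3].
have {hN1}K1 := hN1 n n1; have {hN2}A2 := hN2 n n2; have {hN3}A3 : bb <= a n := hN3 n n3.
have an0 := a_gt0 n; pose x := a n / (M * r); have x0 : 0 < x by rewrite divr_gt0.
set cs := _ + _; have csE := one_sub_charfun_sqr P (mZ s t n); rewrite -/cs in csE.
pose G := kap * (e ^+ 2 * (p * local_square Y x) / 2 - (bb / a n) ^+ 2).
have mind (E : set Omega) : measurable E -> measurable_fun setT (\1_E : Omega -> R).
  by move=> mE; exact: measurable_indic.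
have i1 (E : set Omega) (w : Omega) : 0 <= (\1_E w : R) <= 1.
  by rewrite indicE; case: (w \in E); rewrite ?lexx ?ler01.
have mXA : measurable (X @^-1` A).
  by rewrite -[X in measurable X]setTI; exact: (@measurable_funP _ _ _ _ setT X).
have mbump : measurable_fun setT (fun w => bump (`|Y w| / x)).
  by rewrite /bump; measurability.
have bump01 w : 0 <= bump (`|Y w| / x) <= 1.
  by rewrite bump_ge0 bump_le1// divr_ge0// ltW.
have mlow : measurable_fun setT (fun w => \1_(X @^-1` A) w * bump (`|Y w| / x)).
  by apply: measurable_funM => //; exact: mind.
have low01 w : `|\1_(X @^-1` A) w * bump (`|Y w| / x)| <= 1.
  have /andP[h1 h2] := i1 (X @^-1` A) w; have /andP[h3 h4] := bump01 w.
  by rewrite (ger0_norm (mulr_ge0 h1 h3)); exact: (mulr_ile1 h1 h3 h2 h4).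
have ilow := bounded_integrable P mlow low01.
(* Independence of X and Y separates the event on X from the bump in Y. *)
have lowE : p * local_square Y x <= \int[P]_w (\1_(X @^-1` A) w * bump (`|Y w| / x)).
  have -> : \int[P]_w (\1_(X @^-1` A) w * bump (`|Y w| / x)) =
      \int[P]_w ((\1_A : R -> R) (X w) * bump (`|Y w| / x)).
    by apply: eq_Rintegral => w _; rewrite !indicE.
  rewrite (@independent_Rintegral _ _ _ P _ _ _ _ X Y (\1_A) (fun y => bump (`|y| / x)) 1 1)//.
  - rewrite ler_wpM2r//; first by apply: Rintegral_ge0 => w _; exact: bump_ge0.
    apply: (le_trans pA); rewrite -Rintegral_indic//.
  - by rewrite /bump; measurability.
  - by move=> y; rewrite indicE; case: (y \in A); rewrite ?normr1 ?normr0.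
  - by move=> y; rewrite ger0_norm ?bump_ge0// bump_le1// divr_ge0// ltW.
have icst (q : R) : P.-integrable setT (EFin \o (fun=> q)).
  by apply: (@bounded_integrable _ _ _ _ _ `|q|) => //=.
have m1c v : measurable_fun setT (fun w => 1 - cos (Z s t n w - Z s t n v)).
  by measurability.
have i1c v : P.-integrable setT (EFin \o (fun w => 1 - cos (Z s t n w - Z s t n v))).
  apply: (@bounded_integrable _ _ _ _ _ 2) => // w.
  by rewrite ger0_norm ?one_sub_cos_ge0 ?one_sub_cos_le2.
have inner v : B v -> G <= \int[P]_w (1 - cos (Z s t n w - Z s t n v)).
  move=> Bv.
  have vb : `|Z s t n v| <= bb / a n.
    move: Bv; rewrite /B/= (@ger0_norm _ (`|X v| + _)) ?addr_ge0// => Bv.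
    rewrite /Z normrM [X in _ * X](ger0_norm (_ : 0 <= (a n)^-1)) ?invr_ge0 ?(ltW an0)// ler_wpM2r ?invr_ge0 ?(ltW an0)//.
    rewrite (_ : _ + _ = (s * X v + t) * Y v); last by ring.
    rewrite normrM /bb mulrAC.
    have hX : `|X v| <= b%:R by apply: le_trans Bv; rewrite lerDl.
    have hY : `|Y v| <= b%:R by apply: le_trans Bv; rewrite lerDr.
    apply: ler_pM => //; apply: (le_trans (ler_normD _ _)); rewrite normrM /r.
    rewrite mulrDl mul1r; apply: lerD; last by rewrite lerDr.
    by rewrite mulrC; apply: ler_pM => //; rewrite lerDl.
  have pw w : kap * (e ^+ 2 / 2) * (\1_(X @^-1` A) w * bump (`|Y w| / x)) +
      (- 1) * (kap * (bb / a n) ^+ 2) <= 1 - cos (Z s t n w - Z s t n v).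
    rewrite indicE; have [|nA] := boolP (w \in _); last first.
      rewrite mul0r mulr0 add0r mulN1r; apply: (@le_trans _ _ 0); last exact: one_sub_cos_ge0.
      by rewrite oppr_le0 mulr_ge0// ?sqr_ge0// ltW.
    rewrite inE/= => /hA/andP[h1 h2].
    have zE : `|Y w| / x = M * r * `|Y w| / a n.
      by rewrite /x; field; rewrite !gt_eqF.
    have uE : `|Z s t n w| = `|s * X w + t| * `|Y w| / a n.
      rewrite /Z normrM [X in _ * X = _](ger0_norm (_ : 0 <= (a n)^-1)) ?invr_ge0 ?(ltW an0)//.
      by rewrite -normrM; congr (`|_| * _); ring.
    have := @one_sub_cos_sub_ge (Z s t n w) (Z s t n v) (`|Y w| / x) e (bb / a n).
    rewrite (_ : kap * _ * _ + _ = cos_const * (e ^+ 2 * bump (`|Y w| / x) / 2 - (bb / a n) ^+ 2)).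
      apply => //; first exact: ltW.
      - by rewrite divr_ge0// ltW.
      - rewrite uE zE /e !mulrA ler_wpM2r ?invr_ge0 ?(ltW an0)// ler_wpM2r//.
        by rewrite divfK ?gt_eqF.
      - by rewrite uE zE ler_wpM2r ?invr_ge0 ?(ltW an0)// ler_wpM2r.
      - by rewrite ler_pdivrMr// mul1r.
    by rewrite /kap; field; rewrite gt_eqF.
  apply: (@le_trans _ _ (\int[P]_w (kap * (e ^+ 2 / 2) *
      (\1_(X @^-1` A) w * bump (`|Y w| / x)) + (- 1) * (kap * (bb / a n) ^+ 2)))).
    rewrite Rintegral_lincomb// prob_Rintegral_cst /G.
    have k1 : 0 <= kap * (e ^+ 2 / 2) by rewrite mulr_ge0 ?divr_ge0 ?sqr_ge0// ltW.
    have := ler_wpM2l k1 lowE; lra.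
  apply: le_Rintegral => //; exact: integrable_lincomb.
(* The integrand in v is nonnegative, so its integral over [B] alone is a lower bound. *)
have DG : pB * G <= 1 - cs.
  rewrite csE.
  rewrite (_ : pB * G = \int[P]_v (\1_B v * G)); last first.
    rewrite RintegralZr//; first by rewrite Rintegral_indic.
    apply: (@bounded_integrable _ _ _ _ _ 1) => [|w]; first exact: mind.
    by have /andP[h1 h2] := i1 B w; rewrite ger0_norm.
  apply: le_Rintegral => //.
  - apply: (@bounded_integrable _ _ _ _ _ `|G|) => [|w].
      by apply: measurable_funM; [exact: mind|measurability].
    have /andP[h1 h2] := i1 B w; rewrite normrM ger0_norm// ler_piMl//.
  - apply: (@bounded_integrable _ _ _ _ _ 2) => [|v].
      have -> : (fun v => \int[P]_w (1 - cos (Z s t n w - Z s t n v))) =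
         (fun v => 1 - (cos (Z s t n v) * \int[P]_w cos (Z s t n w)
           + sin (Z s t n v) * \int[P]_w sin (Z s t n w))).
        by apply/funext => v; exact: charfun_shift.
      by measurability.
    rewrite ger0_norm; last by apply: Rintegral_ge0 => w _; exact: one_sub_cos_ge0.
    rewrite -[leRHS](prob_Rintegral_cst P); apply: le_Rintegral => //.
    by move=> w _; exact: one_sub_cos_le2.
  - move=> v _; rewrite indicE; have [|_] := boolP (v \in B).
      by rewrite inE mul1r => /inner.
    by rewrite mul0r; apply: Rintegral_ge0 => w _; exact: one_sub_cos_ge0.
have cs0 : 0 <= cs by rewrite addr_ge0 ?sqr_ge0.
have cs1 : cs <= 1.
  rewrite -subr_ge0 csE; apply: Rintegral_ge0 => v _; apply: Rintegral_ge0 => w _.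
  exact: one_sub_cos_ge0.
apply: (@le_trans _ _ (expR (- (n%:R * (1 - cs))))).
  rewrite -{1}(subKr 1 cs); apply: one_sub_exprn_le.
  by rewrite subr_ge0 cs1 gerBl cs0.
rewrite -expRD ler_expR.
have nb : n%:R * (bb / a n) ^+ 2 <= 1.
  rewrite expr_div_n mulrA ler_pdivrMr ?exprn_gt0// mul1r.
  apply: (@le_trans _ _ ((bb ^+ 2 + 1)^-1 * a n ^+ 2 * bb ^+ 2)).
    by rewrite ler_wpM2r ?sqr_ge0.
  rewrite mulrAC ler_piMl ?sqr_ge0// mulrC ler_pdivrMr ?mul1r ?lerDl//.
  by rewrite ltr_wpDl ?sqr_ge0.
have n0 : 0 <= n%:R :> R by [].
have := ler_wpM2l n0 DG.
have -> : n%:R * (pB * G) = pB * kap * (e ^+ 2 * p / 2) * (n%:R * local_square Y x)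
    - pB * kap * (n%:R * (bb / a n) ^+ 2).
  by rewrite /G; field; rewrite gt_eqF.
have := ler_wpM2l (ltW (mulr_gt0 pb0 k0)) nb.
have q0 : 0 <= pB * kap * (e ^+ 2 * p / 2).
  by apply: ltW; rewrite -(pmulr_lgt0 _ c0).
by have := ler_wpM2l q0 K1; rewrite -/x; lra.
Qed.

End charfun_decay.

(** The factorization is known for bounded functions; g is truncated at k and recovered by dominated
    convergence. *)
Lemma Rintegral_independent_integrable d d1 d2 {Omega : measurableType d} {R : realType}
    (P : probability Omega R) (T1 : measurableType d1) (T2 : measurableType d2)
    (U : Omega -> T1) (V : Omega -> T2) (g : T1 -> R) (q : T2 -> R) :
  measurable_fun setT U -> measurable_fun setT V -> independent_rvs P U V ->
  measurable_fun setT g -> measurable_fun setT q ->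
  (forall x, 0 <= g x) -> (forall x, 0 <= q x <= 1) ->
  P.-integrable setT (EFin \o (g \o U)) ->
  \int[P]_w (g (U w) * q (V w)) = \int[P]_w g (U w) * \int[P]_w q (V w).
Proof.
move=> mU mV indep mg mq g0 q01 ig.
pose gk (k : nat) x := Num.min (g x) k%:R.
have gk0 k x : 0 <= gk k x by rewrite le_min g0 ler0n.
have gkg k x : gk k x <= g x by rewrite ge_min lexx.
have mgk k : measurable_fun setT (gk k).
  by apply: measurable_minr => //; exact: measurable_cst.
have mgU : measurable_fun setT (g \o U) by exact: measurableT_comp.
have mgkU k : measurable_fun setT (gk k \o U) by exact: measurableT_comp.
have mqV : measurable_fun setT (q \o V) by exact: measurableT_comp.
have cgk x : gk k x @[k --> \oo] --> g x.
  apply: (@cvg_trans _ ((fun=> g x : R) @ \oo)); last exact: cvg_cst.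
  apply: near_eq_cvg; exists (Num.truncn (g x)).+1 => // k /= gxk.
  rewrite /gk min_l// ltW// (lt_le_trans (truncnS_gt _))// ler_nat//.
have h1 : \int[P]_w (gk k (U w) * q (V w)) @[k --> \oo] --> \int[P]_w (g (U w) * q (V w)).
  apply: (Rintegral_dominated_cvg (g := g \o U)) => //.
  - by move=> k; exact: (measurable_funM (mgkU k) mqV).
  - by move=> w; apply: cvgM; [exact: cgk|exact: cvg_cst].
  - move=> k w /=; have /andP[q0 q1] := q01 (V w).
    by rewrite ger0_norm ?mulr_ge0// (le_trans _ (gkg k _))// ler_piMr.
have h2 : \int[P]_w gk k (U w) @[k --> \oo] --> \int[P]_w g (U w).
  apply: (Rintegral_dominated_cvg (g := g \o U)) => //.
  by move=> k w /=; rewrite ger0_norm.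
have h3 : \int[P]_w (gk k (U w) * q (V w)) @[k --> \oo]
    --> \int[P]_w g (U w) * \int[P]_w q (V w).
  rewrite (_ : (fun k => _) = (fun k => \int[P]_w gk k (U w) * \int[P]_w q (V w))).
    by apply: cvgM => //; exact: cvg_cst.
  apply/funext => k.
  apply: (@independent_Rintegral _ _ _ P _ _ _ _ U V (gk k) q k%:R 1) => //.
    by move=> x; rewrite ger0_norm// ge_min lexx orbT.
  by move=> x; have /andP[q0 q1] := q01 x; rewrite ger0_norm.
by rewrite -(cvg_lim _ h1)// (cvg_lim _ h3).
Qed.

(** * Rapid decay in the frequencies and tightness of the normed sums *)

Section partial_sums.
Context {d} {Omega : measurableType d} {R : realType} (P : probability Omega R).
Variables (X Y : {RV P >-> R}) (X_ Y_ : nat -> {RV P >-> R}).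
Hypothesis indepXY : independent_rvs P X Y.
Hypothesis X_nondegenerate : nondegenerate_rv P X.
Hypothesis X_integrable : ('E_P[fun w => `|X w|%R] < +oo)%E.
Hypothesis Y_ge0 : P [set w | 0 <= Y w] = 1%E.
Hypothesis Y_pos : (0 < P [set w | (0 < Y w)%R])%E.
Hypothesis iidXY : iid_copies P P (fun w => (X w, Y w)) (fun i w => (X_ i w, Y_ i w)).
Variable a : nat -> R.
Hypothesis fellerY : feller_constants Y a (fun=> 0).

Let a_gt0 n : 0 < a n. Proof. by case: fellerY. Qed.

Let iidY : iid_copies P P Y (fun i => Y_ i : Omega -> R).
Proof.
have := @iid_copies_comp _ _ _ P _ _ _ _ P _ _ _ _ (snd : R * R -> R) measurable_snd iidXY.
by [].
Qed.

Let U1 n w := (\sum_(i < n) X_ i w * Y_ i w) / a n.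
Let U2 n w := (\sum_(i < n) Y_ i w) / a n.

Let charfun_sqr s t n :=
  (\int[P]_w cos (s * U1 n w + t * U2 n w)) ^+ 2 +
  (\int[P]_w sin (s * U1 n w + t * U2 n w)) ^+ 2.

Let charfun_sqrE s t n : charfun_sqr s t n =
  ((\int[P]_w cos ((s * (X w * Y w) + t * Y w) / a n)) ^+ 2 +
   (\int[P]_w sin ((s * (X w * Y w) + t * Y w) / a n)) ^+ 2) ^+ n.
Proof.
pose W i w := (s * (X_ i w * Y_ i w) + t * Y_ i w) / a n.
have mW i : measurable_fun setT (W i) by rewrite /W; measurability.
pose W0 w := (s * (X w * Y w) + t * Y w) / a n.
have mW0 : measurable_fun setT W0 by rewrite /W0; measurability.
have iidW : iid_copies P P W0 W.
  apply: (@iid_copies_comp _ _ _ _ _ _ _ _ _ _ _ _ _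
    (fun z : R * R => (s * (z.1 * z.2) + t * z.2) / a n) _ iidXY).
  by measurability.
rewrite -(cos_sin_iid_sum mW mW0 iidW n) /charfun_sqr.
have WE w : \sum_(i < n) W i w = s * U1 n w + t * U2 n w.
  by rewrite /U1 /U2 !mulrA -mulrDl !mulr_sumr -big_split/= mulr_suml.
by congr (_ ^+ 2 + _ ^+ 2); apply: eq_Rintegral => w _; rewrite WE.
Qed.

Let mU1 n : measurable_fun setT (U1 n).
Proof.
apply: measurable_funM; last exact: measurable_cst.
by apply: measurable_sum => i; measurability.
Qed.

Let mU2 n : measurable_fun setT (U2 n).
Proof.
apply: measurable_funM; last exact: measurable_cst.
by apply: measurable_sum => i; measurability.
Qed.

Lemma exprn_gt_ex (L x : R) : 2 <= L -> exists k, x < L ^+ k.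
Proof.
move=> L2; exists (Num.truncn x).+1; apply: (lt_le_trans (truncnS_gt x)).
apply: (@le_trans _ _ (2 ^+ (Num.truncn x).+1)).
  by rewrite -natrX ler_nat ltnW// ltn_expl.
by rewrite lerXn2r// nnegrE// (le_trans _ L2).
Qed.

(** Let L^j <= r < L^(j+1) with r = |s| + |t|. By exp(-y) <= (k+1)! / y^(k+1), the bound exp(-c 2^j)
    is at most a constant times 2^(-(k+1) j), whereas (1 + r)^m <= (2 L)^m L^(m j) and L^m < 2^k.
    Only N depends on (s, t). *)
Lemma charfun_rapid_decay (m : nat) : exists C : R, forall s t : R,
  exists N : nat, forall n, (N <= n)%N ->
    charfun_sqr s t n * (1 + `|s| + `|t|) ^+ m <= C.
Proof.
have [L0 [c [C0 [L01 c0 C00 dec]]]] := charfun_exponential_decay indepXY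
  X_nondegenerate Y_ge0 Y_pos iidXY fellerY.
(* The maximum with 2 makes the powers of L unbounded, so that a first power above r exists. *)
pose L := Num.max L0 2.
have L2 : 2 <= L by rewrite le_max lexx orbT.
have Lpos : 0 < L by rewrite (lt_le_trans _ L2).
have [k kL] := exprn_gt_ex (L ^+ m) (lexx (2 : R)).
pose C1 := C0 * (2 * L) ^+ m * ((k.+1)`!%:R / c ^+ k.+1).
have C1_ge0 : 0 <= C1.
  rewrite /C1; apply: mulr_ge0; last by apply: divr_ge0 => //; apply: exprn_ge0; exact: ltW.
  by apply: mulr_ge0; [exact: ltW|apply: exprn_ge0; apply: mulr_ge0 => //; exact: ltW].
exists (2 ^+ m + C1) => s t; rewrite -addrA; set r := `|s| + `|t|.
have r0 : 0 <= r by rewrite addr_ge0.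
have [r1|r1] := ltP r 1.
  exists 0%N => n _; apply: (@le_trans _ _ (2 ^+ m)); last by rewrite lerDl.
  have cs0 : 0 <= charfun_sqr s t n by rewrite addr_ge0 ?sqr_ge0.
  have cs1 : charfun_sqr s t n <= 1.
    rewrite -subr_ge0 (one_sub_charfun_sqr P); first by apply: Rintegral_ge0 => v _;
      apply: Rintegral_ge0 => w _; exact: one_sub_cos_ge0.
    by have h1 := mU1 n; have h2 := mU2 n; measurability.
  apply: (@le_trans _ _ ((1 + r) ^+ m)).
    by rewrite ler_piMl// exprn_ge0// addr_ge0.
  by rewrite lerXn2r ?nnegrE ?addr_ge0//; lra.
have [j0 rj0 minj0] := ex_minnP (exprn_gt_ex r L2).
case: j0 rj0 minj0 => [|j] rj minj; first by move: rj; rewrite expr0 ltNge r1.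
have jr : L ^+ j <= r by rewrite leNgt; apply/negP => /minj; rewrite ltnn.
have [|N hN] := dec j s t.
  apply: le_trans jr; rewrite lerXn2r ?nnegrE ?(ltW Lpos)//.
    by rewrite (le_trans _ L01).
  by rewrite le_max lexx.
exists N => n Nn; rewrite charfun_sqrE.
have {hN} := hN n Nn; set q := _ ^+ n => qle.
have q0 : 0 <= q by rewrite exprn_ge0// addr_ge0 ?sqr_ge0.
apply: (@le_trans _ _ C1); last by rewrite lerDr exprn_ge0.
have e1 : (1 + r) ^+ m <= (2 * L) ^+ m * (L ^+ m) ^+ j.
  rewrite -exprM mulnC exprM -exprMn lerXn2r ?nnegrE ?addr_ge0//.
    by rewrite !mulr_ge0 ?exprn_ge0// ltW.
  by move: rj; rewrite exprS => rj; rewrite -mulrA; lra.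
have e2 : expR (- (c * 2 ^+ j)) <= (k.+1)`!%:R / c ^+ k.+1 / (2 ^+ k.+1) ^+ j.
  have y0 : 0 < c * 2 ^+ j by rewrite mulr_gt0// exprn_gt0.
  have ye : (c * 2 ^+ j) ^+ k.+1 / (k.+1)`!%:R <= expR (c * 2 ^+ j).
    by apply: le_trans (expR_ge1Dxn k (ltW y0)); rewrite lerDr.
  rewrite expRN -[leLHS]mul1r ler_pdivrMr ?expR_gt0//.
  have f0 : 0 < (k.+1)`!%:R :> R by rewrite ltr0n fact_gt0.
  apply: (@le_trans _ _ ((k.+1)`!%:R / c ^+ k.+1 / (2 ^+ k.+1) ^+ j *
     ((c * 2 ^+ j) ^+ k.+1 / (k.+1)`!%:R))); last first.
    rewrite ler_wpM2l// !divr_ge0 ?exprn_ge0// ltW//.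
  rewrite exprMn -!exprM (mulnC j); rewrite le_eqVlt; apply/orP; left; apply/eqP.
  by field; rewrite ?(gt_eqF f0) ?expf_neq0 ?gt_eqF.
have e3 : (L ^+ m) ^+ j <= (2 ^+ k.+1) ^+ j.
  rewrite lerXn2r ?nnegrE ?exprn_ge0 ?(ltW Lpos)// (le_trans (ltW kL))//.
  by rewrite exprS ler_peMl ?exprn_ge0// ler1n.
have F0 : 0 <= (k.+1)`!%:R / c ^+ k.+1 by rewrite divr_ge0// exprn_ge0// ltW.
have P0 : 0 < (2 ^+ k.+1) ^+ j :> R by rewrite !exprn_gt0.
apply: (@le_trans _ _ (C0 * ((k.+1)`!%:R / c ^+ k.+1 / (2 ^+ k.+1) ^+ j) *
    ((2 * L) ^+ m * (2 ^+ k.+1) ^+ j))).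
  apply: ler_pM => //.
  - by rewrite exprn_ge0// addr_ge0.
  - by apply: (le_trans qle); rewrite ler_wpM2l// ltW.
  - by apply: (le_trans e1); rewrite ler_wpM2l// exprn_ge0// mulr_ge0// ltW.
rewrite le_eqVlt; apply/orP; left; apply/eqP; rewrite /C1.
move: ((2 ^+ k.+1) ^+ j) P0 => z z0.
by move: ((k.+1)`!%:R / c ^+ k.+1) ((2 * L) ^+ m) => u v; field; rewrite gt_eqF.
Qed.

Lemma min1_sum_le n (z : nat -> R) : (forall i, 0 <= z i) ->
  Num.min 1 (\sum_(i < n) z i) <= \sum_(i < n) Num.min 1 (z i).
Proof.
move=> z0; elim: n => [|n IH]; first by rewrite !big_ord0 ge_min lexx orbT.
rewrite !big_ord_recr/=; apply: (@le_trans _ _ (Num.min 1 (\sum_(i < n) z i) + Num.min 1 (z n))).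
  have s0 : 0 <= \sum_(i < n) z i by exact: sumr_ge0.
  have zn := z0 n; move: (\sum_(i < n) _) (z n) s0 zn => x y x0 y0.
  rewrite ge_min; have [?|?] := leP 1 x; have [?|?] := leP 1 y; apply/orP; lra.
by rewrite lerD2r.
Qed.

(** Subadditivity of min(1, .) reduces the bound to n E min(1, (|X| + 1) |Y| / (a_n K)). The part
    |X| + 1 <= 2 B is controlled by n H(L a_n). The rest is at most E g_B(X) times n H(a_n) by
    independence, and E g_B(X) is small because X is integrable. *)
Lemma partial_sums_tight (e : R) : 0 < e -> exists (K : R) (N : nat),
  1 <= K /\ forall n, (N <= n)%N ->
    \int[P]_w Num.min 1 ((`|U1 n w| + `|U2 n w|) / K) <= e.
Proof.
move=> e0.
have [C [NC [C0 hC]]] := trunc_mean_bounded iidY Y_ge0 fellerY.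
have iX : P.-integrable setT (EFin \o (fun w => 2 * (`|X w| + 1))).
  apply: integrable_scale; apply: integrable_add.
    apply/integrableP; split; first by apply/measurable_EFinP; measurability.
    move: X_integrable; rewrite unlock; congr (_ < _)%E.
    by apply: eq_integral => w _ /=; rewrite normr_id.
  exact: prob_integrable_cst.
(* This function is at most 2 (|x| + 1), at least |x| + 1 where |x| + 1 >= 2 B, and zero where |x| +
   1 <= B. *)
pose g (B : nat) (x : R) := 2 * Num.max 0 (`|x| + 1 - B%:R).
have g_ge0 B x : 0 <= g B x by rewrite mulr_ge0// le_max lexx.
have mg B : measurable_fun setT (g B) by rewrite /g; measurability.
have mgX B : measurable_fun setT (fun w => g B (X w)).
  by apply: (measurableT_comp (mg B)); exact: measurable_funP.
have gle B x : g B x <= 2 * (`|x| + 1).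
  rewrite ler_pM2l// ge_max addr_ge0//=; have : 0 <= B%:R :> R by []; lra.
have igX B : P.-integrable setT (EFin \o (fun w => g B (X w))).
  by apply: (integrable_le (mgX B) _ iX) => w; rewrite ger0_norm.
have : \int[P]_w g B (X w) @[B --> \oo] --> \int[P]_w (0 : R).
  apply: (Rintegral_dominated_cvg _ _ iX) => //.
    move=> w; apply: (@cvg_trans _ ((fun=> 0 : R) @ \oo)); last exact: cvg_cst.
    apply: near_eq_cvg; exists (Num.truncn (`|X w| + 1)).+1 => // B /= hB.
    rewrite /g max_l ?mulr0// subr_le0 ltW// (lt_le_trans (truncnS_gt _))// ler_nat//.
  by move=> B w; rewrite ger0_norm.
rewrite prob_Rintegral_cst => /cvgrPdist_le /(_ (e / (2 * C))).
have eC0 : 0 < e / (2 * C) by rewrite divr_gt0// mulr_gt0.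
move=> /(_ eC0) [B0 _ /(_ B0.+1 (leqnSn _))]; set B := B0.+1.
rewrite /= sub0r normrN ger0_norm; last by apply: Rintegral_ge0 => w _; exact: g_ge0.
move=> gB.
have e20 : 0 < e / 2 by rewrite divr_gt0.
have [L [NL [L1 hL]]] := trunc_mean_tight iidY Y_ge0 fellerY e20.
have B1 : 1 <= B%:R :> R by rewrite ler1n.
have K1 : 1 <= L * (2 * B%:R) by nra.
(* The factor 2 B compensates |X| + 1 on the first part, and L is left for n H(L a_n). *)
exists (L * (2 * B%:R)), (maxn NC NL); split=> // n; rewrite geq_max => /andP[nC nL].
have an0 := a_gt0 n; set K := L * _ in K1 *.
have K0 : 0 < K by rewrite (lt_le_trans _ K1).
have L0 : 0 < L by rewrite (lt_le_trans _ L1).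
pose z (x : R * R) := (`|x.1| + 1) * `|x.2| / (a n * K).
have z0 x : 0 <= z x.
  by apply: divr_ge0; apply: mulr_ge0 => //; exact: ltW.
have mz : measurable_fun setT (fun x => Num.min 1 (z x)).
  by rewrite /z; measurability.
have min01 (x : R) : 0 <= x -> `|Num.min 1 x| <= 1.
  by move=> x0; rewrite ger0_norm ?ge_min ?lexx// le_min ler01.
have mXYi i : measurable_fun setT (fun w => (X_ i w, Y_ i w)).
  by apply: measurable_fun_pair; exact: measurable_funP.
have mXY : measurable_fun setT (fun w => (X w, Y w)).
  by apply: measurable_fun_pair; exact: measurable_funP.
have imin i : P.-integrable setT (EFin \o (fun w => Num.min 1 (z (X_ i w, Y_ i w)))).
  apply: (@bounded_integrable _ _ _ _ _ 1); last by move=> w; exact: min01.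
  exact: (measurableT_comp mz (mXYi i)).
have isum : P.-integrable setT (EFin \o (fun w => \sum_(i < n) Num.min 1 (z (X_ i w, Y_ i w)))).
  rewrite (_ : _ \o _ = (fun w => \sum_(i < n) (Num.min 1 (z (X_ i w, Y_ i w)))%:E)%E).
    by apply: integrable_sum => // i _; exact: imin.
  by apply/funext => w /=; rewrite sumEFin.
apply: (@le_trans _ _ (\int[P]_w (\sum_(i < n) Num.min 1 (z (X_ i w, Y_ i w))))).
  apply: le_Rintegral => //.
    apply: (@bounded_integrable _ _ _ _ _ 1) => [|w].
      by have h1 := mU1 n; have h2 := mU2 n; measurability.
    by apply: min01; rewrite divr_ge0 ?addr_ge0// ltW.
  move=> w _; apply: (le_trans _ (@min1_sum_le n (fun i => z (X_ i w, Y_ i w)) (fun i => z0 _))).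
  rewrite le_min ge_min lexx/= ge_min; apply/orP; right.
  rewrite ler_pdivrMr// mulr_suml /U1 /U2 !normrM.
  rewrite (ger0_norm (_ : 0 <= (a n)^-1)) ?invr_ge0 ?(ltW an0)//.
  rewrite -mulrDl ler_pdivrMr// mulr_suml.
  apply: (@le_trans _ _ (\sum_(i < n) (`|X_ i w * Y_ i w| + `|Y_ i w|))).
    by rewrite big_split/=; apply: lerD; exact: ler_norm_sum.
  apply: ler_sum => i _; rewrite /z/= normrM.
  rewrite le_eqVlt; apply/orP; left; apply/eqP; field.
  by rewrite !gt_eqF.
have sumE : forall k, \int[P]_w (\sum_(i < k) Num.min 1 (z (X_ i w, Y_ i w))) =
    k%:R * \int[P]_w Num.min 1 (z (X w, Y w)).
  elim=> [|k IH].
    by rewrite mul0r; under eq_Rintegral do rewrite big_ord0; rewrite prob_Rintegral_cst.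
  rewrite -natr1 mulrDl mul1r -IH.
  rewrite (@Rintegral_same_distribution _ _ _ P _ _ _ P _ _ _ _ 1 mXY (mXYi k) (iidXY.2 k) mz); last first.
    by move=> x; exact: min01.
  rewrite -RintegralD//; first by apply: eq_Rintegral => w _; rewrite big_ord_recr.
  rewrite (_ : _ \o _ = (fun w => \sum_(i < k) (Num.min 1 (z (X_ i w, Y_ i w)))%:E)%E).
    by apply: integrable_sum => // i _; exact: imin.
  by apply/funext => w /=; rewrite sumEFin.
rewrite sumE.
have ia (x : R) : 0 < x -> P.-integrable setT (EFin \o (fun w => Num.min 1 (`|Y w| / x))).
  move=> x0; apply: (@bounded_integrable _ _ _ _ _ 1) => [|w]; first by measurability.
  by apply: min01; rewrite divr_ge0// ltW.
have La0 : 0 < L * a n by rewrite mulr_gt0.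
have iprod : P.-integrable setT (EFin \o (fun w => g B (X w) * Num.min 1 (`|Y w| / a n))).
  apply: (integrable_le _ _ iX); first by measurability.
  move=> w; rewrite normrM ger0_norm// (le_trans _ (gle B _))// ler_piMr//.
  by apply: min01; rewrite divr_ge0// ltW.
have bound : \int[P]_w Num.min 1 (z (X w, Y w)) <=
    trunc_mean Y (L * a n) + \int[P]_w g B (X w) * trunc_mean Y (a n).
  rewrite /trunc_mean.
  rewrite -(@Rintegral_independent_integrable _ _ _ _ _ P _ _ X Y (g B) (fun y => Num.min 1 (`|y| / a n)))//.
  - rewrite -RintegralD//; last exact: ia.
    apply: le_Rintegral => //.
    + apply: (@bounded_integrable _ _ _ _ _ 1); last by move=> w; exact: min01.
      exact: (measurableT_comp mz mXY).
    + by apply: integrable_add => //; exact: ia.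
    + move=> w _; rewrite /z/=; set x := `|X w| + 1; set y := `|Y w|.
      have x1 : 1 <= x by rewrite /x lerDr.
      have y0 : 0 <= y by exact: normr_ge0.
      have gy0 : 0 <= g B (X w) * Num.min 1 (y / a n).
        by rewrite mulr_ge0// le_min ler01 divr_ge0// ltW.
      have [xB|Bx] := leP x (2 * B%:R).
        apply: ler_wpDr => //; rewrite le_min ge_min lexx/= ge_min; apply/orP; right.
        rewrite ler_pdivrMr ?mulr_gt0// (_ : y / _ * _ = 2 * B%:R * y); last first.
          by rewrite /K; field; rewrite !gt_eqF.
        by rewrite ler_wpM2r.
      have m0 : 0 <= Num.min 1 (y / (L * a n)) by rewrite le_min ler01 divr_ge0// ltW.
      apply: ler_wpDl => //.
      have -> : g B (X w) = 2 * (x - B%:R) by rewrite /g max_r// -/x; lra.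
      apply: (@le_trans _ _ (x * Num.min 1 (y / a n))); last first.
        by rewrite ler_wpM2r ?le_min ?ler01 ?divr_ge0 ?(ltW an0)//; lra.
      rewrite minr_pMr ?addr_ge0// mulr1 le_min ge_min x1/= ge_min; apply/orP; right.
      rewrite invfM !mulrA ler_piMr ?invf_le1//.
      by rewrite divr_ge0 ?mulr_ge0 ?addr_ge0// ltW.
  - by measurability.
  - by move=> y; rewrite le_min ler01 divr_ge0 ?(ltW an0)//= ge_min lexx.
  - by apply: (integrable_le (mgX B) _ iX) => w; rewrite ger0_norm.
have h1 := hC n nC; have h2 := hL n nL.
have n0 : 0 <= n%:R :> R by [].
apply: (le_trans (ler_wpM2l n0 bound)).
rewrite mulrDr mulrCA; apply: (@le_trans _ _ (e / 2 + e / (2 * C) * C)).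
  apply: lerD => //; apply: ler_pM => //; last by rewrite mulr_ge0// trunc_mean_ge0.
  by apply: Rintegral_ge0 => w _; exact: g_ge0.
rewrite le_eqVlt; apply/orP; left; apply/eqP; field.
by rewrite gt_eqF.
Qed.

End partial_sums.

(** * Fourier inversion in the plane *)

(** Tychonoff gives a cluster point p in the product of copies of [-1, 1]. A neighbourhood of p
    constraining finitely many coordinates is visited beyond every index, so the k-th term can be
    taken within 1 / (k + 1) of p in the coordinates up to k. *)
Lemma diagonal_subsequence {R : realType} (u : nat -> nat -> R) :
  (forall n j, `|u n j| <= 1) ->
  exists psi, strictly_increasing psi /\ forall j, cvgn (fun k => u (psi k) j).
Proof.
move=> u1.
have cA := @tychonoff nat (fun=> R) (fun=> `[(-1 : R), 1]%classic)
  (fun=> @segment_compact R (-1) 1).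
have uA : (u n @[n --> \oo]) [set f | forall i : nat, `[(-1 : R), 1]%classic (f i)].
  by exists 0%N => // n _ j /=; rewrite in_itv/= -ler_norml.
have [p [_ clp]] := cA _ (fmap_proper_filter u _) uA.
have [|psi [hpsi psiP]] := @subsequence_exists
    (fun k n => forall j, (j <= k)%N -> `|u n j - p j| < k.+1%:R^-1).
  move=> k N.
  have A1 : (u n @[n --> \oo]) [set u n | n in [set n | (N <= n)%N]].
    by exists N => // n /= Nn; exists n.
  have k0 : 0 < k.+1%:R^-1 :> R by rewrite invr_gt0.
  pose V (j : 'I_k.+1) : set (nat -> R) := @proj nat (fun=> R) j @^-1` ball (p j) k.+1%:R^-1.
  have B1 : nbhs p [set f | forall j, V j f].
    apply: (@filter_forall _ _ V (nbhs p)) => j.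
    exact: (@proj_continuous nat (fun=> R) (nat_of_ord j) p _ (nbhsx_ballx (p j) _ k0)).
  have [f [[n Nn <-] fB]] := clp _ _ A1 B1.
  exists n => // j jk.
  by have jk' : (j < k.+1)%N := jk; have := fB (Ordinal jk'); rewrite /V /ball/= distrC.
exists psi; split=> // j; apply/cvg_ex; exists (p j).
apply/cvgrPdist_le => e e0; have [K _ hK] : \forall k \near \oo, (k.+1%:R^-1 : R) <= e.
  have := @cvg_harmonic R => /cvgrPdist_le /(_ e e0); apply: filterS => k.
  by rewrite sub0r normrN ger0_norm ?invr_ge0.
exists (maxn K j) => // k /=; rewrite geq_max => /andP[Kk jk].
by rewrite distrC ltW// (lt_le_trans (psiP k j jk))//; exact: hK.
Qed.

(** The Boolean chooses between the real and the imaginary part of a characteristic function, so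
    that one proof serves both. *)
Definition trig {R : realType} (b : bool) : R -> R := if b then cos else sin.

Section trig.
Context {R : realType}.
Implicit Types x y : R.

Lemma trig_le1 b x : `|trig b x| <= 1.
Proof. by case: b; [exact: cos_max|exact: sin_max]. Qed.

Lemma trig_lipschitz b x y : `|trig b x - trig b y| <= `|x - y|.
Proof. by case: b; [exact: cos_lipschitz|exact: sin_lipschitz]. Qed.

Lemma measurable_trig b : measurable_fun setT (@trig R b).
Proof.
by case: b; apply: continuous_measurable_fun; [exact: continuous_cos|exact: continuous_sin].
Qed.

End trig.

Section charfun_subsequence.
Context {d} {Omega : measurableType d} {R : realType} (P : probability Omega R).
Variables (U1 U2 : nat -> Omega -> R).
Hypotheses (mU1 : forall n, measurable_fun setT (U1 n)) (mU2 : forall n, measurable_fun setT (U2 n)).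
Hypothesis tightU : forall e : R, 0 < e -> exists (K : R) (N : nat),
  1 <= K /\ forall n, (N <= n)%N ->
    \int[P]_w Num.min 1 ((`|U1 n w| + `|U2 n w|) / K) <= e.

Definition charfun b n (th : R * R) := \int[P]_w trig b (th.1 * U1 n w + th.2 * U2 n w).

Let mth b n (th : R * R) : measurable_fun setT (fun w => trig b (th.1 * U1 n w + th.2 * U2 n w)).
Proof.
apply: (measurableT_comp (measurable_trig b)).
by have h1 := mU1 n; have h2 := mU2 n; measurability.
Qed.

Let ith b n th : P.-integrable setT (EFin \o (fun w => trig b (th.1 * U1 n w + th.2 * U2 n w))).
Proof. by apply: (@bounded_integrable _ _ _ _ _ 1) => // w; exact: trig_le1. Qed.

Lemma charfun_le1 b n th : `|charfun b n th| <= 1.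
Proof.
rewrite (le_trans (le_normr_Rintegral _ (ith b n th)))//.
rewrite -[leRHS](prob_Rintegral_cst P); apply: le_Rintegral => //.
- apply: (@bounded_integrable _ _ _ _ _ 1) => [|w]; last by rewrite normr_id trig_le1.
  by apply: measurableT_comp => //; exact: normr_measurable.
- exact: prob_integrable_cst.
- by move=> w _; exact: trig_le1.
Qed.

(** If both frequencies move by at most 1 / K, the increment is at most E min(2, |U| / K) <= 2 E
    min(1, |U| / K) with |U| = |U1| + |U2|, which tightness makes small. *)
Lemma charfun_equicontinuous (e : R) : 0 < e -> exists (del : R) (N : nat),
  0 < del /\ forall b n th th', (N <= n)%N -> `|th.1 - th'.1| <= del ->
    `|th.2 - th'.2| <= del -> `|charfun b n th - charfun b n th'| <= e.
Proof.
move=> e0; have e20 : 0 < e / 2 by rewrite divr_gt0.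
have [K [N [K1 hK]]] := tightU e20.
have K0 : 0 < K by rewrite (lt_le_trans _ K1).
exists K^-1, N; split; first by rewrite invr_gt0.
move=> b n th th' Nn h1 h2.
have mu1 := mU1 n; have mu2 := mU2 n.
have m1 := mth b n th; have m2 := mth b n th'.
have V0 w : 0 <= (`|U1 n w| + `|U2 n w|) / K by rewrite divr_ge0 ?addr_ge0// ltW.
have im : P.-integrable setT (EFin \o (fun w => Num.min 1 ((`|U1 n w| + `|U2 n w|) / K))).
  apply: (@bounded_integrable _ _ _ _ _ 1) => [|w]; first by measurability.
  by rewrite ger0_norm ?ge_min ?lexx// le_min ler01 V0.
apply: (@le_trans _ _ (2 * \int[P]_w Num.min 1 ((`|U1 n w| + `|U2 n w|) / K))); last first.
  by have := hK n Nn; lra.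
rewrite -RintegralZl//; apply: Rintegral_dist_le => //.
  exact: integrable_scale.
move=> w; have a1 : `|trig b (th.1 * U1 n w + th.2 * U2 n w)
     - trig b (th'.1 * U1 n w + th'.2 * U2 n w)| <= 2.
  by rewrite (le_trans (ler_normB _ _))// (_ : 2 = 1 + 1 :> R)// lerD// trig_le1.
have a2 := trig_lipschitz b (th.1 * U1 n w + th.2 * U2 n w) (th'.1 * U1 n w + th'.2 * U2 n w).
have a3 : `|th.1 * U1 n w + th.2 * U2 n w - (th'.1 * U1 n w + th'.2 * U2 n w)|
    <= (`|U1 n w| + `|U2 n w|) / K.
  rewrite (_ : _ - (_ + _) = (th.1 - th'.1) * U1 n w + (th.2 - th'.2) * U2 n w); last by ring.
  rewrite (le_trans (ler_normD _ _))// !normrM mulrDl ![_ / K]mulrC.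
  by apply: lerD; rewrite ler_wpM2r.
have [V1|V1] := leP 1 ((`|U1 n w| + `|U2 n w|) / K); first by rewrite mulr1.
by have := V0 w; have := le_trans a2 a3; lra.
Qed.

(* Pointwise convergence on rational points extends to all points by equicontinuity. *)
Lemma charfun_subsequence : exists psi, strictly_increasing psi /\
  forall b th, cvgn (fun k => charfun b (psi k) th).
Proof.
(* One sequence enumerates the Boolean together with all rational frequencies; integers that code
   nothing get the value 0. *)
pose u n j := if choice.unpickle j is Some (b, (q1, q2)) then
  charfun b n (@ratr R q1, @ratr R q2) else 0.
have u1 n j : `|u n j| <= 1.
  by rewrite /u; case: choice.unpickle => [[b [q1 q2]]|]; [exact: charfun_le1|rewrite normr0].
have [psi [hpsi cu]] := diagonal_subsequence u1.
exists psi; split=> // b th; apply/cauchy_cvgP; apply: cauchy_exP => e e0.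
have e20 : 0 < e / 2 by rewrite divr_gt0.
have [del [N [del0 eq]]] := charfun_equicontinuous e20.
have ratd (x : R) : exists q : rat, `|x - ratr q| <= del.
  have xd : x < x + del by rewrite ltrDl.
  have [q] := rat_in_itvoo xd; rewrite in_itv/= => /andP[h1 h2]; exists q.
  by rewrite ler_norml; apply/andP; split; lra.
have [q1 hq1] := ratd th.1; have [q2 hq2] := ratd th.2.
have := cu (choice.pickle (b, (q1, q2))); rewrite /u choice.pickleK => /cvg_ex[l cl].
exists l; move/cvgrPdist_lt : cl => /(_ _ e20) [k0 _ hk0].
exists (maxn k0 N) => // k /=; rewrite geq_max => /andP[k0k Nk].
have h1 : `|l - charfun b (psi k) (ratr q1, ratr q2)| < e / 2 by exact: hk0.
have h2 : `|charfun b (psi k) th - charfun b (psi k) (ratr q1, ratr q2)| <= e / 2.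
  by apply: eq => //; exact: leq_trans Nk (strictly_increasing_ge hpsi k).
rewrite /ball/=; move: h1 h2; set x := charfun _ _ _; set y := charfun _ _ _.
rewrite ltr_norml ler_norml => /andP[? ?] /andP[? ?].
by rewrite ltr_norml; apply/andP; split; lra.
Qed.

End charfun_subsequence.

(** * Affine changes of variables and product integrals *)

Section lebesgue_affine.
Context {R : realType}.
Local Notation mu := (@lebesgue_measure R).
Implicit Types a b c : R.

Lemma measurable_affine a b : measurable_fun (setT : set (measurableTypeR R))
  (fun x : measurableTypeR R => (a * x + b : measurableTypeR R)).
Proof.
have m : measurable_fun (setT : set R) (fun x : R => a * x + b) by measurability.
exact: m.
Qed.

(** By uniqueness of Lebesgue measure it suffices to compare on half-open intervals. A negative
    slope turns ]u, v] into an interval open on the right, hence the two cases. *)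
Lemma lebesgue_measure_affine a b (A : set R) : a != 0 -> measurable A ->
  mu A = (`|a|%:E * mu ((fun x => a * x + b)%R @^-1` A))%E.
Proof.
move=> a0 mA.
pose f := fun x : measurableTypeR R => (a * x + b : measurableTypeR R).
pose m' : {measure set (measurableTypeR R) -> \bar R} :=
  mscale (NngNum (normr_ge0 a)) (pushforward mu f).
pose m := m' (measurable_affine a b).
suff h (X : set R) : ocitv X -> mu X = m X by exact: (lebesgue_measure_unique h mA).
move=> /ocitvP[->|[[u v] /= uv ->]].
  by rewrite measure0 /m /= measure0.
rewrite /m/= /mscale/= /pushforward lebesgue_measure_itv/= lte_fin uv -EFinD.
have [ap|an|/eqP] := ltgtP a 0; last by rewrite (negbTE a0).
  have -> : f @^-1` `]u, v]%classic = `[(v - b) / a, (u - b) / a[%classic.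
    apply/seteqP; split => x /=; rewrite !in_itv/= /f ler_ndivrMr// ltr_ndivlMr//;
      by move=> /andP[h1 h2]; apply/andP; split; lra.
  rewrite lebesgue_measure_itv/= lte_fin ltr_ndivrMr// divfK ?lt_eqF// ltrD2r uv.
  rewrite -EFinD -EFinM ltr0_norm//; congr EFin; by field.
have -> : f @^-1` `]u, v]%classic = `](u - b) / a, (v - b) / a]%classic.
  apply/seteqP; split => x /=; rewrite !in_itv/= /f ler_pdivlMr// ltr_pdivrMr//;
    by move=> /andP[h1 h2]; apply/andP; split; lra.
rewrite lebesgue_measure_itv/= lte_fin ltr_pdivrMr// divfK ?gt_eqF// ltrD2r uv.
rewrite -EFinD -EFinM gtr0_norm//; congr EFin; by field.
Qed.

Lemma ge0_integral_affine a b (F : R -> \bar R) : a != 0 ->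
  measurable_fun setT F -> (forall x, (0 <= F x)%E) ->
  (\int[mu]_x F x = `|a|%:E * \int[mu]_x F (a * x + b)%R)%E.
Proof.
move=> a0 mF F0.
pose f := fun x : measurableTypeR R => (a * x + b : measurableTypeR R).
pose m' : {measure set (measurableTypeR R) -> \bar R} := pushforward mu f.
pose m := m' (measurable_affine a b).
transitivity (\int[mscale (NngNum (normr_ge0 a)) m]_x F x)%E.
  apply: eq_measure_integral => A mA _.
  exact: (lebesgue_measure_affine b a0 mA).
rewrite ge0_integral_mscale//; congr (_ * _)%E.
by rewrite /m ge0_integral_pushforward//; exact: measurable_affine.
Qed.

Lemma integrable_affine a b (F : R -> R) : a != 0 ->
  mu.-integrable setT (EFin \o F) -> mu.-integrable setT (EFin \o (fun x => F (a * x + b))).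
Proof.
move=> a0 /integrableP[/measurable_EFinP mF iF].
have mFa : measurable_fun setT (fun x => F (a * x + b)).
  exact: (measurableT_comp mF (measurable_affine a b)).
apply/integrableP; split; first exact/measurable_EFinP.
move: iF; rewrite (@ge0_integral_affine a b (fun x => `|(EFin \o F) x|%E))//; last first.
  by apply: measurableT_comp => //; exact/measurable_EFinP.
have aE : `|a|%:E = `|a|%:E :> \bar R by [].
have a0' : 0 < `|a| by rewrite normr_gt0.
rewrite -ge0_fin_numE; last by rewrite mule_ge0// ?lee_fin// integral_ge0.
move=> h; rewrite -ge0_fin_numE ?integral_ge0//.
have -> : (\int[mu]_x `|(EFin \o (fun x => F (a * x + b)%R)) x| =
   (`|a|^-1)%:E * (`|a|%:E * \int[mu]_x `|(EFin \o F) (a * x + b)%R|))%E.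
  by rewrite muleA -EFinM mulVf ?gt_eqF// mul1e.
by rewrite fin_numM.
Qed.

Lemma Rintegral_affine a b (F : R -> R) : a != 0 ->
  mu.-integrable setT (EFin \o F) ->
  \int[mu]_x F x = `|a| * \int[mu]_x F (a * x + b).
Proof.
move=> a0 iF; have iFa := integrable_affine b a0 iF.
have /integrableP[mF _] := iF.
rewrite -[RHS]/(fine (`|a|%:E) * fine _) -fineM//; last exact: integrable_fin_num.
rewrite /Rintegral; congr fine.
pose Fa x := F (a * x + b).
have e : (\int[mu]_x (Fa x)%:E =
    \int[mu]_x ((fun x => (Fa x)%:E)^\+ x) - \int[mu]_x ((fun x => (Fa x)%:E)^\- x))%E.
  exact: integralE.
rewrite integralE [X in (_ * X)%E](_ : _ = \int[mu]_x (Fa x)%:E)%E// e.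
rewrite (@ge0_integral_affine a b ((fun x => (F x)%:E)^\+)%E)//; last exact: measurable_funepos.
rewrite (@ge0_integral_affine a b ((fun x => (F x)%:E)^\-)%E)//; last exact: measurable_funeneg.
have := @muleBr R `|a|%:E _ _ isT (integrable_add_def measurableT iFa).
by move=> h; rewrite [RHS]h; congr (_ * _ - _ * _)%E; apply: eq_integral => x _; rewrite ?funeposE ?funenegE.
Qed.

Local Notation mu2 := (mu \x mu)%E.

Lemma ge0_integral_prod (f g : R -> \bar R) :
  measurable_fun setT f -> measurable_fun setT g ->
  (forall x, (0 <= f x)%E) -> (forall x, (0 <= g x)%E) ->
  (\int[mu2]_x (f x.1 * g x.2) = \int[mu]_x f x * \int[mu]_x g x)%E.
Proof.
move=> mf mg f0 g0.
rewrite (@fubini_tonelli1 _ _ _ _ _ mu mu (fun x : R * R => f x.1 * g x.2)%E)//; last 2 first.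
- by apply: emeasurable_funM; apply: measurableT_comp.
- by move=> x; exact: mule_ge0.
rewrite /fubini_F/=.
transitivity (\int[mu]_x (f x * \int[mu]_y g y))%E.
  by apply: eq_integral => x _; rewrite ge0_integralZl.
by rewrite ge0_integralZr// integral_ge0.
Qed.

Lemma integrable_prod (f g : R -> R) :
  mu.-integrable setT (EFin \o f) -> mu.-integrable setT (EFin \o g) ->
  mu2.-integrable setT (EFin \o (fun x => f x.1 * g x.2)).
Proof.
move=> /integrableP[/measurable_EFinP mf iif] /integrableP[/measurable_EFinP mg iig].
apply/integrableP; split.
  by apply/measurable_EFinP; apply: measurable_funM; apply: measurableT_comp.
have -> : (\int[mu2]_x `|(EFin \o (fun x : R * R => f x.1 * g x.2)%R) x| =
    \int[mu2]_x (`|f x.1|%:E * `|g x.2|%:E))%E.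
  by apply: eq_integral => x _ /=; rewrite normrM EFinM.
rewrite (@ge0_integral_prod (fun x => `|f x|%:E) (fun x => `|g x|%:E))//.
- apply: lte_mul_pinfty; [exact: integral_ge0| |exact: iig].
  by rewrite ge0_fin_numE; [exact: iif|exact: integral_ge0].
- by apply/measurable_EFinP; exact: measurableT_comp.
- by apply/measurable_EFinP; exact: measurableT_comp.
Qed.

Lemma Rintegral_prod (f g : R -> R) :
  mu.-integrable setT (EFin \o f) -> mu.-integrable setT (EFin \o g) ->
  \int[mu2]_x (f x.1 * g x.2) = \int[mu]_x f x * \int[mu]_x g x.
Proof.
move=> if_ ig; have ifg := integrable_prod if_ ig.
rewrite {1}/Rintegral -(@integral12_prod_meas1 _ _ _ _ _ mu mu (EFin \o (fun x : R * R => f x.1 * g x.2)))//.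
rewrite -[RHS]mulrC -RintegralZl// /Rintegral; congr fine; apply: eq_integral => x _.
rewrite /fubini_F/= mulrC.
transitivity (\int[mu]_y ((f x)%:E * (g y)%:E))%E; first by apply: eq_integral => y _.
by rewrite integralZl// EFinM fineK//; exact: integrable_fin_num.
Qed.

Lemma integrable_oneDsqrV : mu.-integrable setT (EFin \o (fun x : R => (1 + x ^+ 2)^-1)).
Proof.
have p0 (x : R) : 0 <= (1 + x ^+ 2)^-1 by rewrite invr_ge0 addr_ge0 ?sqr_ge0.
have cf : continuous (fun x : R => (1 + x ^+ 2)^-1) by exact: continuous_oneDsqrV.
apply/integrableP; split.
  by apply/measurable_EFinP; exact: continuous_measurable_fun.
under eq_integral => x _ do rewrite /= (ger0_norm (p0 x)).
rewrite (@ge0_symfun_integralT _ (fun x : R => (1 + x ^+ 2)^-1))//; last first.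
  by move=> x /=; rewrite sqrrN.
have := @integral0y_oneDsqr R; rewrite /oneDsqr => h.
rewrite (_ : \int[mu]_(x in _) _ = (pi / 2)%:E)%E; first by rewrite -EFinM ltry.
by rewrite -h; congr integral; apply/seteqP; split => x /=; rewrite in_itv/= andbT.
Qed.

Definition weight2 (x : R * R) : R := (1 + x.1 ^+ 2)^-1 * (1 + x.2 ^+ 2)^-1.

Lemma integrable_weight2 : mu2.-integrable setT (EFin \o weight2).
Proof. exact: integrable_prod integrable_oneDsqrV integrable_oneDsqrV. Qed.

End lebesgue_affine.

Lemma lipschitz_continuous {R : realType} (V : normedModType R) (f : V -> R) (C : R) :
  (forall x y, `|f x - f y| <= C * `|x - y|) -> continuous f.
Proof.
move=> fC x; apply/cvgrPdist_le => e e0.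
pose C' := Num.max 1 C; have C'0 : 0 < C' by rewrite lt_max ltr01.
near=> y; apply: (le_trans (fC x y)).
apply: (@le_trans _ _ (C' * `|x - y|)).
  by rewrite ler_wpM2r// le_max lexx orbT.
rewrite -ler_pdivlMl//; near: y.
have ee : 0 < C'^-1 * e by rewrite mulr_gt0// invr_gt0.
have h : y @[y --> x] --> x by exact: cvg_id.
by move/cvgrPdist_le : h => /(_ _ ee).
Unshelve. all: end_near. Qed.

(** * The tent function and the Fejer kernel *)

Section fejer.
Context {R : realType}.
Local Notation mu := (@lebesgue_measure R).
Implicit Types x y th T : R.

(** It combines the two properties that the smoothing needs: compact support and a nonnegative
    Fourier transform. *)
Definition tent th : R := Num.max 0 (1 - `|th|).

Lemma tent_ge0 th : 0 <= tent th.
Proof. by rewrite le_max lexx. Qed.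

Lemma tent_le1 th : tent th <= 1.
Proof. by rewrite ge_max ler01/= gerBl. Qed.

Lemma tent_eq0 th : 1 <= `|th| -> tent th = 0.
Proof. by move=> h; rewrite /tent max_l// subr_le0. Qed.

Lemma measurable_tent : measurable_fun setT tent.
Proof. by rewrite /tent; measurability. Qed.

Lemma continuous_tent : continuous tent.
Proof.
apply: (@lipschitz_continuous _ R^o _ 1) => x y; rewrite mul1r.
have := ler_dist_dist x y; rewrite /tent.
have := normr_ge0 x; have := normr_ge0 y; move: `|x| `|y| `|x - y| => u v w v0 u0.
rewrite ler_norml => /andP[h1 h2].
by case: (leP 0 (1 - u)); case: (leP 0 (1 - v)) => *; rewrite ler_norml; apply/andP; split; lra.
Qed.

Lemma tent_le_oneDsqrV th : tent th <= 2 * (1 + th ^+ 2)^-1.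
Proof.
have d0 : 0 < 1 + th ^+ 2 by rewrite ltr_pwDl// sqr_ge0.
have [h|h] := leP 1 `|th|.
  by rewrite tent_eq0// mulr_ge0// invr_ge0 ltW.
rewrite (le_trans (tent_le1 _))// ler_pdivlMr// mul1r -(real_normK (num_real th)).
by have := normr_ge0 th; nra.
Qed.

Lemma integrable_tent_mul (h : R -> R) : measurable_fun setT h -> (forall th, `|h th| <= 1) ->
  mu.-integrable setT (EFin \o (fun th => tent th * h th)).
Proof.
move=> mh h1; apply: (@integrable_le _ _ _ mu _ (fun th => 2 * (1 + th ^+ 2)^-1)).
- exact: (measurable_funM measurable_tent mh).
- move=> th; rewrite normrM ger0_norm ?tent_ge0//.
  by rewrite (le_trans _ (tent_le_oneDsqrV th))// ler_piMr// tent_ge0.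
- exact: integrable_scale integrable_oneDsqrV.
Qed.

Lemma integrable_tent : mu.-integrable setT (EFin \o tent).
Proof.
have n1 (th : R) : `|1 : R| <= 1 by rewrite normr1.
have := @integrable_tent_mul (fun=> 1) (measurable_cst _) n1.
by rewrite (_ : (fun th => tent th * 1) = tent)//; apply/funext => th; rewrite mulr1.
Qed.

Lemma integral01_FTC (f F : R -> R) : (forall th, is_derive th 1 F (f th)) -> continuous f ->
  (\int[mu]_(th in `[0%R, 1%R]) (f th)%:E = (F 1 - F 0)%:E)%E.
Proof.
move=> dF cf; have cF : continuous F.
  by move=> th; apply/differentiable_continuous/derivable1_diffP; exact: ex_derive.
rewrite (@continuous_FTC2 _ f F)//.
- exact: continuous_subspaceT.
- split; first by move=> th _; exact: ex_derive.
  + by apply: cvg_at_right_filter; exact: cF.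
  + by apply: cvg_at_left_filter; exact: cF.
- by move=> th _; rewrite derive1E; exact: derive_val.
Qed.

(** On [0, 1] the tent is the polynomial 1 - th, and beyond it vanishes, so integrals against even
    functions come down to the fundamental theorem of calculus. *)
Lemma integral_tent_even (h : R -> R) : (forall th, 0 <= h th) -> continuous h ->
  (forall th, h (- th) = h th) ->
  (\int[mu]_th (tent th * h th)%:E = 2%:E * \int[mu]_(th in `[0%R, 1%R]) ((1 - th) * h th)%:E)%E.
Proof.
move=> h0 ch hN; rewrite (@ge0_symfun_integralT _ (fun th => tent th * h th)).
- congr (_ * _)%E; rewrite integral_mkcond [RHS]integral_mkcond.
  apply: eq_integral => th _; rewrite /patch.
  have [t0|t0] := leP 0 th; last first.
    rewrite memNset ?memNset//=; first by rewrite in_itv/= leNgt t0.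
    by apply/negP; rewrite -ltNge.
  rewrite mem_set//; have [t1|t1] := leP th 1.
    rewrite mem_set/= ?in_itv/= ?t0//.
    by rewrite /tent ger0_norm// max_r// subr_ge0.
  rewrite memNset/= ?in_itv/=; last by rewrite t0/= leNgt t1.
  by rewrite tent_eq0 ?mul0r// ger0_norm// ltW.
- by move=> th; rewrite mulr_ge0// tent_ge0.
- by move=> th; apply: cvgM; [exact: continuous_tent|exact: ch].
- by move=> th /=; rewrite hN /tent normrN.
Qed.

Lemma integral_tent : \int[mu]_th tent th = 1.
Proof.
have := @integral_tent_even (fun=> 1) (fun=> ler01) (fun _ => cvg_cst _) (fun=> erefl).
under eq_integral do rewrite mulr1; under [in X in _ = (_ * X)%E]eq_integral do rewrite mulr1.
have dF (th : R) : is_derive th 1 (fun th => th - th ^+ 2 / 2) (1 - th).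
  by apply: is_derive_eq; rewrite /GRing.scale/=; field.
have cf : continuous (fun th : R => 1 - th).
  by move=> th; apply: cvgB; [exact: cvg_cst|exact: cvg_id].
rewrite (integral01_FTC dF cf).
by rewrite /Rintegral => ->; rewrite -EFinM/=; field.
Qed.

(** A Fourier integral rather than the closed form 2 (1 - cos x) / x^2: the value at 0 is then 1,
    and Lipschitz continuity follows under the integral sign. *)
Definition fejer x : R := \int[mu]_th (tent th * cos (th * x)).

Let mcosx x : measurable_fun setT (fun th => cos (th * x)).
Proof. by measurability. Qed.

Let icosx x : mu.-integrable setT (EFin \o (fun th => tent th * cos (th * x))).
Proof. by apply: integrable_tent_mul => // th; exact: cos_max. Qed.

Lemma fejer0 : fejer 0 = 1.
Proof.
by rewrite -[RHS]integral_tent; apply: eq_Rintegral => th _; rewrite mulr0 cos0 mulr1.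
Qed.

Lemma fejerE x : x != 0 -> fejer x = 2 * (1 - cos x) / x ^+ 2.
Proof.
move=> x0.
(* The 1 makes the integrand nonnegative, as [integral_tent_even] asks; it is removed at the end by
   [integral_tent]. *)
have h0 th : 0 <= 1 + cos (th * x) by have := cos_geN1 (th * x); lra.
have ch : continuous (fun th => 1 + cos (th * x)).
  move=> th; apply: cvgD; first exact: cvg_cst.
  apply: (@cvg_comp _ _ _ (fun th => th * x) cos); last exact: continuous_cos.
  by apply: cvgMl; exact: cvg_id.
have hN th : 1 + cos (- th * x) = 1 + cos (th * x) by rewrite mulNr cosN.
have := integral_tent_even h0 ch hN.
(* The antiderivative comes from integrating (1 - th) cos(th x) by parts once. *)
have dF (th : R) : is_derive th 1
    (fun th => th - th ^+ 2 / 2 + ((1 - th) * (sin (th * x) / x) - cos (th * x) / x ^+ 2))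
    ((1 - th) * (1 + cos (th * x))).
  have d1 : is_derive th 1 (fun th : R => th * x) x.
    by apply: is_derive_eq; rewrite /GRing.scale/=; ring.
  have d2 : is_derive th 1 (fun th : R => sin (th * x)) (cos (th * x) * x).
    exact: (@is_derive1_comp _ sin (fun th => th * x) th _ _ (is_derive_sin _) d1).
  have d3 : is_derive th 1 (fun th : R => cos (th * x)) (- sin (th * x) * x).
    exact: (@is_derive1_comp _ cos (fun th => th * x) th _ _ (is_derive_cos _) d1).
  by apply: is_derive_eq; rewrite /GRing.scale/=; field.
have cf : continuous (fun th => (1 - th) * (1 + cos (th * x))).
  move=> th; apply: cvgM; last exact: ch.
  by apply: cvgB; [exact: cvg_cst|exact: cvg_id].
rewrite (integral01_FTC dF cf).
rewrite mul0r cos0 sin0 mul1r subrr mul0r -EFinM => e.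
have : \int[mu]_th (tent th * (1 + cos (th * x))) = fejer x + 1.
  rewrite -[X in _ = _ + X]integral_tent -RintegralD//; last exact: integrable_tent.
  by apply: eq_Rintegral => th _; rewrite mulrDr mulr1 addrC.
rewrite {1}/Rintegral e /= => h.
have -> : fejer x = (fejer x + 1) - 1 by ring.
by rewrite -h; field.
Qed.

Lemma fejer_ge0 x : 0 <= fejer x.
Proof.
have [->|x0] := eqVneq x 0; first by rewrite fejer0.
by rewrite fejerE// divr_ge0 ?sqr_ge0// mulr_ge0// one_sub_cos_ge0.
Qed.

(** The constant is 1 + 4: in 2 (1 - cos x) (1 + x^2) the term 2 (1 - cos x) is at most x^2 and the
    term 2 (1 - cos x) x^2 at most 4 x^2. *)
Lemma fejer_le x : fejer x <= 5 * (1 + x ^+ 2)^-1.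
Proof.
have d0 : 0 < 1 + x ^+ 2 by rewrite ltr_pwDl// sqr_ge0.
have [->|x0] := eqVneq x 0; first by rewrite fejer0 expr0n/= addr0 invr1 mulr1 ler1n.
have x2 : 0 < x ^+ 2 by rewrite exprn_even_gt0.
rewrite ler_pdivlMr// fejerE// mulrAC ler_pdivrMr//.
have h1 := one_sub_cos_le x; have h2 := one_sub_cos_le2 x; have h3 := one_sub_cos_ge0 x.
by nra.
Qed.

Lemma fejer_lipschitz x y : `|fejer x - fejer y| <= `|x - y|.
Proof.
have -> : `|x - y| = \int[mu]_th (`|x - y| * tent th).
  by rewrite RintegralZl ?integral_tent ?mulr1//; exact: integrable_tent.
apply: Rintegral_dist_le => //; first exact: integrable_scale integrable_tent.
move=> th; rewrite -mulrBr normrM ger0_norm ?tent_ge0// mulrC.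
have [h|h] := leP 1 `|th|; first by rewrite tent_eq0// !mulr0.
rewrite ler_wpM2r ?tent_ge0// (le_trans (cos_lipschitz _ _))// -mulrBr normrM.
by rewrite ler_piMl// ltW.
Qed.

Lemma measurable_fejer : measurable_fun setT fejer.
Proof.
apply: continuous_measurable_fun; apply: (@lipschitz_continuous _ R^o _ 1) => x y.
by rewrite mul1r; exact: fejer_lipschitz.
Qed.

Lemma integrable_fejer : mu.-integrable setT (EFin \o fejer).
Proof.
apply: (@integrable_le _ _ _ mu _ (fun x => 5 * (1 + x ^+ 2)^-1)).
- exact: measurable_fejer.
- by move=> x; rewrite ger0_norm ?fejer_ge0 ?fejer_le.
- exact: integrable_scale integrable_oneDsqrV.
Qed.

(** The normalization of the smoothing kernel divides by this integral. On [0, 1] the integrand is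
    at least twice [cos_const]. *)
Lemma integral_fejer_gt0 : 0 < \int[mu]_x fejer x.
Proof.
have k0 := @cos_const_gt0 R.
have m01 : measurable (`[0, 1]%classic : set R) by exact: measurable_itv.
apply: (@lt_le_trans _ _ (\int[mu]_x (2 * cos_const * \1_(`[0, 1]%classic : set R) x))); last first.
  apply: le_Rintegral => //; last 2 first.
  - exact: integrable_fejer.
  - move=> x _; rewrite indicE; have [|_] := boolP (x \in _); last by rewrite mulr0 fejer_ge0.
    rewrite inE/= in_itv/= => /andP[x0 x1]; rewrite mulr1.
    have [->|xn0] := eqVneq x 0.
      rewrite fejer0 /cos_const; have := @cos_le1 R 1; have := @cos1_gt0 R; nra.
    have x2 : 0 < x ^+ 2 by rewrite exprn_even_gt0.
    rewrite fejerE// ler_pdivlMr// -mulrA ler_wpM2l//.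
    by apply: one_sub_cos_ge; rewrite ger0_norm//; lra.
  - by apply: integrable_scale; exact: integrable_indic_itv.
rewrite RintegralZl//; last exact: integrable_indic_itv.
have e1 : fine (mu (`[0, 1]%classic : set R)) = 1.
  by rewrite lebesgue_measure_itv/= lte_fin ltr01/= subr0.
have h : 0 < 2 * cos_const * fine (mu (`[0, 1]%classic : set R)).
  by rewrite e1 mulr1 mulr_gt0.
by rewrite /Rintegral integral_indic// setIT; exact: h.
Qed.

Lemma integral_tent_sin x : \int[mu]_th (tent th * sin (th * x)) = 0.
Proof.
have is_ : mu.-integrable setT (EFin \o (fun th => tent th * sin (th * x))).
  by apply: integrable_tent_mul => [|th]; [measurability|exact: sin_max].
have n1 : -1 != 0 :> R by rewrite oppr_eq0 oner_eq0.
have := Rintegral_affine 0 n1 is_; rewrite normrN1 mul1r.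
have -> : \int[mu]_th (tent (-1 * th + 0) * sin ((-1 * th + 0) * x)) =
    \int[mu]_th ((-1) * (tent th * sin (th * x))).
  apply: eq_Rintegral => th _; rewrite addr0 mulN1r mulNr sinN /tent normrN; ring.
by rewrite RintegralZl// => h; lra.
Qed.

Lemma fejer_scale T x : 0 < T ->
  \int[mu]_th (tent (th / T) * cos (th * x)) = T * fejer (T * x).
Proof.
move=> T0; have Tn0 : T != 0 by rewrite gt_eqF.
have Tv0 : T^-1 != 0 by rewrite invr_eq0.
have iF : mu.-integrable setT (EFin \o (fun th => tent (th / T) * cos (th * x))).
  have := integrable_affine 0 Tv0 (icosx (T * x)); congr (integrable _ _ _).
  apply/funext => th /=; rewrite addr0; congr (tent _ * cos _)%:E; first by rewrite mulrC.
  by field.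
rewrite (Rintegral_affine 0 Tn0 iF) gtr0_norm//; congr (_ * _).
by apply: eq_Rintegral => th _; rewrite addr0; congr (tent _ * cos _); field.
Qed.

Lemma fejer_scale_sin T x : 0 < T -> \int[mu]_th (tent (th / T) * sin (th * x)) = 0.
Proof.
move=> T0; have Tn0 : T != 0 by rewrite gt_eqF.
have Tv0 : T^-1 != 0 by rewrite invr_eq0.
have is_ : mu.-integrable setT (EFin \o (fun th => tent th * sin (th * (T * x)))).
  by apply: integrable_tent_mul => [|th]; [measurability|exact: sin_max].
have iF : mu.-integrable setT (EFin \o (fun th => tent (th / T) * sin (th * x))).
  have := integrable_affine 0 Tv0 is_; congr (integrable _ _ _).
  apply/funext => th /=; rewrite addr0; congr (tent _ * sin _)%:E; first by rewrite mulrC.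
  by field.
rewrite (Rintegral_affine 0 Tn0 iF) -[RHS](mulr0 `|T|); congr (_ * _).
rewrite -[RHS](integral_tent_sin (T * x)).
by apply: eq_Rintegral => th _; rewrite addr0; congr (tent _ * sin _); field.
Qed.

Lemma integrable_tent_scale T (h : R -> R) : 0 < T -> measurable_fun setT h ->
  (forall th, `|h th| <= 1) -> mu.-integrable setT (EFin \o (fun th => tent (th / T) * h th)).
Proof.
move=> T0 mh h1; have Tv0 : T^-1 != 0 by rewrite invr_eq0 gt_eqF.
have mt : measurable_fun setT (fun th => tent (th / T)).
  by apply: (measurableT_comp measurable_tent); measurability.
have := integrable_affine 0 Tv0 integrable_tent => it.
apply: (@integrable_le _ _ _ mu _ (fun th => tent (T^-1 * th + 0))) => //.
  exact: (measurable_funM mt mh).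
move=> th; rewrite addr0 mulrC normrM (mulrC _^-1).
by rewrite [X in _ * X <= _]ger0_norm ?tent_ge0// ler_piMl// tent_ge0.
Qed.

Local Notation mu2 := (mu \x mu)%E.

(** After expanding the cosine of the sum, the product of cosines factors by Fubini and the product
    of sines integrates to zero by oddness. *)
Lemma fejer_fourier2 T (x : R * R) : 0 < T ->
  \int[mu2]_th (tent (th.1 / T) * tent (th.2 / T) * cos (th.1 * x.1 + th.2 * x.2)) =
  (T * fejer (T * x.1)) * (T * fejer (T * x.2)).
Proof.
move=> T0.
have ic y := @integrable_tent_scale T (fun th => cos (th * y)) T0 (mcosx y)
  (fun th => cos_max (th * y)).
have ms y : measurable_fun setT (fun th => sin (th * y)) by measurability.
have is_ y := @integrable_tent_scale T (fun th => sin (th * y)) T0 (ms y)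
  (fun th => sin_max (th * y)).
rewrite -!fejer_scale// -(Rintegral_prod (ic x.1) (ic x.2)).
have h := Rintegral_prod (is_ x.1) (is_ x.2).
rewrite !fejer_scale_sin// mulr0 in h.
rewrite -[RHS]subr0 -h -RintegralB//.
- by apply: eq_Rintegral => th _; rewrite cosD; ring.
- exact: (integrable_prod (ic _) (ic _)).
- exact: (integrable_prod (is_ _) (is_ _)).
Qed.

End fejer.

Section taylor.
Context {R : realType}.

Lemma taylor1 (f df : R -> R) (x h : R) :
  (forall z : R, is_derive z 1 f (df z)) -> (forall y z, `|df y - df z| <= `|y - z|) ->
  `|f (x + h) - f x - h * df x| <= h ^+ 2.
Proof.
move=> f_df df_lip.
have cf : continuous f.
  by move=> z; apply/differentiable_continuous/derivable1_diffP; exact: ex_derive.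
have cs (u v : R) : {within `[u, v], continuous f} by exact: continuous_subspaceT.
have [h0|/ltW h0] := leP 0 h.
  have xh : x <= x + h by rewrite lerDl.
  have [c] := MVT_segment xh (fun z _ => f_df z) (cs _ _).
  rewrite in_itv/= => /andP[c1 c2] ->.
  have -> : df c * (x + h - x) - h * df x = (df c - df x) * h by ring.
  rewrite normrM expr2 (ger0_norm h0) ler_wpM2r// (le_trans (df_lip _ _))//.
  by rewrite ger0_norm ?subr_ge0//; lra.
have xh : x + h <= x by rewrite gerDl.
have [c] := MVT_segment xh (fun z _ => f_df z) (cs _ _).
rewrite in_itv/= => /andP[c1 c2] e.
have -> : f (x + h) - f x - h * df x = (df c - df x) * h.
  by rewrite -[f (x + h) - f x]opprB e; ring.
rewrite normrM -(real_normK (num_real h)) expr2 ler_wpM2r// (le_trans (df_lip _ _))//.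
by rewrite (ler0_norm h0) (ler0_norm (_ : c - x <= 0)) ?subr_le0//; lra.
Qed.

Lemma cos_taylor1 (x h : R) : `|cos (x + h) - cos x + h * sin x| <= h ^+ 2.
Proof.
have := @taylor1 cos (fun z => - sin z) x h.
rewrite mulrN opprK; apply => y z.
by rewrite -opprD normrN; exact: sin_lipschitz.
Qed.

Lemma sin_taylor1 (x h : R) : `|sin (x + h) - sin x - h * cos x| <= h ^+ 2.
Proof.
apply: (@taylor1 sin cos) => y z.
exact: cos_lipschitz.
Qed.

End taylor.

(** * Smoothness of Fourier integrals with rapidly decreasing coefficients *)

Section oscillatory_integrals.
Context {R : realType}.
Local Notation mu := (@lebesgue_measure R).
Local Notation mu2 := (mu \x mu)%E.
Implicit Types u c s : R * R -> R.

Definition dot (th x : R * R) : R := th.1 * x.1 + th.2 * x.2.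

(** The decay half of the Schwartz condition. Multiplication by a linear form preserves it, which is
    what differentiation under a Fourier integral demands. *)
Definition rapid u := measurable_fun setT u /\
  forall m, exists C, forall th, `|u th| * (1 + `|th.1| + `|th.2|) ^+ m <= C.

Lemma measurable_dot x : measurable_fun setT (dot^~ x).
Proof. by rewrite /dot; measurability. Qed.

Lemma rapid_integrable u : rapid u -> mu2.-integrable setT (EFin \o u).
Proof.
(* The fourth power is taken because (1 + p + q)^4 dominates (1 + p^2) (1 + q^2), whose inverse is
   [weight2]. *)
move=> [mu_ /(_ 4%N)[C hC]].
apply: (@integrable_le _ _ _ mu2 _ (fun th => C * weight2 th)).
- exact: mu_.
- move=> th; rewrite /weight2 -invfM ler_pdivlMr; last first.
    by rewrite mulr_gt0// ltr_pwDl// sqr_ge0.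
  apply: (le_trans _ (hC th)); rewrite ler_wpM2l//.
  rewrite (_ : 4%N = (2 * 2)%N)// exprM [leRHS]expr2.
  rewrite -(real_normK (num_real th.1)) -(real_normK (num_real th.2)).
  have := normr_ge0 th.1; have := normr_ge0 th.2.
  move: `|th.1| `|th.2| => p q q0 p0.
  by apply: ler_pM; rewrite ?addr_ge0 ?sqr_ge0//; nra.
- exact: integrable_scale integrable_weight2.
Qed.

Lemma rapid_dot u v : rapid u -> rapid (fun th => dot th v * u th).
Proof.
move=> [mu_ hu]; split; first exact: (measurable_funM (measurable_dot v) mu_).
move=> m; have [C hC] := hu m.+1; exists ((`|v.1| + `|v.2|) * C) => th.
apply: (le_trans _ (ler_wpM2l _ (hC th))); last exact: addr_ge0.
rewrite normrM exprS.
have h : `|dot th v| <= (`|v.1| + `|v.2|) * (1 + `|th.1| + `|th.2|).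
  rewrite /dot (le_trans (ler_normD _ _))// !normrM.
  have := normr_ge0 th.1; have := normr_ge0 th.2; have := normr_ge0 v.1; have := normr_ge0 v.2.
  by nra.
rewrite -mulrA (_ : _ * (_ * (_ * _)) =
  ((`|v.1| + `|v.2|) * (1 + `|th.1| + `|th.2|)) * (`|u th| * (1 + `|th.1| + `|th.2|) ^+ m)).
  by rewrite ler_wpM2r// mulr_ge0// exprn_ge0// !addr_ge0.
by ring.
Qed.

Lemma rapid_opp u : rapid u -> rapid (fun th => - u th).
Proof.
move=> [mu_ hu]; split; first exact: measurableT_comp.
by move=> m; have [C hC] := hu m; exists C => th; rewrite normrN.
Qed.

Lemma rapid_norm u : rapid u -> rapid (fun th => `|u th|).
Proof.
move=> [mu_ hu]; split; first by apply: measurableT_comp => //; exact: normr_measurable.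
by move=> m; have [C hC] := hu m; exists C => th; rewrite normr_id.
Qed.

Lemma rapid_integrable_mul u (h : R * R -> R) : rapid u -> measurable_fun setT h ->
  (forall th, `|h th| <= 1) -> mu2.-integrable setT (EFin \o (fun th => u th * h th)).
Proof.
move=> ru mh h1; apply: (@integrable_le _ _ _ mu2 _ (fun th => `|u th|)).
- exact: (measurable_funM ru.1 mh).
- by move=> th; rewrite normrM ler_piMr.
- exact: rapid_integrable (rapid_norm ru).
Qed.

(** The real part of the integral of (c + i s) e^{-i dot th x}, an inverse Fourier transform up to
    its normalization. *)
Definition osc c s (x : R * R) : R :=
  \int[mu2]_th (c th * cos (dot th x) + s th * sin (dot th x)).

Lemma integrable_osc c s x : rapid c -> rapid s ->
  mu2.-integrable setT (EFin \o (fun th => c th * cos (dot th x) + s th * sin (dot th x))).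
Proof.
move=> rc rs; have md := measurable_dot x.
apply: integrable_add; apply: rapid_integrable_mul => //.
- by apply: measurableT_comp md; exact: continuous_measurable_fun (@continuous_cos R).
- by move=> th; exact: cos_max.
- by apply: measurableT_comp md; exact: continuous_measurable_fun (@continuous_sin R).
- by move=> th; exact: sin_max.
Qed.

Lemma osc_continuous c s : rapid c -> rapid s -> continuous (osc c s).
Proof.
move=> rc rs.
pose g th := (`|dot th (1, 0) * c th| + `|dot th (0, 1) * c th|)
  + (`|dot th (1, 0) * s th| + `|dot th (0, 1) * s th|).
have ig : mu2.-integrable setT (EFin \o g).
  by do 2?[apply: integrable_add]; apply: rapid_integrable; apply: rapid_norm; exact: rapid_dot.
apply: (@lipschitz_continuous _ (R^o * R^o)%type _ (\int[mu2]_th g th)) => x y.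
have ix := integrable_osc x rc rs; have iy := integrable_osc y rc rs.
rewrite mulrC -RintegralZl//; apply: Rintegral_dist_le => //.
  exact: integrable_scale.
move=> th.
have n1 : `|x.1 - y.1| <= `|x - y| by rewrite prod_normE le_max lexx.
have n2 : `|x.2 - y.2| <= `|x - y| by rewrite prod_normE le_max lexx orbT.
have hd : `|dot th x - dot th y| <= `|x - y| * (`|th.1| + `|th.2|).
  rewrite /dot (_ : _ - _ = th.1 * (x.1 - y.1) + th.2 * (x.2 - y.2)); last by ring.
  rewrite (le_trans (ler_normD _ _))// !normrM mulrDr mulrC (mulrC `|th.2|).
  by apply: lerD; rewrite ler_wpM2r.
rewrite (_ : _ - _ = c th * (cos (dot th x) - cos (dot th y)) +
  s th * (sin (dot th x) - sin (dot th y))); last by ring.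
rewrite (le_trans (ler_normD _ _))// !normrM.
have hc := le_trans (cos_lipschitz (dot th x) (dot th y)) hd.
have hs := le_trans (sin_lipschitz (dot th x) (dot th y)) hd.
have -> : g th = (`|c th| + `|s th|) * (`|th.1| + `|th.2|).
  by rewrite /g /dot !(mulr0, mulr1, addr0, add0r) !normrM; ring.
rewrite mulrCA mulrDl; apply: lerD; exact: ler_wpM2l.
Qed.

(** The first-order Taylor error of cosine and sine is at most the square of h [dot th v], uniformly
    in x; rapid coefficients make its integral O(h^2). *)
Lemma osc_cvg_derive c s v x : rapid c -> rapid s ->
  h^-1 *: (osc c s (h *: v + x) - osc c s x) @[h --> 0^'] -->
  osc (fun th => dot th v * s th) (fun th => - (dot th v * c th)) x.
Proof.
move=> rc rs.
have rc1 := rapid_dot v rc; have rs1 := rapid_dot v rs.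
have rc2 := rapid_dot v rc1; have rs2 := rapid_dot v rs1.
set D := osc (fun th => dot th v * s th) _ x.
pose g th := `|dot th v * (dot th v * c th)| + `|dot th v * (dot th v * s th)|.
have ig : mu2.-integrable setT (EFin \o g).
  by apply: integrable_add; apply: rapid_integrable; exact: rapid_norm.
have key h : `|osc c s (h *: v + x) - osc c s x - h * D| <= h ^+ 2 * \int[mu2]_th g th.
  have i1 := integrable_osc (h *: v + x) rc rs; have i2 := integrable_osc x rc rs.
  have i3 := integrable_osc x rs1 (rapid_opp rc1).
  have i12 := integrable_lincomb 1 (-1) i1 i2.
  have i123 := integrable_lincomb 1 (- h) i12 i3.
  have -> : osc c s (h *: v + x) - osc c s x - h * D = \int[mu2]_th
      (1 * (1 * (c th * cos (dot th (h *: v + x)) + s th * sin (dot th (h *: v + x))) +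
            (-1) * (c th * cos (dot th x) + s th * sin (dot th x))) +
       (- h) * (dot th v * s th * cos (dot th x) + - (dot th v * c th) * sin (dot th x))).
    transitivity (1 * (1 * osc c s (h *: v + x) + (-1) * osc c s x) + (- h) * D); first by ring.
    by rewrite [RHS](Rintegral_lincomb 1 (- h) i12 i3) (Rintegral_lincomb 1 (-1) i1 i2).
  rewrite (le_trans (le_normr_Rintegral _ i123))// -RintegralZl//.
  apply: le_Rintegral => //.
  - have := integrable_norm i123; exact.
  - exact: integrable_scale.
  move=> th _.
  have -> : dot th (h *: v + x) = dot th x + h * dot th v.
    by rewrite /dot/= /GRing.scale/=; ring.
  have hc := cos_taylor1 (dot th x) (h * dot th v).
  have hs := sin_taylor1 (dot th x) (h * dot th v).
  rewrite (_ : 1 * _ + _ =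
    c th * (cos (dot th x + h * dot th v) - cos (dot th x) + h * dot th v * sin (dot th x)) +
    s th * (sin (dot th x + h * dot th v) - sin (dot th x) - h * dot th v * cos (dot th x)));
    last by ring.
  rewrite (le_trans (ler_normD _ _))// !normrM.
  have -> : g th = (`|c th| + `|s th|) * dot th v ^+ 2.
    by rewrite /g !normrM -(real_normK (num_real (dot th v))); ring.
  rewrite mulrCA -exprMn mulrDl; apply: lerD; exact: ler_wpM2l.
apply/cvgrPdist_le => e e0.
set I := \int[mu2]_th g th in key.
have I0 : 0 <= I by apply: Rintegral_ge0 => th _; rewrite addr_ge0.
near=> h.
have hn0 : h != 0 by near: h; exact: nbhs_dnbhs_neq.
have hs : `|h| * I <= e.
  rewrite (@le_trans _ _ (`|h| * (I + 1)))//; first by rewrite ler_wpM2l// lerDl.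
  rewrite -ler_pdivlMr ?ltr_wpDl//.
  near: h; apply: nbhs_dnbhs.
  have h2 : 0 < e / (I + 1) by rewrite divr_gt0// ltr_wpDl.
  by exists (e / (I + 1)) => //= h; rewrite /= sub0r normrN => /ltW.
rewrite (_ : D - _ = - h^-1 * (osc c s (h *: v + x) - osc c s x - h * D)); last first.
  by rewrite /GRing.scale/=; field.
rewrite normrM normrN normfV ler_pdivrMl ?normr_gt0// (le_trans (key h))//.
by rewrite -(real_normK (num_real h)) expr2 -mulrA ler_wpM2l.
Unshelve. all: by end_near.
Qed.

(** The class is stable under directional derivatives: the pair (c, s) becomes the linear form times
    (s, -c), which is again rapid. *)
Lemma osc_smooth c s : rapid c -> rapid s -> smooth2 (osc c s).
Proof.
move=> rc rs n; elim: n c s rc rs => [|n IH] c s rc rs /=; split => //;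
  try exact: osc_continuous.
move=> v _; split.
  by move=> x; apply/cvg_ex; eexists; exact: osc_cvg_derive.
have -> : 'D_v (osc c s) = osc (fun th => dot th v * s th) (fun th => - (dot th v * c th)).
  by apply/funext => x; apply: cvg_lim => //; exact: osc_cvg_derive.
by apply: IH; [exact: rapid_dot|exact/rapid_opp/rapid_dot].
Qed.

End oscillatory_integrals.

(** * Measurability and uniform continuity on the plane *)

Section continuous_plane.
Context {R : realType}.
Implicit Types g h : R * R -> R.

Lemma continuous_box h x (e : R) : continuous h -> 0 < e ->
  exists2 r : R, 0 < r & forall y, `|x.1 - y.1| < r -> `|x.2 - y.2| < r -> `|h x - h y| <= e.
Proof.
move=> ch e0; have /cvgrPdist_le /(_ e e0) /nbhs_ballP [r r0 hr] := ch x.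
by exists r => // y y1 y2; apply: hr; split.
Qed.

(** The measurable structure on the plane is the product one, so a superlevel set is written as the
    union of the countably many rational boxes that it contains. *)
Lemma measurable_continuous2 g : continuous g -> measurable_fun setT g.
Proof.
move=> cg mD; apply: (measurability _ (RGenOInfty.measurableE R)) => //.
move=> _ [_ [a ->] <-]; rewrite setTI.
pose B (q : rat * rat * nat) : set (R * R) := [set x | `|x.1 - ratr q.1.1| < q.2.+1%:R^-1] `&`
  [set x | `|x.2 - ratr q.1.2| < q.2.+1%:R^-1].
have mB q : measurable (B q).
  have mlt (f : R * R -> R) (r : R) : measurable_fun setT f -> measurable [set x | `|f x| < r].
    move=> mf; have := @measurable_fun_ltr _ _ _ _ (fun x => `|f x|) (fun=> r).
    rewrite -[X in measurable X]setTI => /(_ _ _); apply => //.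
    by apply: measurableT_comp => //; exact: normr_measurable.
  by apply: measurableI; apply: mlt; measurability.
rewrite (_ : _ @^-1` _ = \bigcup_q (if `[< forall x, B q x -> a < g x >] then B q else set0)).
  apply: countable_bigcupT_measurable => [|q]; first exact: countableP.
  by case: ifP.
apply/seteqP; split => [x /=|x [q _]]; last first.
  by case: ifPn => // /asboolP h /h; rewrite /= in_itv/= andbT.
rewrite in_itv/= andbT => ax.
have e0 : 0 < (g x - a) / 2 by rewrite divr_gt0// subr_gt0.
have [r r0 hr] := continuous_box x cg e0.
have [k kr] : exists k : nat, (k.+1%:R^-1 : R) < r / 2.
  have r20 : 0 < r / 2 by rewrite divr_gt0.
  have /cvgrPdist_lt /(_ _ r20) [k _ hk] := @cvg_harmonic R.
  by exists k; have := hk k (leqnn k); rewrite sub0r normrN ger0_norm ?invr_ge0.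
have k0 : 0 < (k.+1%:R^-1 : R) by rewrite invr_gt0.
have [del delE] : exists del : R, del = k.+1%:R^-1 by exists (k.+1%:R^-1).
rewrite -delE in kr k0.
have ratd (y : R) : exists q : rat, `|y - ratr q| < del.
  have yd : y < y + del by rewrite ltrDl.
  have [q] := rat_in_itvoo yd; rewrite in_itv/= => /andP[h1 h2]; exists q.
  by rewrite ltr_norml; apply/andP; split; lra.
have [q1 hq1] := ratd x.1; have [q2 hq2] := ratd x.2.
exists (q1, q2, k) => //; rewrite ifT; first by split; rewrite /= -delE.
apply/asboolP => y [y1 y2]; rewrite /= -delE in y1 y2.
have d1 : `|x.1 - y.1| < r.
  by move: hq1 y1; rewrite !ltr_norml => /andP[? ?] /andP[? ?]; apply/andP; split; lra.
have d2 : `|x.2 - y.2| < r.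
  by move: hq2 y2; rewrite !ltr_norml => /andP[? ?] /andP[? ?]; apply/andP; split; lra.
by have := hr y d1 d2; rewrite ler_norml => /andP[? ?]; lra.
Qed.

Definition uniformly_continuous2 h := forall e : R, 0 < e -> exists2 r : R, 0 < r &
  forall x y, `|x.1 - y.1| <= r -> `|x.2 - y.2| <= r -> `|h x - h y| <= e.

Lemma compact_support_uniformly_continuous h (A : R) : continuous h ->
  (forall x, (A <= `|x.1|) || (A <= `|x.2|) -> h x = 0) -> uniformly_continuous2 h.
Proof.
move=> ch h0 e e0.
(* The margin 1 ensures that a point outside the box and any point within 1 of it in each coordinate
   both lie where h vanishes. *)
pose I : set R := `[- (A + 1), A + 1]%classic.
have cI : compact (I `*` I) by apply: compact_setX; exact: segment_compact.
pose Pr (n : nat) (x : R * R) := forall y, `|x.1 - y.1| <= n.+1%:R^-1 ->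
  `|x.2 - y.2| <= n.+1%:R^-1 -> `|h x - h y| <= e.
have [] := (compact_near_coveringP (I `*` I)).1 cI nat \oo Pr _.
  move=> x _; have e20 : 0 < e / 2 by rewrite divr_gt0.
  have [r r0 hr] := continuous_box x ch e20.
  have r20 : 0 < r / 2 by rewrite divr_gt0.
  have /cvgrPdist_lt /(_ _ r20) hk := @cvg_harmonic R.
  exists (ball x (r / 2), [set k | `|0 - (k.+1%:R^-1 : R)| < r / 2]).
    by split => //=; exact: nbhsx_ballx.
  move=> [z k] [/= [z1 z2] kr] y y1 y2.
  rewrite /ball/= in z1 z2.
  rewrite sub0r normrN ger0_norm ?invr_ge0// in kr.
  have hz : `|h x - h z| <= e / 2 by apply: hr; lra.
  have hy : `|h x - h y| <= e / 2.
    move: z1 z2 (le_lt_trans y1 kr) (le_lt_trans y2 kr).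
    rewrite !ltr_norml => /andP[? ?] /andP[? ?] /andP[? ?] /andP[? ?].
    by apply: hr; rewrite ltr_norml; apply/andP; split; lra.
  rewrite (_ : h z - h y = (h x - h y) - (h x - h z)); last by ring.
  by rewrite (le_trans (ler_normB _ _))//; lra.
move=> N _ /(_ N (leqnn N)) hN; exists N.+1%:R^-1; first by rewrite invr_gt0.
have N1 : N.+1%:R^-1 <= 1 :> R by rewrite invf_le1// ler1n.
move=> x y xy1 xy2.
have [Ix|nIx] := pselect ((I `*` I) x); first exact: hN.
have big (z z' : R) : ~ I z -> `|z - z'| <= 1 -> A <= `|z| /\ A <= `|z'|.
  move=> nI zz'; have /negP : ~ `|z| <= A + 1.
    by move=> h1; apply: nI; rewrite /I/= in_itv/= -ler_norml.
  rewrite -ltNge => h1; split; first by lra.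
  by have := ler_normD (z - z') z'; rewrite subrK; lra.
have [] : ~ I x.1 \/ ~ I x.2 by apply/not_andP.
  move=> /big/(_ (le_trans xy1 N1))[b1 b2]; rewrite !h0 ?b1 ?b2 ?subrr ?normr0//; exact: ltW.
move=> /big/(_ (le_trans xy2 N1))[b1 b2]; rewrite !h0 ?b1 ?b2 ?orbT ?subrr ?normr0//; exact: ltW.
Qed.

End continuous_plane.

(** * The approximate identity built from the Fejer kernel *)

Section smoothing_kernel.
Context {R : realType}.
Local Notation mu := (@lebesgue_measure R).
Local Notation mu2 := (mu \x mu)%E.
Implicit Types (T u r e : R) (h : R * R -> R).

(* Its value, 2 pi, is never needed. *)
Definition fejer_mass : R := \int[mu]_x fejer x.

Definition kern T (x : R) : R := T * fejer (T * x) / fejer_mass.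

Let mass_gt0 : 0 < fejer_mass := integral_fejer_gt0.

Lemma kern_ge0 T x : 0 <= T -> 0 <= kern T x.
Proof. by move=> T0; rewrite divr_ge0 ?mulr_ge0 ?fejer_ge0// ltW. Qed.

Lemma kern_le T x : 0 <= T -> kern T x <= 5 * T / fejer_mass.
Proof.
move=> T0; rewrite /kern ler_wpM2r ?invr_ge0 ?(ltW mass_gt0)// mulrC ler_wpM2r//.
rewrite (le_trans (fejer_le _))// ler_piMr// invf_le1 ?ltr_pwDl ?sqr_ge0//.
by rewrite lerDl sqr_ge0.
Qed.

Lemma measurable_kern T : measurable_fun setT (kern T).
Proof.
have m : measurable_fun setT (fun x => fejer (T * x)).
  by apply: (measurableT_comp measurable_fejer); measurability.
by rewrite /kern; apply: measurable_funM => //; apply: measurable_funM.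
Qed.

Definition tail r : R := \int[mu]_x ((r < `|x|)%R%:R * fejer x) / fejer_mass.

Let integrable_tail r : mu.-integrable setT (EFin \o (fun x : R => (r < `|x|)%R%:R * fejer x)).
Proof.
apply: (@integrable_le _ _ _ mu _ fejer) => [|x|].
- apply: measurable_funM; last exact: measurable_fejer.
  have -> : (fun x : R => (r < `|x|)%R%:R) = \1_[set x : R | r < `|x|] :> (R -> R).
    by apply/funext => x; rewrite indicE; congr (_%:R); congr nat_of_bool; apply/idP/idP; rewrite inE.
  apply: measurable_indic; rewrite -[X in measurable X]setTI.
  have := @measurable_fun_ltr _ _ _ setT (fun _ : R => r) (fun x : R => `|x|).
  by apply => //; exact: normr_measurable.
- by rewrite ger0_norm ?mulr_ge0 ?fejer_ge0// ler_piMl ?fejer_ge0//; case: (_ < _).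
- exact: integrable_fejer.
Qed.

Lemma tail_cvg0 r : 0 < r -> tail (N.+1%:R * r) @[N --> \oo] --> 0.
Proof.
move=> r0; rewrite -[X in _ --> X](mul0r fejer_mass^-1); apply: cvgMl.
have -> : 0 = \int[mu]_x (cst 0 x) :> R.
  by rewrite /Rintegral integral0.
apply: (@Rintegral_dominated_cvg _ _ _ mu _ _ fejer).
- by move=> N; have /integrableP[/measurable_EFinP] := integrable_tail (N.+1%:R * r).
- move=> x; apply/cvgrPdist_le => e e0.
  have [k hk] : exists k : nat, `|x| / r <= k%:R.
    by exists (Num.Def.archi_bound (`|x| / r)); rewrite ltW// archi_boundP// divr_ge0// ltW.
  exists k => // N /= kN; have h : `|x| <= N.+1%:R * r.
    by rewrite -ler_pdivrMr// (le_trans hk)// ler_nat leqW.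
  by rewrite (ltNge _ `|x|) h mul0r subr0 normr0 ltW.
- exact: integrable_fejer.
- by move=> N x; rewrite ger0_norm ?mulr_ge0 ?fejer_ge0// ler_piMl ?fejer_ge0//; case: (_ < _).
Qed.

Let shiftE T (F : R -> R) u : 0 < T -> mu.-integrable setT (EFin \o F) ->
  mu.-integrable setT (EFin \o (fun x => T * F (T * (x - u)) / fejer_mass)) /\
  \int[mu]_x (T * F (T * (x - u)) / fejer_mass) = \int[mu]_x F x / fejer_mass.
Proof.
move=> T0 iF; have Tn0 : T != 0 by rewrite gt_eqF.
have iFa := integrable_affine (- (T * u)) Tn0 iF.
have E : (fun x => T * F (T * (x - u)) / fejer_mass) =
    (fun x => (T / fejer_mass) * F (T * x + - (T * u))).
  by apply/funext => x; rewrite mulrBr; ring.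
rewrite E; split; first exact: integrable_scale.
by rewrite RintegralZl// (Rintegral_affine (- (T * u)) Tn0 iF) (gtr0_norm T0); ring.
Qed.

Lemma integrable_kern T u : 0 < T -> mu.-integrable setT (EFin \o (fun x => kern T (x - u))).
Proof. by move=> T0; have [] := shiftE u T0 integrable_fejer. Qed.

Lemma integral_kern T u : 0 < T -> \int[mu]_x (kern T (x - u)) = 1.
Proof.
by move=> T0; have [_ ->] := shiftE u T0 integrable_fejer; rewrite divff// gt_eqF.
Qed.

Let kern_tail T r u : 0 < T -> 0 < r ->
  mu.-integrable setT (EFin \o (fun x => (r < `|x - u|)%R%:R * kern T (x - u))) /\
  \int[mu]_x ((r < `|x - u|)%R%:R * kern T (x - u)) = tail (T * r).
Proof.
move=> T0 r0; have [] := shiftE u T0 (integrable_tail (T * r)).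
have -> : (fun x => T * ((T * r < `|T * (x - u)|)%R%:R * fejer (T * (x - u))) / fejer_mass) =
   (fun x => (r < `|x - u|)%R%:R * kern T (x - u)).
  by apply/funext => x; rewrite normrM (gtr0_norm T0) ltr_pM2l// /kern; ring.
by [].
Qed.

Definition kern2 T (x : R * R) : R := kern T x.1 * kern T x.2.

Lemma measurable_kern2 T (u : R * R) :
  measurable_fun setT (fun x : R * R => kern2 T (x.1 - u.1, x.2 - u.2)).
Proof.
have mk := measurable_kern T.
by apply: measurable_funM; apply: (measurableT_comp mk); measurability.
Qed.

Lemma kern2_ge0 T x : 0 <= T -> 0 <= kern2 T x.
Proof. by move=> T0; rewrite mulr_ge0// kern_ge0. Qed.

Lemma kern2_le T x : 0 <= T -> kern2 T x <= (5 * T / fejer_mass) ^+ 2.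
Proof. by move=> T0; rewrite expr2; apply: ler_pM; rewrite ?kern_ge0 ?kern_le. Qed.

(** As [kern2] has mass one, the difference is the integral of h x - h u against it. Where some
    coordinate is farther than r the integrand carries a factor at most 2 M; two coordinates make 4
    M tails. *)
Lemma smoothing_error h (M : R) T r e (u : R * R) : 0 < T -> 0 < r -> 0 <= e ->
  measurable_fun setT h -> (forall x, `|h x| <= M) ->
  (forall x y, `|x.1 - y.1| <= r -> `|x.2 - y.2| <= r -> `|h x - h y| <= e) ->
  `|\int[mu2]_x (h x * kern2 T (x.1 - u.1, x.2 - u.2)) - h u| <= e + 4 * M * tail (T * r).
Proof.
move=> T0 r0 e0 mh hM hr; have M0 : 0 <= M := le_trans (normr_ge0 _) (hM u).
have ik1 := integrable_kern u.1 T0; have ik2 := integrable_kern u.2 T0.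
have [it1 t1] := kern_tail u.1 T0 r0; have [it2 t2] := kern_tail u.2 T0 r0.
have ik := integrable_prod ik1 ik2; have Ek := Rintegral_prod ik1 ik2.
have ia := integrable_prod it1 ik2; have Ea := Rintegral_prod it1 ik2.
have ib := integrable_prod ik1 it2; have Eb := Rintegral_prod ik1 it2.
rewrite !integral_kern// ?t1 ?t2 ?mulr1 ?mul1r in Ek Ea Eb.
have ihk : mu2.-integrable setT (EFin \o (fun x => h x * kern2 T (x.1 - u.1, x.2 - u.2))).
  apply: (@integrable_le _ _ _ mu2 _ (fun x => M * (kern T (x.1 - u.1) * kern T (x.2 - u.2)))).
  - exact: (measurable_funM mh (measurable_kern2 T u)).
  - by move=> x; rewrite normrM (ger0_norm (kern2_ge0 _ (ltW T0))) ler_wpM2r// kern2_ge0// ltW.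
  - exact: integrable_scale.
have ihB := integrable_lincomb 1 (- h u) ihk ik.
have -> : \int[mu2]_x (h x * kern2 T (x.1 - u.1, x.2 - u.2)) - h u =
    \int[mu2]_x (1 * (h x * kern2 T (x.1 - u.1, x.2 - u.2)) +
      - h u * (kern T (x.1 - u.1) * kern T (x.2 - u.2))).
  by rewrite Rintegral_lincomb// Ek mul1r mulr1.
rewrite (le_trans (le_normr_Rintegral _ ihB))//.
have iab := integrable_lincomb (2 * M) (2 * M) ia ib.
have iall := integrable_lincomb e 1 ik iab.
have -> : e + 4 * M * tail (T * r) = \int[mu2]_x (e * (kern T (x.1 - u.1) * kern T (x.2 - u.2)) +
    1 * (2 * M * ((r < `|x.1 - u.1|)%R%:R * kern T (x.1 - u.1) * kern T (x.2 - u.2)) +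
         2 * M * (kern T (x.1 - u.1) * ((r < `|x.2 - u.2|)%R%:R * kern T (x.2 - u.2))))).
  by rewrite (Rintegral_lincomb e 1 ik iab) (Rintegral_lincomb _ _ ia ib) Ek Ea Eb; ring.
apply: le_Rintegral => //.
- have := integrable_norm ihB; exact.
move=> x _; have k1 := kern_ge0 (x.1 - u.1) (ltW T0); have k2 := kern_ge0 (x.2 - u.2) (ltW T0).
rewrite /kern2/=; set k := kern T (x.1 - u.1) in k1 *; set l := kern T (x.2 - u.2) in k2 *.
rewrite (_ : 1 * _ + _ = (h x - h u) * (k * l)); last by ring.
rewrite normrM (ger0_norm (mulr_ge0 k1 k2)).
rewrite (_ : e * _ + _ = (e + 2 * M * ((r < `|x.1 - u.1|)%R%:R + (r < `|x.2 - u.2|)%R%:R)) * (k * l));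
  last by ring.
apply: (ler_wpM2r (mulr_ge0 k1 k2)).
have h2M : `|h x - h u| <= 2 * M.
  by rewrite (le_trans (ler_normB _ _))// mulr_natl mulr2n lerD.
have [/andP[x1 x2]|nx] := boolP ((`|x.1 - u.1| <= r) && (`|x.2 - u.2| <= r)).
  by apply: (le_trans (hr _ _ x1 x2)); rewrite lerDl !mulr_ge0// addr_ge0.
apply: (le_trans h2M); rewrite -[leLHS]mulr1 ler_wpDl// ler_wpM2l ?mulr_ge0//.
by move: nx; rewrite negb_and -!ltNge => /orP[] ->; rewrite ?lerDl ?lerDr ler0n.
Qed.

(* Convergence is uniform in u, so u may later be replaced by a random vector. *)
Lemma smoothing_uniform h (M e : R) : measurable_fun setT h -> (forall x, `|h x| <= M) ->
  uniformly_continuous2 h -> 0 < e ->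
  exists N0, forall N, (N0 <= N)%N -> forall u : R * R,
    `|\int[mu2]_x (h x * kern2 N.+1%:R (x.1 - u.1, x.2 - u.2)) - h u| <= e.
Proof.
move=> mh hM uh e0; have e20 : 0 < e / 2 by rewrite divr_gt0.
have M0 : 0 <= M := le_trans (normr_ge0 _) (hM (0, 0)).
have [r r0 hr] := uh _ e20.
have d0 : 0 < e / 2 / (4 * M + 1) by rewrite divr_gt0//; lra.
have /cvgrPdist_le /(_ _ d0) [N0 _ hN0] := tail_cvg0 r0.
exists N0 => N N0N u.
have N1 : 0 < N.+1%:R :> R by [].
apply: (le_trans (smoothing_error u N1 r0 (ltW e20) mh hM hr)).
have := hN0 N N0N; rewrite sub0r normrN => /(le_trans (ler_norm _)).
rewrite ler_pdivlMr; last by lra.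
have t0 : 0 <= tail (N.+1%:R * r).
  by rewrite divr_ge0 ?(ltW mass_gt0)// Rintegral_ge0// => x _; rewrite mulr_ge0 ?fejer_ge0.
move: (tail _) t0 => t t0; nra.
Qed.

End smoothing_kernel.

Section fubini_plane.
Context {R : realType}.
Local Notation mu := (@lebesgue_measure R).

Let sigma_finite_plane : sigma_finite setT (mu \x mu)%E.
Proof.
have /sigma_finiteP[F [TF ndF Foo]] := sigma_finiteT mu.
exists (fun n => F n `*` F n).
  rewrite -setXTT TF predeqE => -[x y]; split => [[/= [n _ Fx] [k _ Fy]]|[n _ []/= ? ?]].
    exists (maxn n k) => //; split.
    - by move: x Fx; exact/subsetPset/ndF/leq_maxl.
    - by move: y Fy; exact/subsetPset/ndF/leq_maxr.
  by split; exists n.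
move=> k; have [mF Fk] := Foo k; split; first exact: measurableX.
by rewrite product_measure1E// lte_mul_pinfty// ge0_fin_numE.
Qed.

(* No sigma-finite structure on a product measure is exported by the library. *)
Definition plane_measure := HB.pack_for
  {sigma_finite_measure set (measurableTypeR R * measurableTypeR R)%type -> \bar R}
  (mu \x mu)%E (Measure_isSigmaFinite.Build _ _ _ (mu \x mu)%E sigma_finite_plane).

Lemma Rintegral_Fubini2 d (Omega : measurableType d) (P : probability Omega R)
    (F : Omega * (R * R) -> R) (B : R * R -> R) :
  measurable_fun setT F -> (forall w x, `|F (w, x)| <= B x) ->
  (mu \x mu)%E.-integrable setT (EFin \o B) ->
  \int[P]_w (\int[(mu \x mu)%E]_x F (w, x)) = \int[(mu \x mu)%E]_x (\int[P]_w F (w, x)).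
Proof.
move=> mF FB iB.
exact: (@Rintegral_Fubini _ _ _ _ _ P plane_measure F B).
Qed.

End fubini_plane.

(** * Inversion of smoothed characteristic functions *)

Section smoothed_density.
Context {R : realType}.
Local Notation mu := (@lebesgue_measure R).
Local Notation mu2 := (mu \x mu)%E.
Implicit Types c s v : R * R -> R.

Lemma osc_cvg (c_ s_ : nat -> R * R -> R) c s (g : R * R -> R) x :
  (forall n, measurable_fun setT (c_ n)) -> (forall n, measurable_fun setT (s_ n)) ->
  (forall th, c_ n th @[n --> \oo] --> c th) -> (forall th, s_ n th @[n --> \oo] --> s th) ->
  (forall n th, `|c_ n th| <= g th) -> (forall n th, `|s_ n th| <= g th) ->
  mu2.-integrable setT (EFin \o g) -> osc (c_ n) (s_ n) x @[n --> \oo] --> osc c s x.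
Proof.
move=> mc ms cc cs gc gs ig; have md := measurable_dot x.
apply: (@Rintegral_dominated_cvg _ _ _ mu2 _ _ (fun th => 2 * g th)).
- move=> n; apply: measurable_funD; apply: measurable_funM.
  + exact: mc.
  + exact: (measurableT_comp (measurable_trig true) md).
  + exact: ms.
  + exact: (measurableT_comp (measurable_trig false) md).
- by move=> th; apply: cvgD; apply: cvgMl.
- exact: integrable_scale.
- move=> n th; rewrite (le_trans (ler_normD _ _))// !normrM mulrDl mul1r.
  by apply: lerD; rewrite (le_trans (ler_piMr _ _))// ?cos_max ?sin_max.
Qed.

(** Convolution with [kern2 T] seen on the Fourier side: the tents confine the frequencies to a
    square of half-side T, and the power of [fejer_mass] comes from normalizing the two kernels. *)
Definition smoothed T v th : R :=
  fejer_mass ^- 2 * (tent (th.1 / T) * tent (th.2 / T)) * v th.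

Lemma measurable_smoothed T v : measurable_fun setT v -> measurable_fun setT (smoothed T v).
Proof.
move=> mv.
have m1 : measurable_fun setT (fun th : R * R => tent (th.1 / T)).
  by apply: (measurableT_comp (@measurable_tent R)); measurability.
have m2 : measurable_fun setT (fun th : R * R => tent (th.2 / T)).
  by apply: (measurableT_comp (@measurable_tent R)); measurability.
by apply: measurable_funM => //; apply: measurable_funM => //; exact: measurable_funM.
Qed.

Lemma smoothed_le T v th : `|smoothed T v th| <= fejer_mass ^- 2 * `|v th|.
Proof.
have m0 : 0 <= (fejer_mass : R) ^- 2 by rewrite invr_ge0 exprn_ge0// ltW// integral_fejer_gt0.
rewrite /smoothed !normrM (ger0_norm m0) ler_wpM2r// (ger0_norm (tent_ge0 _)).
by rewrite (ger0_norm (tent_ge0 _)) ler_piMr// mulr_ile1 ?tent_ge0 ?tent_le1.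
Qed.

Lemma smoothed_rapid T v : 0 < T -> measurable_fun setT v -> (forall th, `|v th| <= 1) ->
  rapid (smoothed T v).
Proof.
move=> T0 mv v1; split; first exact: measurable_smoothed.
have m0 : 0 <= (fejer_mass : R) ^- 2 by rewrite invr_ge0 exprn_ge0// ltW// integral_fejer_gt0.
move=> m; exists (fejer_mass ^- 2 * (1 + T + T) ^+ m) => th.
have C0 : 0 <= fejer_mass ^- 2 * (1 + T + T) ^+ m.
  by rewrite mulr_ge0// exprn_ge0// !addr_ge0// ltW.
have z (y : R) : T < `|y| -> tent (y / T) = 0.
  by move=> h; rewrite tent_eq0// normrM normfV (gtr0_norm T0) ler_pdivlMr// mul1r ltW.
have [h1|h1] := leP `|th.1| T; last first.
  by rewrite /smoothed z// mul0r mulr0 mul0r normr0 mul0r.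
have [h2|h2] := leP `|th.2| T; last first.
  by rewrite /smoothed (z th.2)// !mulr0 mul0r normr0 mul0r.
apply: ler_pM => //.
  by rewrite (le_trans (smoothed_le _ _ _))// ler_piMr.
by apply: lerXn2r; rewrite ?nnegrE ?addr_ge0 ?(ltW T0)// !lerD.
Qed.

End smoothed_density.

Section inversion.
Context {d} {Omega : measurableType d} {R : realType} (P : probability Omega R).
Local Notation mu := (@lebesgue_measure R).
Local Notation mu2 := (mu \x mu)%E.
Variables (U1 U2 : nat -> Omega -> R).
Hypotheses (mU1 : forall n, measurable_fun setT (U1 n)) (mU2 : forall n, measurable_fun setT (U2 n)).
Local Notation cf := (charfun P U1 U2).

Let mth b n (th : R * R) : measurable_fun setT (fun w => trig b (th.1 * U1 n w + th.2 * U2 n w)).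
Proof.
apply: (measurableT_comp (measurable_trig b)).
by have h1 := mU1 n; have h2 := mU2 n; measurability.
Qed.

Let ith b n th : P.-integrable setT (EFin \o (fun w => trig b (th.1 * U1 n w + th.2 * U2 n w))).
Proof. by apply: (@bounded_integrable _ _ _ _ _ 1) => // w; exact: trig_le1. Qed.

Lemma measurable_charfun b n : measurable_fun setT (cf b n).
Proof.
(* The 1 makes the integrand nonnegative, so that Tonelli gives measurability; it is subtracted
   afterwards. *)
pose F (z : (R * R) * Omega) := (1 + trig b (z.1.1 * U1 n z.2 + z.1.2 * U2 n z.2))%:E.
have mF : measurable_fun setT F.
  apply/measurable_EFinP; apply: measurable_funD => //.
  apply: (measurableT_comp (measurable_trig b)).
  have h1 := measurableT_comp (mU1 n) (@measurable_snd _ _ (R * R)%type Omega).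
  have h2 := measurableT_comp (mU2 n) (@measurable_snd _ _ (R * R)%type Omega).
  have k1 := measurableT_comp (@measurable_fst _ _ R R) (@measurable_fst _ _ (R * R)%type Omega).
  have k2 := measurableT_comp (@measurable_snd _ _ R R) (@measurable_fst _ _ (R * R)%type Omega).
  by apply: measurable_funD; apply: measurable_funM.
have F0 z : (0 <= F z)%E.
  have := trig_le1 b (z.1.1 * U1 n z.2 + z.1.2 * U2 n z.2); rewrite ler_norml => /andP[h _].
  by rewrite lee_fin; lra.
have mG := @measurable_fun_fubini_tonelli_F _ _ _ _ _ P F mF F0.
have -> : cf b n = (fun th => fine (fubini_F P F th) - 1).
  apply/funext => th; rewrite -[fine _]/(\int[P]_w (1 + trig b (th.1 * U1 n w + th.2 * U2 n w))).
  have i1 : P.-integrable setT (EFin \o (fun=> 1)).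
    exact: prob_integrable_cst.
  by rewrite RintegralD// prob_Rintegral_cst addrC addKr.
by apply: measurable_funB => //; exact: measurableT_comp.
Qed.

Lemma measurable_kern2_comp T n : measurable_fun setT
  (fun z : Omega * (R * R) => kern2 T (z.2.1 - U1 n z.1, z.2.2 - U2 n z.1)).
Proof.
have mk := @measurable_kern R T.
have h1 := measurableT_comp (mU1 n) (@measurable_fst _ _ Omega (R * R)%type).
have h2 := measurableT_comp (mU2 n) (@measurable_fst _ _ Omega (R * R)%type).
have k1 := measurableT_comp (@measurable_fst _ _ R R) (@measurable_snd _ _ Omega (R * R)%type).
have k2 := measurableT_comp (@measurable_snd _ _ R R) (@measurable_snd _ _ Omega (R * R)%type).
by apply: measurable_funM; apply: (measurableT_comp mk); exact: measurable_funB.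
Qed.

(** Both sides are the density at x of U_n plus independent noise of density [kern2 T]. The kernel
    is replaced by its Fourier integral and Fubini exchanges the integrals; the tents supply
    integrability in the frequency, whatever the characteristic function. *)
Lemma charfun_inversion n T (x : R * R) : 0 < T ->
  \int[P]_w kern2 T (x.1 - U1 n w, x.2 - U2 n w) =
  osc (smoothed T (cf true n)) (smoothed T (cf false n)) x.
Proof.
move=> T0.
pose tt (th : R * R) : R := tent (th.1 / T) * tent (th.2 / T).
have mass0 : fejer_mass != 0 :> R by rewrite gt_eqF// integral_fejer_gt0.
have itt : mu2.-integrable setT (EFin \o tt).
  have h := @integrable_tent_scale R T (fun=> 1) T0.
  have {h}h : mu.-integrable setT (EFin \o (fun th : R => tent (th / T) * 1)).
    by apply: h => // th; rewrite normr1.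
  by have := integrable_prod h h; congr (integrable _ _ _); apply/funext => th /=; rewrite !mulr1.
have tt0 th : 0 <= tt th by rewrite mulr_ge0 ?tent_ge0.
pose F (z : Omega * (R * R)) := fejer_mass ^- 2 * (tt z.2 *
  cos (z.2.1 * (x.1 - U1 n z.1) + z.2.2 * (x.2 - U2 n z.1))).
have -> : \int[P]_w kern2 T (x.1 - U1 n w, x.2 - U2 n w) = \int[P]_w (\int[mu2]_th F (w, th)).
  apply: eq_Rintegral => w _; rewrite /F/= RintegralZl//; last first.
    apply: (@integrable_le _ _ _ mu2 _ tt) => //.
      have mtt : measurable_fun setT tt by case/integrableP: itt => /measurable_EFinP.
      apply: measurable_funM => //.
      by apply: (measurableT_comp (continuous_measurable_fun (@continuous_cos R))); measurability.
    by move=> th; rewrite normrM (ger0_norm (tt0 th)) ler_piMr// cos_max.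
  rewrite (fejer_fourier2 (x.1 - U1 n w, x.2 - U2 n w) T0) /kern2 /kern/=.
  by field.
have mtt : measurable_fun setT tt by case/integrableP: itt => /measurable_EFinP.
rewrite (@Rintegral_Fubini2 _ _ _ P F (fun th => fejer_mass ^- 2 * tt th)); first last.
- exact: integrable_scale.
- move=> w th; rewrite /F/= normrM ger0_norm ?invr_ge0 ?sqr_ge0// ler_wpM2l ?invr_ge0 ?sqr_ge0//.
  by rewrite normrM (ger0_norm (tt0 th)) ler_piMr// cos_max.
- apply: measurable_funM => //; apply: measurable_funM.
    by apply: (measurableT_comp mtt); exact: measurable_snd.
  apply: (measurableT_comp (continuous_measurable_fun (@continuous_cos R))).
  have h1 := measurableT_comp (mU1 n) (@measurable_fst _ _ Omega (R * R)%type).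
  have h2 := measurableT_comp (mU2 n) (@measurable_fst _ _ Omega (R * R)%type).
  have k1 := measurableT_comp (@measurable_fst _ _ R R) (@measurable_snd _ _ Omega (R * R)%type).
  have k2 := measurableT_comp (@measurable_snd _ _ R R) (@measurable_snd _ _ Omega (R * R)%type).
  by apply: measurable_funD; apply: measurable_funM => //; apply: measurable_funB.
apply: eq_Rintegral => th _; rewrite /F/= /smoothed -/(tt th).
have -> : (fun w => fejer_mass ^- 2 * (tt th * cos (th.1 * (x.1 - U1 n w) + th.2 * (x.2 - U2 n w))))
  = (fun w => (fejer_mass ^- 2 * tt th * cos (dot th x)) * trig true (th.1 * U1 n w + th.2 * U2 n w)
     + (fejer_mass ^- 2 * tt th * sin (dot th x)) * trig false (th.1 * U1 n w + th.2 * U2 n w)).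
  apply/funext => w; rewrite (_ : _ * (_ - _) + _ = dot th x - (th.1 * U1 n w + th.2 * U2 n w)).
    by rewrite cosB /trig; ring.
  by rewrite /dot; ring.
by rewrite Rintegral_lincomb// /charfun; ring.
Qed.

End inversion.

Lemma dist_chain (R : realFieldType) (e x y z t : R) : `|x - y| <= e / 4 ->
  `|y - z| <= e / 4 -> `|z - t| <= e / 4 -> `|x - t| <= e.
Proof.
by rewrite !ler_norml => /andP[? ?] /andP[? ?] /andP[? ?]; apply/andP; split; lra.
Qed.

(** * Identification of the limit density on integrable test functions *)

Section weak_limit.
Context {d} {Omega : measurableType d} {R : realType} (P : probability Omega R).
Local Notation mu := (@lebesgue_measure R).
Local Notation mu2 := (mu \x mu)%E.
Variables (U1 U2 : nat -> Omega -> R).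
Hypotheses (mU1 : forall n, measurable_fun setT (U1 n)) (mU2 : forall n, measurable_fun setT (U2 n)).
Local Notation cf := (charfun P U1 U2).
Variable phi : bool -> R * R -> R.
Hypothesis cf_phi : forall b th, cf b n th @[n --> \oo] --> phi b th.
Hypothesis phi_rapid : forall b, rapid (phi b).

Let mass2 : R := fejer_mass ^- 2.

Let mass2_ge0 : 0 <= mass2.
Proof. by rewrite /mass2 invr_ge0 exprn_ge0// ltW// integral_fejer_gt0. Qed.

(** The inverse Fourier transform of phi, with [fejer_mass ^- 2] in the place of (2 pi)^(-2); this
    is the constant produced by the normalization of [kern2]. *)
Definition limit_density : R * R -> R :=
  osc (fun th => mass2 * phi true th) (fun th => mass2 * phi false th).

Let rphi b : rapid (fun th => mass2 * phi b th).
Proof.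
have [mphi hphi] := phi_rapid b; split; first exact: measurable_funM.
move=> m; have [C hC] := hphi m; exists (mass2 * C) => th.
by rewrite normrM (ger0_norm mass2_ge0) -mulrA ler_wpM2l.
Qed.

Lemma limit_density_smooth : smooth2 limit_density.
Proof. by apply: osc_smooth; exact: rphi. Qed.

Lemma continuous_limit_density : continuous limit_density.
Proof. by apply: osc_continuous; exact: rphi. Qed.

Let mf : measurable_fun setT limit_density.
Proof. exact: measurable_continuous2 continuous_limit_density. Qed.

Let phi_le1 b th : `|phi b th| <= 1.
Proof.
have h : `|cf b n th| @[n --> \oo] --> `|phi b th| by apply: cvg_norm; exact: cf_phi.
rewrite -(cvg_lim _ h)//; apply: limr_le; first exact: cvgP h.
by apply: nearW => n; exact: charfun_le1.
Qed.

Let mphi b : measurable_fun setT (phi b).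
Proof. by have [] := phi_rapid b. Qed.

(** [fnT T n], below, is the density of U_n plus noise of density [kern2 T], and [fT T] is its limit
    in n. *)
Let fT T := osc (smoothed T (phi true)) (smoothed T (phi false)).
Let fnT T n := osc (smoothed T (cf true n)) (smoothed T (cf false n)).

Let continuous_fT T : 0 < T -> continuous (fT T).
Proof. by move=> T0; apply: osc_continuous; apply: smoothed_rapid. Qed.

Let continuous_fnT T n : 0 < T -> continuous (fnT T n).
Proof.
move=> T0; apply: osc_continuous; apply: smoothed_rapid => //.
- exact: measurable_charfun.
- by move=> th; exact: charfun_le1.
- exact: measurable_charfun.
- by move=> th; exact: charfun_le1.
Qed.

(** At fixed T the compactly supported tents dominate, because characteristic functions are bounded
    by 1; no decay uniform in n enters. *)
Let fnT_cvg T x : 0 < T -> fnT T n x @[n --> \oo] --> fT T x.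
Proof.
move=> T0; have r1 : rapid (smoothed T (fun=> 1)).
  by apply: smoothed_rapid => // th; rewrite normr1.
have s0 th : 0 <= smoothed T (fun=> 1) th.
  by rewrite /smoothed mulr1 mulr_ge0// mulr_ge0 ?tent_ge0.
have le1 v th : `|v th| <= 1 -> `|smoothed T v th| <= smoothed T (fun=> 1) th.
  move=> v1; rewrite (_ : smoothed T v th = smoothed T (fun=> 1) th * v th).
    by rewrite normrM ger0_norm// ler_piMr.
  by rewrite /smoothed mulr1.
apply: (@osc_cvg R _ _ _ _ (smoothed T (fun=> 1)) x).
- by move=> n; apply: measurable_smoothed; exact: measurable_charfun.
- by move=> n; apply: measurable_smoothed; exact: measurable_charfun.
- by move=> th; apply: cvgMr; exact: cf_phi.
- by move=> th; apply: cvgMr; exact: cf_phi.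
- by move=> n th; apply: le1; exact: charfun_le1.
- by move=> n th; apply: le1; exact: charfun_le1.
- exact: rapid_integrable.
Qed.

Let bd th : R := `|mass2 * phi true th| + `|mass2 * phi false th|.

Let ibd : mu2.-integrable setT (EFin \o bd).
Proof. by apply: integrable_add; apply: rapid_integrable; exact: rapid_norm. Qed.

Let smoothed_phi_le T b th : `|smoothed T (phi b) th| <= `|mass2 * phi b th|.
Proof. by rewrite [leRHS]normrM (ger0_norm mass2_ge0); exact: smoothed_le. Qed.

Let smoothed_phi_bd T b th : `|smoothed T (phi b) th| <= bd th.
Proof.
rewrite (le_trans (smoothed_phi_le T b th))// /bd.
by case: b; rewrite ?lerDl ?lerDr.
Qed.

(** As T grows the tents tend to 1, and the majorant is now the rapidly decreasing limit itself. *)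
Let fT_cvg x : fT N.+1%:R x @[N --> \oo] --> limit_density x.
Proof.
have t1 (y : R) : tent (y / N.+1%:R) @[N --> \oo] --> (1 : R).
  rewrite -[X in _ --> X](_ : tent (y * 0) = 1); last by rewrite mulr0 /tent normr0 subr0 max_r.
  apply: (@continuous_cvg _ _ _ _ _ _ tent); first exact: continuous_tent.
  by apply: cvgMr; exact: cvg_harmonic.
have cv b th : smoothed N.+1%:R (phi b) th @[N --> \oo] --> mass2 * phi b th.
  apply: cvgMl; rewrite -[X in _ --> X]mulr1; apply: cvgMr.
  by rewrite -[X in _ --> X]mulr1; apply: cvgM; exact: t1.
apply: (@osc_cvg R _ _ _ _ bd x).
- by move=> N; exact: measurable_smoothed.
- by move=> N; exact: measurable_smoothed.
- exact: cv.
- exact: cv.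
- by move=> N th; exact: smoothed_phi_bd.
- by move=> N th; exact: smoothed_phi_bd.
- exact: ibd.
Qed.

Let fT_le T x : 0 < T -> `|fT T x| <= \int[mu2]_th bd th.
Proof.
move=> T0; have rs b := smoothed_rapid T0 (mphi b) (phi_le1 b).
have io := integrable_osc x (rs true) (rs false).
rewrite (le_trans (le_normr_Rintegral _ io))//; apply: le_Rintegral => //.
- have := integrable_norm io; exact.
have hb b th (y : R) : `|y| <= 1 -> `|smoothed T (phi b) th * y| <= `|mass2 * phi b th|.
  move=> y1; apply: le_trans (smoothed_phi_le T b th).
  by rewrite -[leRHS]mulr1 (normrM (smoothed _ _ _)) ler_wpM2l.
move=> th _; rewrite (le_trans (ler_normD _ _))//.
by apply: lerD; apply: hb; [exact: cos_max|exact: sin_max].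
Qed.

Let ik T n x : 0 < T ->
  P.-integrable setT (EFin \o (fun w => kern2 T (x.1 - U1 n w, x.2 - U2 n w))).
Proof.
move=> T0; apply: (@bounded_integrable _ _ _ _ _ ((5 * T / fejer_mass) ^+ 2)) => [|w].
  have mk := @measurable_kern R T; have h1 := mU1 n; have h2 := mU2 n.
  by apply: measurable_funM; apply: (measurableT_comp mk); measurability.
by rewrite ger0_norm ?kern2_le ?kern2_ge0// ltW.
Qed.

Let fnT_ge0 T n x : 0 < T -> 0 <= fnT T n x.
Proof.
move=> T0; rewrite /fnT -charfun_inversion//.
by apply: Rintegral_ge0 => w _; rewrite kern2_ge0// ltW.
Qed.

Let fnT_le T n x : 0 < T -> fnT T n x <= (5 * T / fejer_mass) ^+ 2.
Proof.
move=> T0; rewrite /fnT -charfun_inversion// -[leRHS](prob_Rintegral_cst P).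
apply: le_Rintegral => //; first exact: ik.
  by apply: (@bounded_integrable _ _ _ _ _ `|(5 * T / fejer_mass) ^+ 2|).
by move=> w _; rewrite kern2_le// ltW.
Qed.

(** Positivity is not visible on the Fourier side. It is inherited from the nonnegative kernel
    through the limit in n and then in T. *)
Lemma limit_density_ge0 x : 0 <= limit_density x.
Proof.
rewrite -(cvg_lim _ (@fT_cvg x))//; apply: limr_ge; first exact: cvgP (@fT_cvg x).
apply: nearW => N; have N0 : 0 < N.+1%:R :> R by [].
rewrite -(cvg_lim _ (@fnT_cvg _ x N0))//; apply: limr_ge; first exact: cvgP (@fnT_cvg _ x N0).
by apply: nearW => n; exact: fnT_ge0.
Qed.

Lemma limit_density_bounded : exists B, forall x, `|limit_density x| <= B.
Proof.
exists (\int[mu2]_th bd th) => x.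
have h : `|fT N.+1%:R x| @[N --> \oo] --> `|limit_density x| by apply: cvg_norm; exact: fT_cvg.
rewrite -(cvg_lim _ h)//; apply: limr_le; first exact: cvgP h.
by apply: nearW => N; exact: fT_le.
Qed.

Section test_function.
Variables (h : R * R -> R) (M : R).
Hypotheses (mh : measurable_fun setT h) (hM : forall x, `|h x| <= M).
Hypothesis (ih : mu2.-integrable setT (EFin \o h)).

Let M0 : 0 <= M := le_trans (normr_ge0 _) (hM (0, 0)).

Let ihn : mu2.-integrable setT (EFin \o (fun x => `|h x|)).
Proof. exact: integrable_norm ih. Qed.

Let integrable_mul_bounded (g : R * R -> R) (B : R) : measurable_fun setT g ->
  (forall x, `|g x| <= B) -> mu2.-integrable setT (EFin \o (fun x => h x * g x)).
Proof.
move=> mg gB; apply: (@integrable_le _ _ _ mu2 _ (fun x => B * `|h x|)).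
- exact: measurable_funM.
- by move=> x; rewrite normrM mulrC ler_wpM2r.
- exact: integrable_scale.
Qed.

Let S T (u : R * R) := \int[mu2]_x (h x * kern2 T (x.1 - u.1, x.2 - u.2)).

Let mS T n : 0 < T -> measurable_fun setT (fun w => S T (U1 n w, U2 n w)).
Proof.
move=> T0.
(* Adding M makes the integrand nonnegative for Tonelli; since the kernel has mass one, this shifts
   the integral by M. *)
pose F (z : Omega * (R * R)) :=
  ((h z.2 + M) * kern2 T (z.2.1 - U1 n z.1, z.2.2 - U2 n z.1))%:E.
have F0 z : (0 <= F z)%E.
  rewrite lee_fin mulr_ge0 ?kern2_ge0 ?(ltW T0)//.
  by have := hM z.2; rewrite ler_norml => /andP[? _]; lra.
have mF : measurable_fun setT F.
  apply/measurable_EFinP; apply: measurable_funM; last exact: measurable_kern2_comp.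
  have kh := measurableT_comp mh (@measurable_snd _ _ Omega (R * R)%type).
  exact: measurable_funD.
have mG := @measurable_fun_fubini_tonelli_F _ _ _ _ _ plane_measure F mF F0.
have -> : (fun w => S T (U1 n w, U2 n w)) = (fun w => fine (fubini_F plane_measure F w) - M).
  apply/funext => w.
  rewrite -[fine _]/(\int[mu2]_x ((h x + M) * kern2 T (x.1 - U1 n w, x.2 - U2 n w))).
  have i1 := integrable_kern (U1 n w) T0; have i2 := integrable_kern (U2 n w) T0.
  have i12 := integrable_prod i1 i2; have E12 := Rintegral_prod i1 i2.
  rewrite !integral_kern// mulr1 in E12.
  have ihk : mu2.-integrable setT (EFin \o (fun x => h x * kern2 T (x.1 - U1 n w, x.2 - U2 n w))).
    apply: (integrable_mul_bounded (B := (5 * T / fejer_mass) ^+ 2)).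
      exact: (measurable_kern2 T (U1 n w, U2 n w)).
    by move=> x; rewrite ger0_norm ?kern2_le ?kern2_ge0// ltW.
  have := Rintegral_lincomb 1 M ihk i12; rewrite E12 mulr1 mul1r => E.
  transitivity ((S T (U1 n w, U2 n w) + M) - M); first by rewrite addrK.
  congr (_ - _); rewrite /S/= -E; apply: eq_Rintegral => x _.
  by rewrite /kern2/=; ring.
by apply: measurable_funB => //; exact: measurableT_comp.
Qed.

Let S_le T u : 0 < T -> `|S T u| <= (5 * T / fejer_mass) ^+ 2 * \int[mu2]_x `|h x|.
Proof.
move=> T0; have ihk : mu2.-integrable setT (EFin \o (fun x => h x * kern2 T (x.1 - u.1, x.2 - u.2))).
  apply: (integrable_mul_bounded (B := (5 * T / fejer_mass) ^+ 2)).
    exact: measurable_kern2.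
  by move=> x; rewrite ger0_norm ?kern2_le ?kern2_ge0// ltW.
rewrite (le_trans (le_normr_Rintegral _ ihk))// -RintegralZl//; apply: le_Rintegral => //.
- have := integrable_norm ihk; exact.
- exact: integrable_scale.
move=> x _; rewrite normrM mulrC ler_wpM2r//.
by rewrite ger0_norm ?kern2_le ?kern2_ge0// ltW.
Qed.

Let integral_S T n : 0 < T ->
  \int[P]_w S T (U1 n w, U2 n w) = \int[mu2]_x (h x * fnT T n x).
Proof.
move=> T0; pose F (z : Omega * (R * R)) := h z.2 * kern2 T (z.2.1 - U1 n z.1, z.2.2 - U2 n z.1).
rewrite [LHS](@Rintegral_Fubini2 _ _ _ P F (fun x => (5 * T / fejer_mass) ^+ 2 * `|h x|)).
- apply: eq_Rintegral => x _; rewrite /F/= RintegralZl//; last exact: ik.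
  by rewrite /fnT -charfun_inversion.
- apply: measurable_funM; last exact: measurable_kern2_comp.
  exact: (measurableT_comp mh (@measurable_snd _ _ Omega (R * R)%type)).
- move=> w x; rewrite /F/= normrM mulrC ler_wpM2r//.
  by rewrite ger0_norm ?kern2_le ?kern2_ge0// ltW.
- exact: integrable_scale.
Qed.

(** The smoothing error is uniform in the law of U_n, so T is fixed first, large enough for this
    error and for the passage from [fT] to the limit density; n tends to infinity afterwards. *)
Lemma test_function_cvg : uniformly_continuous2 h ->
  \int[P]_w h (U1 n w, U2 n w) @[n --> \oo] --> \int[mu2]_x (h x * limit_density x).
Proof.
move=> uh; apply/cvgrPdist_le => e e0; have e40 : 0 < e / 4 by rewrite divr_gt0.
have [N0 hN0] := smoothing_uniform mh hM uh e40.
have cT : \int[mu2]_x (h x * fT N.+1%:R x) @[N --> \oo] --> \int[mu2]_x (h x * limit_density x).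
  apply: (@Rintegral_dominated_cvg _ _ _ mu2 _ _ (fun x => (\int[mu2]_th bd th) * `|h x|)).
  - move=> N; apply: measurable_funM => //.
    by apply: measurable_continuous2; exact: continuous_fT.
  - by move=> x; apply: cvgMr; exact: fT_cvg.
  - exact: integrable_scale.
  - by move=> N x; rewrite normrM mulrC ler_wpM2r// fT_le.
have /cvgrPdist_le /(_ _ e40) [N1 _ hN1] := cT.
pose N := maxn N0 N1; pose T : R := N.+1%:R; have T0 : 0 < T by [].
have cn : \int[mu2]_x (h x * fnT T n x) @[n --> \oo] --> \int[mu2]_x (h x * fT T x).
  apply: (@Rintegral_dominated_cvg _ _ _ mu2 _ _ (fun x => (5 * T / fejer_mass) ^+ 2 * `|h x|)).
  - move=> n; apply: measurable_funM => //.
    by apply: measurable_continuous2; exact: continuous_fnT.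
  - by move=> x; apply: cvgMr; exact: fnT_cvg.
  - exact: integrable_scale.
  - by move=> n x; rewrite normrM mulrC ler_wpM2r// ger0_norm ?fnT_le ?fnT_ge0.
move/cvgrPdist_le : cn => /(_ _ e40) [K _ hK]; exists K => // n /hK h3.
have h2 := hN1 N (leq_maxr _ _).
have h1 : `|\int[P]_w S T (U1 n w, U2 n w) - \int[P]_w h (U1 n w, U2 n w)| <= e / 4.
  have mhU : measurable_fun setT (fun w => h (U1 n w, U2 n w)).
    by apply: (measurableT_comp mh); exact: measurable_fun_pair.
  have iS : P.-integrable setT (EFin \o (fun w => S T (U1 n w, U2 n w))).
    by apply: (bounded_integrable _ (mS n T0)) => w; exact: S_le.
  have ihU : P.-integrable setT (EFin \o (fun w => h (U1 n w, U2 n w))).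
    by apply: (bounded_integrable _ mhU) => w; exact: hM.
  rewrite -[leRHS](prob_Rintegral_cst P); apply: Rintegral_dist_le => //.
  - exact: prob_integrable_cst.
  - by move=> w; exact: (hN0 N (leq_maxl _ _)).
by rewrite integral_S// in h1; exact: dist_chain h2 h3 h1.
Qed.

End test_function.

End weak_limit.

(** * Weak convergence to a smooth density *)

Section cutoff.
Context {R : realType}.
Local Notation mu := (@lebesgue_measure R).
Local Notation mu2 := (mu \x mu)%E.
Implicit Types (K : R) (x : R * R).

Definition cutoff K x : R := tent (x.1 / K) * tent (x.2 / K).

Lemma cutoff_ge0 K x : 0 <= cutoff K x.
Proof. by rewrite mulr_ge0 ?tent_ge0. Qed.

Lemma cutoff_le1 K x : cutoff K x <= 1.
Proof. by rewrite mulr_ile1 ?tent_ge0 ?tent_le1. Qed.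

Lemma continuous_cutoff K : continuous (cutoff K).
Proof.
move=> x; apply: cvgM; apply: (@cvg_comp _ _ _ _ tent _ _ _ _ (@continuous_tent R _)).
- by apply: cvgMl; exact: cvg_fst.
- by apply: cvgMl; exact: cvg_snd.
Qed.

Lemma cutoff_eq0 K x : 0 < K -> (K <= `|x.1|) || (K <= `|x.2|) -> cutoff K x = 0.
Proof.
move=> K0; have z (y : R) : K <= `|y| -> tent (y / K) = 0.
  by move=> h; rewrite tent_eq0// normrM normfV (gtr0_norm K0) ler_pdivlMr// mul1r.
by move=> /orP[] /z h; rewrite /cutoff h ?mul0r ?mulr0.
Qed.

(** It bounds the mass lost by the cutoff by the very functional used to express tightness, through
    1 - u v <= (1 - u) + (1 - v) for u, v <= 1. *)
Lemma one_sub_cutoff_le K x : 0 < K -> 1 - cutoff K x <= Num.min 1 ((`|x.1| + `|x.2|) / K).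
Proof.
move=> K0; have t (y : R) : 1 - `|y| / K <= tent (y / K).
  by rewrite /tent normrM normfV (gtr0_norm K0) le_max lexx orbT.
rewrite le_min; apply/andP; split; first by rewrite gerBl cutoff_ge0.
have aux (u v p q : R) : u <= 1 -> v <= 1 -> 1 - p <= u -> 1 - q <= v -> 1 - u * v <= p + q.
  move=> u1 v1 pu qv; have : 0 <= (1 - u) * (1 - v) by rewrite mulr_ge0 ?subr_ge0.
  by lra.
by rewrite mulrDl; apply: aux; rewrite ?tent_le1.
Qed.

Lemma cutoff_cvg1 x : cutoff n.+1%:R x @[n --> \oo] --> (1 : R).
Proof.
have t (y : R) : tent (y / n.+1%:R) @[n --> \oo] --> (1 : R).
  rewrite -[X in _ --> X](_ : tent (y * 0) = 1); last by rewrite mulr0 /tent normr0 subr0 max_r.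
  apply: (@continuous_cvg _ _ _ _ _ _ tent); first exact: continuous_tent.
  by apply: cvgMr; exact: cvg_harmonic.
by rewrite -[X in _ --> X]mulr1; apply: cvgM; exact: t.
Qed.

Lemma integrable_cutoff K : 0 < K -> mu2.-integrable setT (EFin \o cutoff K).
Proof.
move=> K0; have h := @integrable_tent_scale R K (fun=> 1) K0.
have {h}h : mu.-integrable setT (EFin \o (fun y : R => tent (y / K) * 1)).
  by apply: h => // y; rewrite normr1.
by have := integrable_prod h h; congr (integrable _ _ _); apply/funext => x /=; rewrite !mulr1.
Qed.

End cutoff.

Section continuous_bounded_limit.
Context {d} {Omega : measurableType d} {R : realType} (P : probability Omega R).
Local Notation mu := (@lebesgue_measure R).
Local Notation mu2 := (mu \x mu)%E.
Variables (U1 U2 : nat -> Omega -> R).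
Hypotheses (mU1 : forall n, measurable_fun setT (U1 n)) (mU2 : forall n, measurable_fun setT (U2 n)).
Hypothesis tightU : forall e : R, 0 < e -> exists (K : R) (N : nat),
  1 <= K /\ forall n, (N <= n)%N ->
    \int[P]_w Num.min 1 ((`|U1 n w| + `|U2 n w|) / K) <= e.
Variable phi : bool -> R * R -> R.
Hypothesis cf_phi : forall b th, charfun P U1 U2 b n th @[n --> \oo] --> phi b th.
Hypothesis phi_rapid : forall b, rapid (phi b).

Local Notation f := (limit_density phi).

Let f_ge0 x : 0 <= f x.
Proof. exact: (limit_density_ge0 mU1 mU2 cf_phi phi_rapid). Qed.

Let mf : measurable_fun setT f.
Proof. by apply: measurable_continuous2; exact: continuous_limit_density. Qed.

Let mU n : measurable_fun setT (fun w => (U1 n w, U2 n w)).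
Proof. exact: measurable_fun_pair. Qed.

(** Multiplied by the cutoff, g has compact support, hence is integrable and uniformly continuous,
    as [test_function_cvg] requires. *)
Lemma cutoff_limit (g : R * R -> R) (M K : R) : continuous g -> (forall x, `|g x| <= M) -> 0 < K ->
  \int[P]_w (g (U1 n w, U2 n w) * cutoff K (U1 n w, U2 n w)) @[n --> \oo] -->
  \int[mu2]_x (g x * cutoff K x * f x).
Proof.
move=> cg gM K0; pose h x := g x * cutoff K x.
have ch : continuous h by move=> x; apply: cvgM; [exact: cg|exact: continuous_cutoff].
have mh : measurable_fun setT h by exact: measurable_continuous2.
have M0 : 0 <= M := le_trans (normr_ge0 _) (gM (0, 0)).
have hc x : `|h x| <= M * cutoff K x.
  by rewrite normrM (ger0_norm (cutoff_ge0 _ _)) ler_wpM2r// cutoff_ge0.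
apply: (@test_function_cvg _ _ _ _ _ _ mU1 mU2 _ cf_phi phi_rapid h M mh).
- by move=> x; rewrite (le_trans (hc x))// ler_piMr// cutoff_le1.
- apply: (@integrable_le _ _ _ mu2 _ (fun x => M * cutoff K x)) => //.
  by apply: integrable_scale; exact: integrable_cutoff.
- apply: (@compact_support_uniformly_continuous _ _ K) => // x xK.
  by rewrite /h cutoff_eq0// mulr0.
Qed.

Let icf K : 0 < K -> mu2.-integrable setT (EFin \o (fun x => cutoff K x * f x)).
Proof.
move=> K0; have [B hB] := limit_density_bounded mU1 mU2 cf_phi phi_rapid.
have ic := integrable_cutoff K0.
apply: (@integrable_le _ _ _ mu2 _ (fun x => B * cutoff K x)).
- by apply: measurable_funM => //; have /integrableP[/measurable_EFinP] := ic.
- move=> x; rewrite normrM mulrC (ger0_norm (cutoff_ge0 _ _)) ler_wpM2r//.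
  exact: cutoff_ge0.
- exact: integrable_scale.
Qed.

Let mcU K n : measurable_fun setT (fun w => cutoff K (U1 n w, U2 n w)).
Proof. exact: (measurableT_comp (measurable_continuous2 (@continuous_cutoff R K)) (mU n)). Qed.

Let icU K n : P.-integrable setT (EFin \o (fun w => cutoff K (U1 n w, U2 n w))).
Proof.
apply: (@bounded_integrable _ _ _ _ _ 1); first exact: mcU.
by move=> w; rewrite ger0_norm ?cutoff_ge0 ?cutoff_le1.
Qed.

Let cutoff_limit1 K : 0 < K -> \int[P]_w cutoff K (U1 n w, U2 n w) @[n --> \oo] -->
  \int[mu2]_x (cutoff K x * f x).
Proof.
move=> K0.
have -> : \int[mu2]_x (cutoff K x * f x) = \int[mu2]_x (1 * cutoff K x * f x).
  by apply: eq_Rintegral => x _; rewrite mul1r.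
have -> : (fun n => \int[P]_w cutoff K (U1 n w, U2 n w)) =
    (fun n => \int[P]_w (1 * cutoff K (U1 n w, U2 n w))).
  by apply/funext => n; apply: eq_Rintegral => w _; rewrite mul1r.
apply: (@cutoff_limit (fun=> 1) 1 K) => // [x|x]; first exact: cvg_cst.
by rewrite normr1.
Qed.

Let cutoff_mass_le1 K : 0 < K -> \int[mu2]_x (cutoff K x * f x) <= 1.
Proof.
move=> K0; have h := @cutoff_limit1 _ K0.
rewrite -(cvg_lim _ h)//; apply: limr_le; first exact: cvgP h.
apply: nearW => n; rewrite -[leRHS](prob_Rintegral_cst P); apply: le_Rintegral => //.
- exact: prob_integrable_cst.
- by move=> w _; exact: cutoff_le1.
Qed.

Let tight_cutoff (e : R) : 0 < e -> exists K N, [/\ 0 < K,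
  forall n, (N <= n)%N -> 1 - e <= \int[P]_w cutoff K (U1 n w, U2 n w) &
  1 - e <= \int[mu2]_x (cutoff K x * f x)].
Proof.
move=> e0; have [K [N [K1 hN]]] := tightU e0; have K0 : 0 < K := lt_le_trans ltr01 K1.
have h n : (N <= n)%N -> 1 - e <= \int[P]_w cutoff K (U1 n w, U2 n w).
  move=> /hN; apply: contra_leT; rewrite -!ltNge => h1.
  have i1 := prob_integrable_cst P 1.
  apply: (@lt_le_trans _ _ (\int[P]_w (1 - cutoff K (U1 n w, U2 n w)))).
    by rewrite RintegralB// prob_Rintegral_cst; lra.
  apply: le_Rintegral => //.
  - have := integrable_lincomb 1 (-1) i1 (icU K n); congr (integrable _ _ _).
    by apply/funext => w /=; rewrite mul1r mulN1r.
  - apply: (@bounded_integrable _ _ _ _ _ 1) => [|w].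
      by have h1' := mU1 n; have h2' := mU2 n; measurability.
    by rewrite ger0_norm ?ge_min ?lexx// le_min ler01 divr_ge0 ?addr_ge0// ltW.
  - by move=> w _; exact: (one_sub_cutoff_le (U1 n w, U2 n w) K0).
exists K, N; split => //; have hl := @cutoff_limit1 _ K0.
rewrite -(cvg_lim _ hl)//; apply: limr_ge; first exact: cvgP hl.
by exists N.
Qed.

(** Fatou along growing cutoffs, each of which captures mass at most one as a limit of
    expectations. *)
Let integral_le1 : (\int[mu2]_x (f x)%:E <= 1)%E.
Proof.
have mc n : measurable_fun setT (fun x => (cutoff n.+1%:R x * f x)%:E).
  by have /integrableP[] := @icf n.+1%:R (ltr0Sn _ _).
have c0 n x : (0 <= (cutoff n.+1%:R x * f x)%:E)%E by rewrite lee_fin mulr_ge0 ?cutoff_ge0.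
have := @fatou _ _ _ mu2 setT measurableT
  (fun n x => (cutoff n.+1%:R x * f x)%:E) mc (fun n x _ => c0 n x).
have -> : (\int[mu2]_x limn_einf (fun n => (cutoff n.+1%:R x * f x)%:E) =
    \int[mu2]_x (f x)%:E)%E.
  apply: eq_integral => x _; have [] // := @cvg_limn_einf_sup _
    (fun n => (cutoff n.+1%:R x * f x)%:E) (f x)%:E.
  apply: cvg_EFin; first exact: nearW.
  by rewrite -[X in _ --> X]mul1r; apply: cvgMl; exact: cutoff_cvg1.
move=> /le_trans; apply; rewrite limn_einf_lim; apply: lime_le; first exact: is_cvg_einfs.
apply: nearW => n; rewrite (@le_trans _ _ (\int[mu2]_x (cutoff n.+1%:R x * f x)%:E))%E//.
  by apply: ereal_inf_lbound; exists n => /=.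
have iK := @icf n.+1%:R (ltr0Sn _ _).
have := cutoff_mass_le1 (ltr0Sn R n); rewrite -lee_fin /Rintegral fineK//.
exact: integrable_fin_num.
Qed.

Lemma integrable_limit_density : mu2.-integrable setT (EFin \o f).
Proof.
apply/integrableP; split; first exact/measurable_EFinP.
under eq_integral => x _ do rewrite /= (ger0_norm (f_ge0 x)).
by rewrite (le_lt_trans integral_le1)// ltry.
Qed.

Let mass_gap (K e : R) : 0 < K -> 1 - e <= \int[mu2]_x (cutoff K x * f x) ->
  \int[mu2]_x f x - \int[mu2]_x (cutoff K x * f x) <= e.
Proof.
move=> K0 h; suff : \int[mu2]_x f x <= 1 by lra.
rewrite -lee_fin /Rintegral fineK//; exact: integrable_fin_num integrable_limit_density.
Qed.

(** Fatou gives at most one; tightness lets no mass escape to infinity, which gives at least 1 - e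
    for every e > 0. *)
Lemma integral_limit_density : (\int[mu2]_x (f x)%:E = 1)%E.
Proof.
have iF := integrable_limit_density.
have ff : (\int[mu2]_x (f x)%:E \is a fin_num)%E by exact: integrable_fin_num.
apply/eqP; rewrite eq_le integral_le1/= -(fineK ff) lee_fin.
apply/ler_addgt0Pr => e e0; have [K [N [K0 _ h]]] := tight_cutoff e0.
rewrite -lerBlDr (le_trans h)//; apply: le_Rintegral => //; first exact: icf.
by move=> x _; rewrite ler_piMl// cutoff_le1.
Qed.

(** The function g is replaced by its product with a cutoff on both sides. Each error is at most M
    times the mass lost by the cutoff, which tightness bounds for all large n and for the limit. *)
Lemma continuous_bounded_limit (g : R * R -> R) (M : R) : continuous g ->
  (forall x, `|g x| <= M) ->
  \int[P]_w g (U1 n w, U2 n w) @[n --> \oo] --> \int[mu2]_x (g x * f x).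
Proof.
move=> cg gM; have M0 : 0 <= M := le_trans (normr_ge0 _) (gM (0, 0)).
have mg : measurable_fun setT g by exact: measurable_continuous2.
apply/cvgrPdist_le => e e0; have e40 : 0 < e / 4 by rewrite divr_gt0.
pose e' := e / 4 / (M + 1); have e'0 : 0 < e' by rewrite divr_gt0// ltr_wpDl.
have Me : M * e' <= e / 4.
  by rewrite /e' mulrCA ler_piMr ?(ltW e40)// ler_pdivrMr ?ltr_wpDl// mul1r lerDl.
have [K [N [K0 hN hK]]] := tight_cutoff e'0.
have /cvgrPdist_le /(_ _ e40) [N1 _ hN1] := cutoff_limit cg gM K0.
exists (maxn N N1) => // n /=; rewrite geq_max => /andP[Nn N1n].
apply: (@dist_chain _ e _ (\int[mu2]_x (g x * cutoff K x * f x))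
  (\int[P]_w (g (U1 n w, U2 n w) * cutoff K (U1 n w, U2 n w)))).
- have ifg : mu2.-integrable setT (EFin \o (fun x => g x * f x)).
    apply: (@integrable_le _ _ _ mu2 _ (fun x => M * f x)).
    + exact: measurable_funM.
    + by move=> x; rewrite normrM (ger0_norm (f_ge0 x)) ler_wpM2r.
    + exact: integrable_scale integrable_limit_density.
  have icfg : mu2.-integrable setT (EFin \o (fun x => g x * cutoff K x * f x)).
    apply: (@integrable_le _ _ _ mu2 _ (fun x => M * (cutoff K x * f x))).
    + have /integrableP[/measurable_EFinP mcf _] := icf K0.
      by under eq_fun do rewrite -mulrA; exact: measurable_funM.
    + move=> x; rewrite -mulrA normrM (ger0_norm (mulr_ge0 (cutoff_ge0 _ _) (f_ge0 x))).
      by rewrite ler_wpM2r// mulr_ge0// cutoff_ge0.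
    + exact: integrable_scale (icf K0).
  have iC := integrable_lincomb M (- M) integrable_limit_density (icf K0).
  apply: (@le_trans _ _ (\int[mu2]_x (M * f x + (- M) * (cutoff K x * f x)))).
    apply: Rintegral_dist_le => // x.
    rewrite (_ : _ - _ = g x * ((1 - cutoff K x) * f x)); last by ring.
    rewrite [leRHS](_ : _ = M * ((1 - cutoff K x) * f x)); last by ring.
    have c1 : 0 <= (1 - cutoff K x) * f x by rewrite mulr_ge0 ?subr_ge0 ?cutoff_le1.
    by rewrite normrM (ger0_norm c1) ler_wpM2r.
  rewrite Rintegral_lincomb//; last 2 first.
  - exact: integrable_limit_density.
  - exact: icf.
  rewrite mulNr -mulrBr; apply: le_trans Me; rewrite ler_wpM2l//.
  exact: mass_gap.
- exact: hN1.
- have igU : P.-integrable setT (EFin \o (fun w => g (U1 n w, U2 n w))).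
    apply: (@bounded_integrable _ _ _ _ _ M); first exact: (measurableT_comp mg (mU n)).
    by move=> w; exact: gM.
  have igcU : P.-integrable setT (EFin \o (fun w => g (U1 n w, U2 n w) * cutoff K (U1 n w, U2 n w))).
    apply: (@bounded_integrable _ _ _ _ _ M).
      exact: (measurable_funM (measurableT_comp mg (mU n)) (mcU K n)).
    move=> w; rewrite normrM (ger0_norm (cutoff_ge0 _ _)).
    by rewrite (le_trans (ler_piMr _ (cutoff_le1 _ _))).
  have i1 := prob_integrable_cst P 1.
  have iC := integrable_lincomb M (- M) i1 (icU K n).
  apply: (@le_trans _ _ (\int[P]_w (M * 1 + (- M) * cutoff K (U1 n w, U2 n w)))).
    apply: Rintegral_dist_le => // w.
    rewrite (_ : _ - _ = - (g (U1 n w, U2 n w) * (1 - cutoff K (U1 n w, U2 n w)))); last by ring.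
    rewrite [leRHS](_ : _ = M * (1 - cutoff K (U1 n w, U2 n w))); last by ring.
    have c1 : 0 <= 1 - cutoff K (U1 n w, U2 n w) by rewrite subr_ge0 cutoff_le1.
    by rewrite normrN normrM (ger0_norm c1) ler_wpM2r.
  rewrite Rintegral_lincomb// prob_Rintegral_cst mulNr -mulrBr; apply: le_trans Me.
  by rewrite ler_wpM2l//; have := hN n Nn; lra.
Qed.

End continuous_bounded_limit.

Section density_limit.
Context {d} {Omega : measurableType d} {R : realType} (P : probability Omega R).
Local Notation mu := (@lebesgue_measure R).
Local Notation mu2 := (mu \x mu)%E.
Variables (U1 U2 : nat -> Omega -> R).
Hypotheses (mU1 : forall n, measurable_fun setT (U1 n)) (mU2 : forall n, measurable_fun setT (U2 n)).
Hypothesis tightU : forall e : R, 0 < e -> exists (K : R) (N : nat),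
  1 <= K /\ forall n, (N <= n)%N ->
    \int[P]_w Num.min 1 ((`|U1 n w| + `|U2 n w|) / K) <= e.
Hypothesis decayU : forall m, exists C : R, forall s t : R, exists N : nat, forall n, (N <= n)%N ->
  ((\int[P]_w cos (s * U1 n w + t * U2 n w)) ^+ 2 +
   (\int[P]_w sin (s * U1 n w + t * U2 n w)) ^+ 2) * (1 + `|s| + `|t|) ^+ m <= C.

Lemma density_limit : exists psi, strictly_increasing psi /\ exists f : R * R -> R,
  [/\ smooth2 f, forall x, 0 <= f x, (\int[mu2]_x (f x)%:E = 1)%E &
  forall (g : R * R -> R) (M : R), continuous g -> (forall x, `|g x| <= M) ->
    \int[P]_w g (U1 (psi k) w, U2 (psi k) w) @[k --> \oo] --> \int[mu2]_x (g x * f x)].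
Proof.
have [psi [hpsi cv]] := charfun_subsequence mU1 mU2 tightU.
exists psi; split=> //.
pose phi b th := lim (charfun P U1 U2 b (psi k) th @[k --> \oo]).
have cf_phi b th : charfun P (U1 \o psi) (U2 \o psi) b k th @[k --> \oo] --> phi b th.
  exact: cv.
have mV1 n : measurable_fun setT ((U1 \o psi) n) by exact: mU1.
have mV2 n : measurable_fun setT ((U2 \o psi) n) by exact: mU2.
have tightV (e : R) : 0 < e -> exists (K : R) (N : nat), 1 <= K /\ forall n, (N <= n)%N ->
    \int[P]_w Num.min 1 ((`|(U1 \o psi) n w| + `|(U2 \o psi) n w|) / K) <= e.
  move=> /tightU[K [N [K1 hN]]]; exists K, N; split=> // n Nn; apply: hN.
  exact: leq_trans Nn (strictly_increasing_ge hpsi n).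
have rphi b : rapid (phi b).
  split.
    apply: (measurable_fun_cvg (fun n => measurable_charfun P mV1 mV2 b n)) => th _.
    exact: cf_phi.
  (* The hypothesis bounds the squared modulus, so the exponent is doubled; from z^2 <= C follows z
     <= 1 + C. *)
  move=> m; have [C hC] := decayU (m * 2); exists (1 + C) => th.
  have [N hN] := hC th.1 th.2.
  set r := 1 + `|th.1| + `|th.2|.
  have r0 : 0 <= r ^+ m by rewrite exprn_ge0// !addr_ge0.
  have h : `|charfun P (U1 \o psi) (U2 \o psi) b k th| * r ^+ m @[k --> \oo] --> `|phi b th| * r ^+ m.
    by apply: cvgMl; apply: cvg_norm; exact: cf_phi.
  rewrite -(cvg_lim _ h)//; apply: limr_le; first exact: cvgP h.
  exists N => // k /= Nk.
  have := hN (psi k) (leq_trans Nk (strictly_increasing_ge hpsi k)).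
  rewrite exprM -/r; set x := (X in X ^+ 2 + _); set y := (X in _ + X ^+ 2) => hk.
  have : (`|charfun P (U1 \o psi) (U2 \o psi) b k th| * r ^+ m) ^+ 2 <= C.
    rewrite exprMn real_normK ?num_real//; apply: le_trans hk; rewrite ler_wpM2r ?sqr_ge0//.
    by rewrite /charfun /x /y; case: (b); rewrite /= ?lerDl ?lerDr sqr_ge0.
  have z0 : 0 <= `|charfun P (U1 \o psi) (U2 \o psi) b k th| * r ^+ m by rewrite mulr_ge0.
  move: z0; move: (_ * r ^+ m) => z z0; nra.
exists (limit_density phi); split.
- exact: limit_density_smooth.
- exact: (limit_density_ge0 mV1 mV2 cf_phi rphi).
- exact: (integral_limit_density mV1 mV2 tightV cf_phi rphi).
- move=> g M cg gM; exact: (continuous_bounded_limit mV1 mV2 tightV cf_phi rphi cg gM).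
Qed.

End density_limit.

(** * Null sets of the plane by sections *)

Section plane_null_sets.
Context {R : realType}.
Local Notation mu := (@lebesgue_measure R).
Local Notation mu2 := (mu \x mu)%E.
Implicit Types B : set (R * R).

Let integral_rows B : measurable B -> forall y,
  (\int[mu]_x (\1_B (x, y))%:E = mu [set x | B (x, y)])%E.
Proof.
move=> mB y; have mS : measurable [set x | B (x, y)].
  by have := pair2_measurable y measurableT mB; rewrite setTI.
have -> : mu [set x | B (x, y)] = (\int[mu]_x (\1_[set x | B (x, y)] x)%:E)%E.
  by rewrite integral_indic// setIT.
by apply: eq_integral => x _; rewrite !indicE; congr (_%:R%:E); congr nat_of_bool;
  apply/idP/idP; rewrite !inE.
Qed.

Let integral_columns B : measurable B -> forall x,
  (\int[mu]_y (\1_B (x, y))%:E = mu [set y | B (x, y)])%E.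
Proof.
move=> mB x; have mS : measurable [set y | B (x, y)].
  by have := pair1_measurable x measurableT mB; rewrite setTI.
have -> : mu [set y | B (x, y)] = (\int[mu]_y (\1_[set y | B (x, y)] y)%:E)%E.
  by rewrite integral_indic// setIT.
by apply: eq_integral => y _; rewrite !indicE; congr (_%:R%:E); congr nat_of_bool;
  apply/idP/idP; rewrite !inE.
Qed.

(** The row at height 0 may be left out since a point is null on the line; this spares the ratio its
    singular axis. *)
Lemma plane_null_rows B : measurable B ->
  (forall y, y != 0 -> mu [set x | B (x, y)] = 0%E) -> mu2 B = 0%E.
Proof.
move=> mB h.
have -> : mu2 B = (\int[mu2]_z (\1_B z)%:E)%E by rewrite integral_indic// setIT.
rewrite (@fubini_tonelli2 _ _ _ _ _ mu mu (EFin \o \1_B)); last 2 first.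
- by apply/measurable_EFinP; exact: measurable_indic.
- by move=> z; rewrite lee_fin.
rewrite (ae_eq_integral (cst 0%E))//; first by rewrite integral0.
- apply: measurable_fun_fubini_tonelli_G => //.
    by apply/measurable_EFinP; exact: measurable_indic.
  by move=> z; rewrite lee_fin.
exists [set 0]; split => //; first exact: lebesgue_measure_set1.
move=> y /= hy; apply: contrapT => /eqP y0; apply: hy => _.
exact: (etrans (integral_rows mB y) (h y y0)).
Qed.

Lemma plane_null_columns B : measurable B ->
  (forall x, mu [set y | B (x, y)] = 0%E) -> mu2 B = 0%E.
Proof.
move=> mB h.
have -> : mu2 B = (\int[mu2]_z (\1_B z)%:E)%E by rewrite integral_indic// setIT.
rewrite (@fubini_tonelli1 _ _ _ _ _ mu mu (EFin \o \1_B)); last 2 first.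
- by apply/measurable_EFinP; exact: measurable_indic.
- by move=> z; rewrite lee_fin.
rewrite (eq_integral (cst 0%E)); first by rewrite integral0.
by move=> x _; exact: (etrans (integral_columns mB x) (h x)).
Qed.

End plane_null_sets.

(** * The probability measure with a given density *)

Section density_probability.
Context {R : realType}.
Local Notation mu := (@lebesgue_measure R).
Local Notation mu2 := (mu \x mu)%E.
Local Notation plane := (measurableTypeR R * measurableTypeR R)%type.
Variable f : R * R -> R.
Hypotheses (f_ge0 : forall x, 0 <= f x) (mf : measurable_fun setT f).
Hypothesis int_f : (\int[mu2]_x (f x)%:E = 1)%E.

Let density_measure (A : set plane) : \bar R := (\int[mu2]_(x in A) (f x)%:E)%E.

Let if_ : mu2.-integrable setT (EFin \o f).
Proof.
apply/integrableP; split; first exact/measurable_EFinP.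
under eq_integral => x _ do rewrite /= (ger0_norm (f_ge0 x)).
by rewrite int_f ltry.
Qed.

Let density0 : density_measure set0 = 0%E.
Proof. by rewrite /density_measure integral_set0. Qed.

Let density_ge0 A : (0 <= density_measure A)%E.
Proof. by apply: integral_ge0 => x _; rewrite lee_fin. Qed.

Let density_sigma_additive : semi_sigma_additive density_measure.
Proof.
move=> /= A mA tA mUA; rewrite /density_measure/= integral_bigcup//=; last first.
  by apply: (integrableS _ _ (subsetT _)) => //; exact: if_.
apply: is_cvg_ereal_nneg_natsum_cond => n _ _.
by apply: integral_ge0 => /= x ?; rewrite lee_fin.
Qed.

Let density_setT : density_measure setT = 1%E.
Proof. exact: int_f. Qed.

Let density_isMeasure := isMeasure.Build _ _ _ density_measure density0 density_ge0
  density_sigma_additive.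

Let density_m := HB.pack_for {measure set plane -> \bar R} density_measure density_isMeasure.

Definition density_prob : probability plane R :=
  HB.pack_for (probability plane R) density_measure density_isMeasure
    (@Measure_isProbability.Build _ _ R density_m density_setT).

Lemma density_probE A : density_prob A = (\int[mu2]_(x in A) (f x)%:E)%E.
Proof. by []. Qed.

Lemma density_prob_null A : measurable A -> mu2 A = 0%E -> density_prob A = 0%E.
Proof.
move=> mA A0; rewrite density_probE null_set_integral//.
by apply/measurable_EFinP; exact: measurable_funTS.
Qed.

Let dom : density_prob `<< plane_measure.
Proof. by apply/null_content_dominatesP => A mA A0; exact: density_prob_null. Qed.

(** The Radon-Nikodym derivative has the same integral as f over every measurable set, so they agree
    almost everywhere, and the change of variables formula applies with f. *)
Lemma ge0_integral_density (g : R * R -> \bar R) : measurable_fun setT g ->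
  (forall x, (0 <= g x)%E) ->
  (\int[density_prob]_x g x = \int[mu2]_x (g x * (f x)%:E))%E.
Proof.
move=> mg g0.
rewrite -(Radon_Nikodym_SigmaFinite.change_of_variables dom g0 measurableT mg).
have ih := Radon_Nikodym_SigmaFinite.f_integrable dom.
have mh := measurable_int _ ih.
have hf : ae_eq mu2 setT (Radon_Nikodym_SigmaFinite.f density_prob plane_measure) (EFin \o f).
  apply: integral_ae_eq => //; first exact/measurable_EFinP.
  by move=> E _ mE; rewrite -(Radon_Nikodym_SigmaFinite.f_integral dom mE).
apply: ae_eq_integral => //.
- exact: emeasurable_funM.
- by apply: emeasurable_funM => //; exact/measurable_EFinP.
- by apply: filterS hf => x /= h /h ->.
Qed.

Lemma Rintegral_density (g : R * R -> R) (M : R) : measurable_fun setT g ->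
  (forall x, `|g x| <= M) -> \int[density_prob]_x g x = \int[mu2]_x (g x * f x).
Proof.
move=> mg gM.
have ig : density_prob.-integrable setT (EFin \o g) by apply: (@bounded_integrable _ _ _ _ _ M); [exact: mg|exact: gM].
have i1 : density_prob.-integrable setT (EFin \o (fun=> M)).
  by apply: (@bounded_integrable _ _ _ _ _ `|M|).
have igf : mu2.-integrable setT (EFin \o (fun x => g x * f x)).
  apply: (@integrable_le _ _ _ mu2 _ (fun x => M * f x)).
  - exact: measurable_funM.
  - by move=> x; rewrite normrM (ger0_norm (f_ge0 x)) ler_wpM2r.
  - exact: integrable_scale if_.
(* The shift by M reduces to the nonnegative case; both sides gain M because f has integral one. *)
have E : \int[density_prob]_x (g x + M) = \int[mu2]_x (1 * (g x * f x) + M * f x).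
  rewrite /Rintegral; congr fine.
  rewrite (@ge0_integral_density (fun x => (g x + M)%:E)).
  - by apply: eq_integral => x _; rewrite -EFinM mul1r mulrDl.
  - by apply/measurable_EFinP; exact: measurable_funD.
  - by move=> x; rewrite lee_fin; have := gM x; rewrite ler_norml => /andP[? _]; lra.
move: E; rewrite RintegralD// prob_Rintegral_cst Rintegral_lincomb// mul1r.
have -> : \int[mu2]_x f x = 1 by rewrite /Rintegral int_f.
by rewrite mulr1 => /addIr.
Qed.

End density_probability.

(** * The ratio *)

Section ratio.
Context {R : realType}.
Local Notation mu := (@lebesgue_measure R).
Local Notation mu2 := (mu \x mu)%E.

(** With the convention that 0 has inverse 0, the inverse is the pointwise limit of the continuous
    functions x / (x^2 + 1 / (n + 1)), at 0 as well. *)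
Lemma measurable_inv : measurable_fun setT (fun x : R => x^-1).
Proof.
have c0 (n : nat) (x : R) : x ^+ 2 + n.+1%:R^-1 != 0.
  by rewrite gt_eqF// ltr_wpDl ?sqr_ge0// invr_gt0.
apply: (@measurable_fun_cvg _ _ _ _ (fun n (x : R) => x * (x ^+ 2 + n.+1%:R^-1)^-1)).
  move=> n; apply: continuous_measurable_fun => x; apply: cvgM; first exact: cvg_id.
  apply: cvgV => //; apply: cvgD; last exact: cvg_cst.
  exact: exprn_continuous.
move=> x _; have [->|x0] := eqVneq x 0.
  by rewrite invr0; under eq_fun do rewrite mul0r; exact: cvg_cst.
rewrite -[X in _ --> X](_ : x * (x ^+ 2 + 0)^-1 = x^-1); last by rewrite addr0; field.
apply: cvgMr; apply: cvgV; first by rewrite addr0 sqrf_eq0.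
by apply: cvgD; [exact: cvg_cst|exact: cvg_harmonic].
Qed.

Lemma measurable_ratio d (T : measurableType d) (V1 V2 : T -> R) :
  measurable_fun setT V1 -> measurable_fun setT V2 -> measurable_fun setT (fun w => V1 w / V2 w).
Proof.
by move=> m1 m2; apply: measurable_funM => //; exact: (measurableT_comp measurable_inv m2).
Qed.

Let measurable_div : measurable_fun setT (fun x : R * R => x.1 / x.2).
Proof. by apply: measurable_ratio; [exact: measurable_fst|exact: measurable_snd]. Qed.

Lemma line_null (u v c : R) : (u, v) <> (0, 0) ->
  measurable [set x : R * R | u * x.1 + v * x.2 = c] /\
  mu2 [set x | u * x.1 + v * x.2 = c] = 0%E.
Proof.
move=> uv0; have mL : measurable [set x : R * R | u * x.1 + v * x.2 = c].
  have ml : measurable_fun setT (fun x : R * R => u * x.1 + v * x.2) by measurability.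
  by have := ml measurableT [set c] (measurable_set1 c); rewrite setTI.
split => //; have [u0|u0] := eqVneq u 0.
  have v0 : v != 0 by apply/eqP => v0; apply: uv0; rewrite u0 v0.
  apply: plane_null_columns => // x.
  rewrite (_ : [set y | _] = [set (c - u * x) / v]); first exact: lebesgue_measure_set1.
  apply/seteqP; split => y /=; first by move=> <-; field.
  by move=> ->; field.
apply: plane_null_rows => // y _.
rewrite (_ : [set x | _] = [set (c - v * y) / u]); first exact: lebesgue_measure_set1.
apply/seteqP; split => x /=; first by move=> <-; field.
by move=> ->; field.
Qed.

(** On the row at height y != 0 the section is the image of the null set under multiplication by
    y. *)
Lemma ratio_null (A : set R) : measurable A -> mu A = 0%E ->
  mu2 [set x | A (x.1 / x.2)] = 0%E.
Proof.
move=> mA A0; apply: plane_null_rows.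
  by have := measurable_div measurableT mA; rewrite setTI.
move=> y y0; have yV0 : y^-1 != 0 by rewrite invr_eq0.
have := lebesgue_measure_affine 0 yV0 mA; rewrite A0 => /esym/eqP.
rewrite mule_eq0 eqe normr_eq0 (negbTE yV0)/= => /eqP <-; congr (mu _).
by apply/seteqP; split => x /=; rewrite addr0 mulrC.
Qed.

(** A continuous approximation of the indicator of the axis {x.2 = 0}, where the ratio is
    discontinuous; it tends pointwise to that indicator. *)
Definition near_axis (k : nat) (x : R * R) : R := tent (x.2 * k.+1%:R).

Lemma near_axis_ge0 k x : 0 <= near_axis k x. Proof. exact: tent_ge0. Qed.

Lemma near_axis_le1 k x : near_axis k x <= 1. Proof. exact: tent_le1. Qed.

Lemma continuous_near_axis k : continuous (near_axis k).
Proof.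
move=> x; apply: (@cvg_comp _ _ _ _ tent _ _ _ _ (@continuous_tent R _)).
by apply: cvgMl; exact: cvg_snd.
Qed.

(** At points of the axis continuity comes from the factor 1 - [near_axis], which tends to 0 there
    while g stays bounded. *)
Lemma continuous_off_axis (g : R -> R) (M : R) k : continuous g -> (forall y, `|g y| <= M) ->
  continuous (fun x : R * R => g (x.1 / x.2) * (1 - near_axis k x)).
Proof.
move=> cg gM x; have M0 : 0 <= M := le_trans (normr_ge0 _) (gM 0).
have c1 : (1 - near_axis k y) @[y --> x] --> 1 - near_axis k x.
  by apply: cvgB; [exact: cvg_cst|exact: continuous_near_axis].
have [x20|x20] := eqVneq x.2 0; last first.
  apply: cvgM => //; apply: (@cvg_comp _ _ _ _ g _ _ _ _ (cg _)).
  by apply: cvgM; [exact: cvg_fst|apply: cvgV => //; exact: cvg_snd].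
have n1 : near_axis k x = 1 by rewrite /near_axis x20 mul0r /tent normr0 subr0 max_r.
rewrite n1 subrr in c1.
have Gx : g (x.1 / x.2) * (1 - near_axis k x) = 0 by rewrite n1 subrr mulr0.
apply/cvgrPdist_le => e e0 /=; rewrite Gx; have e'0 : 0 < e / (M + 1) by rewrite divr_gt0// ltr_wpDl.
move/cvgrPdist_le : c1 => /(_ _ e'0); apply: filterS => y.
rewrite !sub0r !normrN normrM ler_pdivlMr ?ltr_wpDl// => h.
apply: le_trans h; rewrite mulrC ler_wpM2l//.
by rewrite (le_trans (gM _))// lerDl.
Qed.

Variable f : R * R -> R.
Hypotheses (f_ge0 : forall x, 0 <= f x) (mf : measurable_fun setT f).
Hypothesis int_f : (\int[mu2]_x (f x)%:E = 1)%E.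

Let if_ : mu2.-integrable setT (EFin \o f).
Proof.
apply/integrableP; split; first exact/measurable_EFinP.
under eq_integral => x _ do rewrite /= (ger0_norm (f_ge0 x)).
by rewrite int_f ltry.
Qed.

Let ibf (h : R * R -> R) (M : R) : measurable_fun setT h -> (forall x, `|h x| <= M) ->
  mu2.-integrable setT (EFin \o (fun x => h x * f x)).
Proof.
move=> mh hM; apply: (@integrable_le _ _ _ mu2 _ (fun x => M * f x)).
- exact: measurable_funM.
- by move=> x; rewrite normrM (ger0_norm (f_ge0 x)) ler_wpM2r.
- exact: integrable_scale if_.
Qed.

Let mna k : measurable_fun setT (near_axis k).
Proof. exact: measurable_continuous2 (@continuous_near_axis k). Qed.

Let near_axis_cvg0 : \int[mu2]_x (near_axis k x * f x) @[k --> \oo] --> (0 : R).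
Proof.
have nz : ((0, 1) : R * R) <> (0, 0) by move=> /(congr1 snd)/= /eqP; rewrite oner_eq0.
have [mL L0] := line_null 0 nz.
pose L := [set x : R * R | 0 * x.1 + 1 * x.2 = 0].
have h : \int[mu2]_x (near_axis k x * f x) @[k --> \oo] --> \int[mu2]_x (\1_L x * f x).
  apply: (@Rintegral_dominated_cvg _ _ _ mu2 _ _ f) => //.
  - by move=> k; apply: measurable_funM; [exact: mna|exact: mf].
  - move=> x; apply: cvgMl; rewrite indicE; have [xL|xL] := pselect (L x).
      rewrite mem_set//; move: xL; rewrite /L/= mul0r add0r mul1r => xL.
      have -> : (fun k => near_axis k x) = (fun=> 1).
        by apply/funext => k; rewrite /near_axis xL mul0r /tent normr0 subr0 max_r.
      exact: cvg_cst.
    rewrite memNset//; have x20 : 0 < `|x.2|.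
      by rewrite normr_gt0; apply/eqP => h; apply: xL; rewrite /L/= h mul0r mul1r addr0.
    apply/cvgrPdist_le => e e0; exists (Num.Def.archi_bound (`|x.2|^-1)) => // k /= hk.
    rewrite /near_axis tent_eq0 ?subr0 ?normr0 ?(ltW e0)//.
    rewrite normrM (@ger0_norm _ k.+1%:R)// mulrC -ler_pdivrMr// mul1r.
    apply: (@le_trans _ _ (Num.Def.archi_bound (`|x.2|^-1))%:R).
      by rewrite ltW// archi_boundP// invr_ge0.
    by rewrite ler_nat leqW.
  - by move=> k x; rewrite normrM !ger0_norm ?near_axis_ge0// ler_piMl// near_axis_le1.
suff <- : \int[mu2]_x (\1_L x * f x) = 0 by [].
rewrite /Rintegral (ae_eq_integral (cst 0%E))//; first by rewrite integral0.
  by apply/measurable_EFinP; apply: measurable_funM.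
exists L; split => //= x /= hx; apply: contrapT => nL; apply: hx => _.
by rewrite indicE memNset// mul0r.
Qed.

(** Removing a neighbourhood of the axis makes the test function continuous, at a cost of at most M
    times [near_axis]. The latter is itself continuous and bounded, so its expectation converges to
    a limit that is small because the axis is null. *)
Lemma ratio_limit d (Omega : measurableType d) (P : probability Omega R)
    (V1 V2 : nat -> Omega -> R) (g : R -> R) (M : R) :
  (forall n, measurable_fun setT (V1 n)) -> (forall n, measurable_fun setT (V2 n)) ->
  (forall (h : R * R -> R) (K : R), continuous h -> (forall x, `|h x| <= K) ->
    \int[P]_w h (V1 n w, V2 n w) @[n --> \oo] --> \int[mu2]_x (h x * f x)) ->
  continuous g -> (forall y, `|g y| <= M) ->
  \int[P]_w g (V1 n w / V2 n w) @[n --> \oo] --> \int[mu2]_x (g (x.1 / x.2) * f x).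
Proof.
move=> mV1 mV2 cV cg gM; have M0 : 0 <= M := le_trans (normr_ge0 _) (gM 0).
have mg : measurable_fun setT g by exact: continuous_measurable_fun.
apply/cvgrPdist_le => e e0; have e40 : 0 < e / 4 by rewrite divr_gt0.
(* The limiting mass near the axis is at most e', hence the mass for large n at most 2 e'. *)
pose e' := e / 4 / (2 * M + 1).
have e'0 : 0 < e' by rewrite divr_gt0// ltr_wpDl// mulr_ge0.
have Me : M * (2 * e') <= e / 4.
  rewrite mulrCA mulrA /e' mulrCA ler_piMr ?(ltW e40)//.
  by rewrite ler_pdivrMr ?ltr_wpDl ?mulr_ge0// mul1r lerDl.
have /cvgrPdist_le /(_ _ e'0) [k _ /(_ k (leqnn k))] := near_axis_cvg0.
rewrite sub0r normrN => /(le_trans (ler_norm _)) hk.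
pose G x := g (x.1 / x.2) * (1 - near_axis k x).
have cG : continuous G by exact: continuous_off_axis.
have mG := measurable_continuous2 cG.
have na1 x : `|1 - near_axis k x| <= 1.
  rewrite ger0_norm ?subr_ge0 ?near_axis_le1// gerBl near_axis_ge0//.
have GM x : `|G x| <= M by rewrite normrM (le_trans (ler_piMr _ (na1 x))).
have gG x : `|g (x.1 / x.2) - G x| <= M * near_axis k x.
  rewrite (_ : _ - _ = g (x.1 / x.2) * near_axis k x); last by rewrite /G; ring.
  by rewrite normrM (ger0_norm (near_axis_ge0 _ _)) ler_wpM2r// near_axis_ge0.
have /cvgrPdist_le /(_ _ e40) [N1 _ hN1] := cV G M cG GM.
have na1' x : `|near_axis k x| <= 1 by rewrite ger0_norm ?near_axis_ge0 ?near_axis_le1.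
have /cvgrPdist_le /(_ _ e'0) [N2 _ hN2] := cV _ 1 (@continuous_near_axis k) na1'.
exists (maxn N1 N2) => // n /=; rewrite geq_max => /andP[N1n N2n].
have mV : measurable_fun setT (fun w => (V1 n w, V2 n w)) by exact: measurable_fun_pair.
have mgr : measurable_fun setT (fun x : R * R => g (x.1 / x.2)).
  exact: (measurableT_comp mg measurable_div).
apply: (@dist_chain _ e _ (\int[mu2]_x (G x * f x)) (\int[P]_w G (V1 n w, V2 n w))).
- have i1 := ibf mgr (fun x => gM (x.1 / x.2)); have i2 := ibf mG GM.
  have i3 := ibf (mna k) na1'.
  apply: (@le_trans _ _ (\int[mu2]_x (M * (near_axis k x * f x)))).
    apply: Rintegral_dist_le => //; first exact: integrable_scale.
    by move=> x; rewrite -mulrBl normrM (ger0_norm (f_ge0 x)) mulrA ler_wpM2r.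
  rewrite RintegralZl//; apply: le_trans Me; rewrite ler_wpM2l//.
  by apply: (le_trans hk); lra.
- exact: hN1.
- have i1 : P.-integrable setT (EFin \o (fun w => g (V1 n w / V2 n w))).
    apply: (@bounded_integrable _ _ _ _ _ M); last by move=> w; exact: gM.
    exact: (measurableT_comp mgr mV).
  have i2 : P.-integrable setT (EFin \o (fun w => G (V1 n w, V2 n w))).
    apply: (@bounded_integrable _ _ _ _ _ M); last by move=> w; exact: GM.
    exact: (measurableT_comp mG mV).
  have i3 : P.-integrable setT (EFin \o (fun w => near_axis k (V1 n w, V2 n w))).
    apply: (@bounded_integrable _ _ _ _ _ 1); last by move=> w; exact: na1'.
    exact: (measurableT_comp (mna k) mV).
  apply: (@le_trans _ _ (\int[P]_w (M * near_axis k (V1 n w, V2 n w)))).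
    apply: Rintegral_dist_le => //; first exact: integrable_scale.
    by move=> w; rewrite distrC; exact: (gG (V1 n w, V2 n w)).
  rewrite RintegralZl//; apply: le_trans Me; rewrite ler_wpM2l//.
  have := hN2 n N2n; rewrite ler_norml => /andP[h1 h2]; lra.
Qed.

(** By [ratio_null] the law of the ratio is absolutely continuous, and Radon-Nikodym supplies its
    density. *)
Lemma ratio_density : exists f_T : R -> R,
  has_density (density_prob f_ge0 mf int_f) mu (fun x => x.1 / x.2) f_T.
Proof.
have mdiv : measurable_fun (setT : set (measurableTypeR R * measurableTypeR R))
    (fun x => x.1 / x.2 : measurableTypeR R) by exact: measurable_div.
pose nu := law (density_prob f_ge0 mf int_f) mdiv.
have nuE A : nu A = density_prob f_ge0 mf int_f [set x | A (x.1 / x.2)] by [].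
have dom : nu `<< mu.
  apply/null_content_dominatesP => A mA A0; rewrite nuE; apply: density_prob_null.
    by have := measurable_div measurableT mA; rewrite setTI.
  exact: ratio_null.
have [h [h0 hfin ih hE]] := @radon_nikodym_sigma_finite _ (measurableTypeR R) R _ nu dom.
exists (fine \o h); split.
- by apply: measurableT_comp => //; exact: measurable_int ih.
- by move=> x; rewrite fine_ge0.
- move=> A mA; rewrite -[LHS]/(nu A) hE//; apply: eq_integral => x _.
  by rewrite /= fineK.
Qed.

End ratio.

Theorem theorem3 (R : realType) (d : measure_display)
    (Omega : measurableType d) (P : probability Omega R)
    (X Y : {RV P >-> R}) (X_ Y_ : nat -> {RV P >-> R})
    (indepXY : independent_rvs P X Y)
    (X_nondegenerate : nondegenerate_rv P X)
    (X_integrable : ('E_P[fun w => `|X w|%R] < +oo)%E)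
    (Y_pos : (0 < P [set w | (0 < Y w)%R])%E)
    (Y_ge0 : P [set w | 0 <= Y w] = 1%E)
    (iidXY : iid_copies P P (fun w => (X w, Y w))
                            (fun i w => (X_ i w, Y_ i w)))
    (Y_feller : centered_feller_class Y) :
  let W1_ n w := \sum_(i < n) X_ i w * Y_ i w in
  let W2_ n w := \sum_(i < n) Y_ i w in
  let T_ n w := W1_ n w / W2_ n w in
  exists a : nat -> R,
  [/\ forall n, 0 < a n, a n @[n --> \oo] --> +oo &
  forall phi, strictly_increasing phi ->
  exists psi, strictly_increasing psi /\
  let n' k := phi (psi k) in
  exists (d' : measure_display) (Omega' : measurableType d')
    (Q : probability Omega' R) (W1 W2 : {RV Q >-> R}),
    [/\ cvg_in_distribution P Q
          (fun k w => (W1_ (n' k) w / a (n' k), W2_ (n' k) w / a (n' k)))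
          (fun w => (W1 w, W2 w)),
        nondegenerate_rvector Q W1 W2,
        exists f : R * R -> R, smooth2 f /\
          has_density Q (lebesgue_measure2 R) (fun w => (W1 w, W2 w)) f,
        cvg_in_distribution P Q
          (fun k => T_ (n' k))
          (fun w => W1 w / W2 w) &
        exists f_T : R -> R,
          has_density Q (@lebesgue_measure R) (fun w => W1 w / W2 w) f_T]].
Proof.
case: Y_feller => a fellerY W1_ W2_ T_.
(* The norming constants of the Feller condition for Y also norm the pair. *)
have [a_gt0 a_oo _] := fellerY; exists a; split=> // phi hphi.
pose V1 n w := W1_ (phi n) w / a (phi n); pose V2 n w := W2_ (phi n) w / a (phi n).
have mX i : measurable_fun setT (X_ i) by exact: measurable_funP.
have mY i : measurable_fun setT (Y_ i) by exact: measurable_funP.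
have mV1 n : measurable_fun setT (V1 n).
  apply: measurable_funM => //; apply: measurable_sum => i.
  exact: (measurable_funM (mX i) (mY i)).
have mV2 n : measurable_fun setT (V2 n).
  by apply: measurable_funM => //; apply: measurable_sum => i; exact: mY.
have tightV (e : R) : 0 < e -> exists (K : R) (N : nat), 1 <= K /\ forall n, (N <= n)%N ->
    \int[P]_w Num.min 1 ((`|V1 n w| + `|V2 n w|) / K) <= e.
  move=> e0; have [K [N [K1 hN]]] := partial_sums_tight indepXY X_integrable Y_ge0 iidXY fellerY e0.
  by exists K, N; split=> // n Nn; apply: hN; exact: leq_trans Nn (strictly_increasing_ge hphi n).
have decayV m : exists C : R, forall s t : R, exists N : nat, forall n, (N <= n)%N ->
    ((\int[P]_w cos (s * V1 n w + t * V2 n w)) ^+ 2 +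
     (\int[P]_w sin (s * V1 n w + t * V2 n w)) ^+ 2) * (1 + `|s| + `|t|) ^+ m <= C.
  have [C hC] := charfun_rapid_decay indepXY X_nondegenerate Y_ge0 Y_pos iidXY fellerY m.
  exists C => s t; have [N hN] := hC s t; exists N => n Nn; apply: hN.
  exact: leq_trans Nn (strictly_increasing_ge hphi n).
have [psi [hpsi [f [sf f_ge0 int_f f_lim]]]] := density_limit mV1 mV2 tightV decayV.
exists psi; split=> // n'.
have cf : continuous f by have [] := sf 0%N.
have mf : measurable_fun setT f by exact: measurable_continuous2.
(* The limit vector is realized canonically: the plane carries the limit law, and W1, W2 are the
   coordinates. *)
pose Q := density_prob f_ge0 mf int_f.
pose plane : measurableType _ := (measurableTypeR R * measurableTypeR R)%type.
have m1 : measurable_fun (setT : set plane) (fst : plane -> R) by exact: measurable_fst.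
have m2 : measurable_fun (setT : set plane) (snd : plane -> R) by exact: measurable_snd.
pose W1 : {RV Q >-> R} := HB.pack_for {mfun plane >-> R} (fst : plane -> R)
  (isMeasurableFun.Build _ _ _ _ _ m1).
pose W2 : {RV Q >-> R} := HB.pack_for {mfun plane >-> R} (snd : plane -> R)
  (isMeasurableFun.Build _ _ _ _ _ m2).
exists _, plane, Q, W1, W2; split.
- move=> g cg [M gM]; have mg := measurable_continuous2 cg.
  have -> : 'E_Q[fun w => g (W1 w, W2 w)]%E = (\int[lebesgue_measure2 R]_x (g x * f x))%:E.
    rewrite expectation_Rintegral; last first.
      by apply: (@bounded_integrable _ _ _ _ _ M); [|move=> w; exact: gM];
        exact: (measurableT_comp mg (measurable_fun_pair m1 m2)).
    congr EFin; rewrite -[RHS](Rintegral_density f_ge0 mf int_f mg gM).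
    by apply: eq_Rintegral => -[].
  have -> : (fun k => 'E_P[fun w => (g (W1_ (n' k) w / a (n' k), W2_ (n' k) w / a (n' k)))%R]%E) =
      (fun k => (\int[P]_w g (V1 (psi k) w, V2 (psi k) w))%:E).
    apply/funext => k; rewrite expectation_Rintegral//.
    apply: (@bounded_integrable _ _ _ _ _ M); last by move=> w; exact: gM.
    by apply: (measurableT_comp mg); exact: (measurable_fun_pair (mV1 (psi k)) (mV2 (psi k))).
  by apply: cvg_EFin; [exact: nearW|exact: f_lim cg gM].
(* A line is Lebesgue null, so the limit law gives it probability zero. *)
- move=> u v c uv0; have [mL L0] := line_null c uv0.
  by rewrite (density_prob_null f_ge0 mf int_f mL L0) lte01.
- exists f; split=> //; split=> // A mA; rewrite /Q.
  rewrite -[RHS](density_probE f_ge0 mf int_f); congr (density_prob _ _ _ _).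
  by apply/seteqP; split => -[].
- move=> g cg [M gM]; have mg := continuous_measurable_fun cg.
  have mgr : measurable_fun setT (fun x : R * R => g (x.1 / x.2)).
    by apply: (measurableT_comp mg); apply: measurable_ratio;
      [exact: measurable_fst|exact: measurable_snd].
  have -> : 'E_Q[fun w => (g (W1 w / W2 w))%R]%E =
      (\int[lebesgue_measure2 R]_x (g (x.1 / x.2) * f x))%:E.
    rewrite expectation_Rintegral; last first.
      by apply: (@bounded_integrable _ _ _ _ _ M); [exact: mgr|move=> w; exact: gM].
    congr EFin.
    exact: (Rintegral_density f_ge0 mf int_f mgr (fun x => gM (x.1 / x.2))).
  have -> : (fun k => 'E_P[fun w => g (T_ (n' k) w)]%E) =
      (fun k => (\int[P]_w g (V1 (psi k) w / V2 (psi k) w))%:E).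
    apply/funext => k.
    (* The common factor a_n cancels. When the denominator vanishes both ratios are 0, since
       division by zero returns 0, in accordance with the convention 0/0 := 0. *)
    have -> : (fun w => g (T_ (n' k) w)) = (fun w => g (V1 (psi k) w / V2 (psi k) w)).
      apply/funext => w; congr g; rewrite /T_ /V1 /V2 -/(n' k) invf_div mulrA.
      by rewrite mulfVK// gt_eqF.
    rewrite expectation_Rintegral//.
    apply: (@bounded_integrable _ _ _ _ _ M); last by move=> w; exact: gM.
    exact: (measurableT_comp mg (measurable_ratio (mV1 (psi k)) (mV2 (psi k)))).
  apply: cvg_EFin; first exact: nearW.
  apply: (ratio_limit f_ge0 mf int_f (V1 := V1 \o psi) (V2 := V2 \o psi) _ _ _ cg gM).
  + by move=> n; exact: mV1.
  + by move=> n; exact: mV2.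
  + by move=> h K ch hK; exact: f_lim ch hK.
- exact: ratio_density.
Qed.
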